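(* For even $k\geq 4$, the differential equation $$f''(z)-\frac{k+1}{2}\mathcal{E}_2(z)f'(z)+\frac{k(k+1)}{4}\mathcal{E}_2'(z)f(z)=0$$ has solutions which are normalized modular forms of weight $k$ on $\Gamma_0(2)$, a generator of which is given by $$e_2^{\frac{k}{2}}\,F\left(-\frac{k}{4},-\frac{k-2}{4};-\frac{k-1}{2};\frac{64}{j_2}\right).$$
   Context: Here $z$ is in the upper half plane, $q=e^{2\pi i z}$, and $'$ denotes $\frac{1}{2\pi i}\frac{d}{dz}=q\frac{d}{dq}$. $\Gamma_0(2)$ is the subgroup of $SL_2(\mathbb{Z})$ of matrices with even lower left entry. Define $$\mathcal{E}_2=1+8\sum_{n\ge1}\frac{(-1)^{n-1}nq^n}{1-q^n},\quad e_2=1+24\sum_{n\ge1}\frac{nq^n}{1+q^n},\quad \mathcal{E}_4=1-16\sum_{n\ge1}\frac{(-1)^{n-1}n^3q^n}{1-q^n},$$ $$D=\frac{e_2^2-\mathcal{E}_4}{64}=q+8q^2+\cdots,\qquad j_2=\frac{e_2^2}{D}.$$ $F(a,b;c;x)=\sum_{n\ge0}\frac{(a)_n(b)_n}{(c)_n}\frac{x^n}{n!}$ is the Gaussian hypergeometric series with $(a)_n=a(a+1)\cdots(a+n-1)$. For even $k\ge 4$ the series above terminates, so the displayed function is the polynomial $$\sum_{0\le i\le k/4}\frac{(-\frac{k}{4})_i(-\frac{k-2}{4})_i}{(-\frac{k-1}{2})_i\,i!}\,64^i D^i e_2^{\frac{k}{2}-2i}$$ in $e_2$ and $D$, whose $q$-expansion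 has constant term $1$. *)

(* Defs.v *)
From Stdlib Require Export Reals ZArith.
From Coquelicot Require Export Coquelicot.
Open Scope R_scope.

Definition CN (n : nat) : C := RtoC (INR n).
Definition CZ (n : Z) : C := RtoC (IZR n).

Definition Cexp (z : C) : C :=
  (exp (Re z) * cos (Im z), exp (Re z) * sin (Im z)).

(* Coquelicot's total operator [Series] is real-valued; a complex series
   converges if and only if its real and imaginary parts both do. *)
Definition CSeries (a : nat -> C) : C :=
  (Series (fun n => Re (a n)), Series (fun n => Im (a n))).

(* sum over n >= 1 *)
Definition CSeries1 (a : nat -> C) : C := CSeries (fun m => a (S m)).

Definition C_sum (a : nat -> C) (N : nat) : C := sum_n (G := C_AbelianMonoid) a N.

Definition is_C_series (a : nat -> C) (l : C) : Prop :=
  is_series (K := C_AbsRing) (V := C_NormedModule) a l.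

Definition C_differentiable (f : C -> C) (z : C) : Prop :=
  ex_derive (K := C_AbsRing) (V := C_NormedModule) f z.

(* Functions on the upper half plane are represented by functions on C of
   which only the values on [upper] matter. *)
Definition upper (z : C) : Prop := 0 < Im z.

(* e^(2 pi i z / N) *)
Definition q_ (N : nat) (z : C) : C := Cexp (2 * PI * Ci * z / CN N)%C.
Definition q (z : C) : C := q_ 1 z.

(* (1 / (2 pi i)) d/dz *)
Definition qD (f : C -> C) (z : C) : C := (C_derive f z / (2 * PI * Ci))%C.

Definition cE2 (z : C) : C :=
  (1 + 8 * CSeries1 (fun n => RtoC (-1) ^ (n - 1) * CN n * q z ^ n / (1 - q z ^ n)))%C.

Definition e2 (z : C) : C :=
  (1 + 24 * CSeries1 (fun n => CN n * q z ^ n / (1 + q z ^ n)))%C.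

Definition cE4 (z : C) : C :=
  (1 - 16 * CSeries1 (fun n => RtoC (-1) ^ (n - 1) * CN n ^ 3 * q z ^ n / (1 - q z ^ n)))%C.

Definition D (z : C) : C := ((e2 z ^ 2 - cE4 z) / 64)%C.

Definition j2 (z : C) : C := (e2 z ^ 2 / D z)%C.

Fixpoint poch (a : C) (n : nat) : C :=
  match n with
  | O => 1%R
  | S m => (poch a m * (a + CN m))%C
  end.

Definition hyperF (a b c x : C) : C :=
  CSeries (fun n => poch a n * poch b n / poch c n * (x ^ n / CN (fact n)))%C.

Record SL2Z := mkSL2Z {
  m_a : Z; m_b : Z; m_c : Z; m_d : Z;
  m_det : (m_a * m_d - m_b * m_c = 1)%Z
}.

Definition Gamma0_2 (g : SL2Z) : Prop := Z.Even (m_c g).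

Definition autj (g : SL2Z) (z : C) : C := (CZ (m_c g) * z + CZ (m_d g))%C.

Definition mobius (g : SL2Z) (z : C) : C :=
  ((CZ (m_a g) * z + CZ (m_b g)) / autj g z)%C.

Definition slash (k : nat) (f : C -> C) (g : SL2Z) (z : C) : C :=
  (f (mobius g z) / autj g z ^ k)%C.

(* f = sum_(n >= 0) a_n e^(2 pi i n z / N) on the upper half plane *)
Definition has_q_expansion (N : nat) (f : C -> C) (a : nat -> C) : Prop :=
  forall z, upper z -> is_C_series (fun n => a n * q_ N z ^ n)%C (f z).

(* Holomorphy at the cusps: Gamma_0(2) contains Gamma(2), which is normal in
   SL_2(Z), so each f|g is invariant under z -> z + 2 and its Fourier expansion
   is in powers of e^(pi i z); no negative powers are allowed. *)
Definition modular_form (k : nat) (f : C -> C) : Prop :=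
  (forall z, upper z -> C_differentiable f z) /\
  (forall g, Gamma0_2 g -> forall z, upper z -> slash k f g z = f z) /\
  (forall g, exists a, has_q_expansion 2 (slash k f g) a).

(* The q-expansion at infinity has constant term 1. *)
Definition normalized (f : C -> C) : Prop :=
  exists a, has_q_expansion 1 f a /\ a O = RtoC 1.

(* The differentiability clauses ensure that the values of the total operator
   [qD] are genuine derivatives. *)
Definition ode_solution (k : nat) (f : C -> C) : Prop :=
  forall z, upper z ->
    C_differentiable f z /\ C_differentiable (qD f) z /\
    C_differentiable cE2 z /\
    (qD (qD f) z - (CN k + 1) / 2 * cE2 z * qD f z
       + CN k * (CN k + 1) / 4 * qD cE2 z * f z = 0)%C.

Definition hyp_a (k : nat) : C := (- (CN k / 4))%C.
Definition hyp_b (k : nat) : C := (- ((CN k - 2) / 4))%C.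
Definition hyp_c (k : nat) : C := (- ((CN k - 1) / 2))%C.

(* e_2^(k/2) F(-k/4, -(k-2)/4; -(k-1)/2; 64/j_2) as a polynomial in e_2 and D,
   which also makes sense at the zeros of e_2. *)
Definition hyp_form (k : nat) (z : C) : C :=
  C_sum (fun i =>
    poch (hyp_a k) i * poch (hyp_b k) i / (poch (hyp_c k) i * CN (fact i))
      * 64 ^ i * D z ^ i * e2 z ^ (k / 2 - 2 * i))%C (k / 4).

(* Main.v *)
(* Let [alpha(p) = 1/2 + 2 sum p^n / (1 + p^(2n))], and let [a], [b] be the squares of [alpha] at
   [p = e^(pi i z)] and at [-p].  When [alpha^2] is expanded as a double series over [Z x Z], the
   partial fraction [1/((1+u)(1+v)) = (1/(1+u) - 1/(1+1/v))/(1-uv)] makes every row telescope.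
   This gives Jacobi's four-square theorem and, in the same way, [a' = 2a(P/4 - b)] and
   [b' = 2b(P/4 - a)] for [P = cE2]; moreover [e2 = 2(a+b)] and [D = (a-b)^2/16].  The identities
   [cE4 = 16ab] and [P' = (P^2 - cE4)/4] follow because the defect of each satisfies
   [h(q) = K h(q^2)] and [h(q) = O(q)], hence vanishes.

   On the imaginary axis, doubling and halving [z] are steps of the arithmetic-geometric mean, and
   comparing limits yields [alpha(i/y) = y alpha(iy)].  The differential system for [a, b, P] is
   stable under [z -> -1/z], so the agreement at [i] propagates along segments by uniqueness of
   solutions.  The Euclidean algorithm then gives the action of all of [SL_2(Z)].

   In the ring generated by [P], [e2], [D] the equation becomes Legendre's equation in [e2], whose
   polynomial solution is the hypergeometric one.  The indicial exponents in [q] are [0] and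
   [(k+1)/2]; for even [k] the second one is incompatible with invariance under [z -> z + 1], so the
   modular solutions form a line. *)
Require Import Defs.
From Stdlib Require Import List FinFun Lra Lia Classical ClassicalEpsilon FunctionalExtensionality.
Import ListNotations.
Open Scope R_scope.

(** * Unordered sums *)

(** Unordered sums are used because the core argument regroups one absolutely convergent double
    series in several ways: by diagonals of [Z x Z], by divisors and by degree. Two nomes coexist.
    In [p = e^(pi i z)] translation by 1 is [p -> -p], which swaps [a] and [b], and inversion acts
    on [a], [b] linearly up to the factor [- z^2]; in [q = p^2] the forms on the group visibly have
    integral powers. Classically [a], [b], [a - b] are [theta_3^4 / 4], [theta_4^4 / 4],
    [theta_2^4 / 4]. Uniqueness for the differential system needs three initial values at [i]: those
    of [a] and [b] come from the mean iteration, that of [P] from differentiating the functional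
    equation of [a] at its fixed point. With [Q = e2^2 - 64 D = cE4] the system reads [D' = P D],
    [e2' = (P e2 - Q) / 2], [P' = (P^2 - Q) / 4]. For an isobaric polynomial [f] in [e2], [D] of
    weight [k = 2m] all terms in [P] cancel from the equation; what remains is [Q / 4] times
    [Q f_ee + 2 e2 f_e - m (m + 1) f], which is Legendre's equation of degree [m] in
    [e2 / (8 sqrt D)]. *)

Definition lsum {I : Type} (F : I -> C) (s : list I) : C :=
  fold_right (fun i acc => (F i + acc)%C) (RtoC 0) s.

Definition rsum {I : Type} (f : I -> R) (s : list I) : R :=
  fold_right (fun i acc => f i + acc) 0 s.

(** Convergence along the finite duplicate-free lists, directed by inclusion. No order on the index
    type is involved, so sums over [nat], pairs and [Z] share one theory and may be reindexed
    freely. *)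
Definition hasSum {I : Type} (F : I -> C) (l : C) : Prop :=
  forall eps, 0 < eps -> exists s0 : list I, forall s, NoDup s -> incl s0 s ->
    Cmod (lsum F s - l) < eps.

Definition bddSum {I : Type} (f : I -> R) : Prop :=
  exists M, forall s, NoDup s -> rsum f s <= M.

Definition absSum {I : Type} (F : I -> C) : Prop := bddSum (fun i => Cmod (F i)).

Definition cdec {I : Type} (i j : I) : {i = j} + {i <> j} :=
  excluded_middle_informative (i = j).

Lemma lsum_app {I : Type} (F : I -> C) s t : lsum F (s ++ t) = (lsum F s + lsum F t)%C.
Proof. induction s as [|i s IH]; simpl; [|rewrite IH]; ring. Qed.

Lemma rsum_app {I : Type} (f : I -> R) s t : rsum f (s ++ t) = rsum f s + rsum f t.
Proof. induction s as [|i s IH]; simpl; [|rewrite IH]; ring. Qed.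

Lemma lsum_ext {I : Type} (F G : I -> C) s :
  (forall i, In i s -> F i = G i) -> lsum F s = lsum G s.
Proof.
  induction s as [|i s IH]; simpl; intros H; auto.
  rewrite (H i), IH; auto.
Qed.

Lemma lsum_map {I J : Type} (F : I -> C) (u : J -> I) s :
  lsum F (map u s) = lsum (fun j => F (u j)) s.
Proof. induction s; simpl; congruence. Qed.

Lemma rsum_map {I J : Type} (f : I -> R) (u : J -> I) s :
  rsum f (map u s) = rsum (fun j => f (u j)) s.
Proof. induction s; simpl; congruence. Qed.

Lemma lsum_plus {I : Type} (F G : I -> C) s :
  lsum (fun i => (F i + G i)%C) s = (lsum F s + lsum G s)%C.
Proof. induction s as [|i s IH]; simpl; [|rewrite IH]; ring. Qed.

Lemma lsum_scal {I : Type} (c : C) (F : I -> C) s :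
  lsum (fun i => (c * F i)%C) s = (c * lsum F s)%C.
Proof. induction s as [|i s IH]; simpl; [|rewrite IH]; ring. Qed.

Lemma rsum_scal {I : Type} (c : R) (f : I -> R) s :
  rsum (fun i => c * f i) s = c * rsum f s.
Proof. induction s as [|i s IH]; simpl; [|rewrite IH]; ring. Qed.

Lemma rsum_plus {I : Type} (f g : I -> R) s :
  rsum (fun i => f i + g i) s = rsum f s + rsum g s.
Proof. induction s as [|i s IH]; simpl; [|rewrite IH]; ring. Qed.

Lemma lsum_0 {I : Type} (F : I -> C) s :
  (forall i, In i s -> F i = RtoC 0) -> lsum F s = RtoC 0.
Proof.
  induction s as [|i s IH]; simpl; intros H; auto.
  rewrite (H i), IH; auto. ring.
Qed.

Lemma rsum_le {I : Type} (f g : I -> R) s :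
  (forall i, In i s -> f i <= g i) -> rsum f s <= rsum g s.
Proof.
  induction s as [|i s IH]; simpl; intros H; [lra|].
  pose proof (H i (or_introl eq_refl)).
  assert (rsum f s <= rsum g s) by auto. lra.
Qed.

Lemma rsum_pos {I : Type} (f : I -> R) s : (forall i, 0 <= f i) -> 0 <= rsum f s.
Proof. intros H; induction s; simpl; [lra | specialize (H a); lra]. Qed.

Lemma Cmod_lsum {I : Type} (F : I -> C) s : Cmod (lsum F s) <= rsum (fun i => Cmod (F i)) s.
Proof.
  induction s as [|i s IH]; simpl.
  - rewrite Cmod_0. lra.
  - eapply Rle_trans; [apply Cmod_triangle | lra].
Qed.

Lemma lsum_RtoC {I : Type} (f : I -> R) s : lsum (fun i => RtoC (f i)) s = RtoC (rsum f s).
Proof. induction s as [|i s IH]; simpl; auto. rewrite IH, RtoC_plus. auto. Qed.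

Lemma rsum_incl {I : Type} (f : I -> R) s t :
  (forall i, 0 <= f i) -> NoDup s -> incl s t -> rsum f s <= rsum f t.
Proof.
  intros Hf. revert t. induction s as [|i s IH]; simpl; intros t Hs Hst.
  - apply rsum_pos; auto.
  - inversion Hs; subst.
    destruct (in_split i t) as [t1 [t2 Ht]]; [apply Hst; left; auto|]. subst t.
    assert (rsum f s <= rsum f (t1 ++ t2)).
    { apply IH; auto. intros j Hj.
      assert (Hj' : In j (t1 ++ i :: t2)) by (apply Hst; right; auto).
      apply in_app_or in Hj'. apply in_or_app.
      destruct Hj' as [|[|]]; auto. subst; contradiction. }
    rewrite rsum_app in *. simpl. lra.
Qed.

Lemma bddSum_le {I : Type} (f g : I -> R) :
  (forall i, f i <= g i) -> bddSum g -> bddSum f.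
Proof.
  intros H [M HM]. exists M. intros s Hs.
  eapply Rle_trans; [apply rsum_le; intros; apply H | auto].
Qed.

Lemma bddSum_scal {I : Type} (c : R) (f : I -> R) :
  0 <= c -> bddSum f -> bddSum (fun i => c * f i).
Proof.
  intros Hc [M HM]. exists (c * M). intros s Hs. rewrite rsum_scal.
  apply Rmult_le_compat_l; auto.
Qed.

Lemma bddSum_plus {I : Type} (f g : I -> R) :
  bddSum f -> bddSum g -> bddSum (fun i => f i + g i).
Proof.
  intros [M HM] [M' HM']. exists (M + M'). intros s Hs. rewrite rsum_plus.
  specialize (HM s Hs). specialize (HM' s Hs). lra.
Qed.

Lemma hasSum_ext {I : Type} (F G : I -> C) l :
  (forall i, F i = G i) -> hasSum F l -> hasSum G l.
Proof. intros H HF. replace G with F; auto. apply functional_extensionality; auto. Qed.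

Lemma hasSum_unique {I : Type} (F : I -> C) l l' : hasSum F l -> hasSum F l' -> l = l'.
Proof.
  intros H H'.
  destruct (Req_dec (Cmod (l - l')) 0) as [E|E].
  { apply Cmod_eq_0 in E. replace l with ((l - l') + l')%C by ring. rewrite E. ring. }
  assert (Hp : 0 < Cmod (l - l')) by (pose proof (Cmod_ge_0 (l - l')); lra).
  destruct (H (Cmod (l - l') / 2)) as [s Hs]; [lra|].
  destruct (H' (Cmod (l - l') / 2)) as [s' Hs']; [lra|].
  pose (u := nodup cdec (s ++ s')).
  assert (Hu : NoDup u) by apply NoDup_nodup.
  assert (H1 : incl s u) by (intros x Hx; apply nodup_In, in_or_app; auto).
  assert (H2 : incl s' u) by (intros x Hx; apply nodup_In, in_or_app; auto).
  specialize (Hs u Hu H1). specialize (Hs' u Hu H2).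
  assert (Cmod (l - l') <= Cmod (lsum F u - l') + Cmod (lsum F u - l)).
  { replace (l - l')%C with ((lsum F u - l') + - (lsum F u - l))%C by ring.
    eapply Rle_trans; [apply Cmod_triangle|]. rewrite Cmod_opp. lra. }
  lra.
Qed.

Lemma hasSum_plus {I : Type} (F G : I -> C) l m :
  hasSum F l -> hasSum G m -> hasSum (fun i => (F i + G i)%C) (l + m)%C.
Proof.
  intros HF HG eps He.
  destruct (HF (eps / 2)) as [s Hs]; [lra|].
  destruct (HG (eps / 2)) as [t Ht]; [lra|].
  exists (s ++ t). intros u Hu Hi.
  assert (H1 := Hs u Hu (fun x Hx => Hi x (in_or_app _ _ _ (or_introl Hx)))).
  assert (H2 := Ht u Hu (fun x Hx => Hi x (in_or_app _ _ _ (or_intror Hx)))).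
  rewrite lsum_plus.
  replace (lsum F u + lsum G u - (l + m))%C with ((lsum F u - l) + (lsum G u - m))%C by ring.
  eapply Rle_lt_trans; [apply Cmod_triangle | lra].
Qed.

Lemma hasSum_scal {I : Type} (c : C) (F : I -> C) l :
  hasSum F l -> hasSum (fun i => (c * F i)%C) (c * l)%C.
Proof.
  intros HF eps He.
  assert (Hc := Cmod_ge_0 c).
  destruct (HF (eps / (Cmod c + 1))) as [s Hs].
  { apply Rdiv_lt_0_compat; lra. }
  exists s. intros u Hu Hi. specialize (Hs u Hu Hi). rewrite lsum_scal.
  replace (c * lsum F u - c * l)%C with (c * (lsum F u - l))%C by ring.
  rewrite Cmod_mult.
  assert (Hd := Cmod_ge_0 (lsum F u - l)).
  apply Rmult_lt_compat_r with (r := Cmod c + 1) in Hs; [|lra].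
  replace (eps / (Cmod c + 1) * (Cmod c + 1)) with eps in Hs by (field; lra). nra.
Qed.

Lemma hasSum_0 {I : Type} : hasSum (fun _ : I => RtoC 0) (RtoC 0).
Proof.
  intros eps He. exists nil. intros s _ _. rewrite lsum_0 by auto.
  replace (RtoC 0 - RtoC 0)%C with (RtoC 0) by ring. rewrite Cmod_0. auto.
Qed.

Lemma hasSum_single {I : Type} (i0 : I) (F : I -> C) :
  (forall i, i <> i0 -> F i = RtoC 0) -> hasSum F (F i0).
Proof.
  intros H eps He. exists [i0]. intros s Hs Hi.
  destruct (in_split i0 s) as [s1 [s2 E]]; [apply Hi; left; auto|]. subst s.
  apply NoDup_remove_2 in Hs.
  rewrite lsum_app. simpl.
  rewrite !lsum_0.
  - replace (RtoC 0 + (F i0 + RtoC 0) - F i0)%C with (RtoC 0) by ring. rewrite Cmod_0. auto.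
  - intros i Hin. apply H. intros ->. apply Hs, in_or_app; auto.
  - intros i Hin. apply H. intros ->. apply Hs, in_or_app; auto.
Qed.

Lemma hasSum_nonneg {I : Type} (f : I -> R) :
  (forall i, 0 <= f i) -> bddSum f -> exists l, hasSum (fun i => RtoC (f i)) (RtoC l).
Proof.
  intros Hf [M HM].
  destruct (completeness (fun x => exists s, NoDup s /\ x = rsum f s)) as [l [Hl1 Hl2]].
  - exists M. intros x [s [Hs ->]]. auto.
  - exists 0, nil. split; [constructor | auto].
  - exists l. intros eps He.
    destruct (classic (exists s, NoDup s /\ l - eps < rsum f s)) as [[s0 [Hs0 Hs]]|Hn].
    + exists s0. intros s Hnd Hi.
      assert (H1 : rsum f s0 <= rsum f s) by (apply rsum_incl; auto).
      assert (H2 : rsum f s <= l) by (apply Hl1; exists s; auto).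
      rewrite lsum_RtoC, <- RtoC_minus, Cmod_R. apply Rabs_def1; lra.
    + exfalso. assert (l <= l - eps); [|lra].
      apply Hl2. intros x [s [Hs ->]].
      apply Rnot_lt_le. intros Hlt. apply Hn. exists s. auto.
Qed.

(** Turns a statement about sums of nonnegative terms back into boundedness, so that reindexing and
    regrouping of sums also transport absolute summability. *)
Lemma hasSum_bdd {I : Type} (f : I -> R) l :
  (forall i, 0 <= f i) -> hasSum (fun i => RtoC (f i)) l -> bddSum f.
Proof.
  intros Hf H. destruct (H 1) as [s0 Hs0]; [lra|].
  exists (Cmod l + 1). intros s Hs.
  pose (u := nodup cdec (s0 ++ s)).
  assert (Hu : NoDup u) by apply NoDup_nodup.
  assert (H1 : incl s0 u) by (intros x Hx; apply nodup_In, in_or_app; auto).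
  assert (H2 : incl s u) by (intros x Hx; apply nodup_In, in_or_app; auto).
  specialize (Hs0 u Hu H1). rewrite lsum_RtoC in Hs0.
  assert (H3 := rsum_incl f s u Hf Hs H2).
  assert (Cmod (RtoC (rsum f u)) <= Cmod (RtoC (rsum f u) - l) + Cmod l).
  { replace (RtoC (rsum f u)) with ((RtoC (rsum f u) - l) + l)%C at 1 by ring.
    apply Cmod_triangle. }
  rewrite Cmod_R in H0. pose proof (Rle_abs (rsum f u)). lra.
Qed.

Lemma im_le_Cmod (c : C) : Rabs (Im c) <= Cmod c.
Proof.
  eapply Rle_trans; [|apply Rmax_Cmod]. apply Rmax_r.
Qed.

(** Real and imaginary parts are split into positive and negative parts, each dominated by
    [Cmod]. *)
Lemma absSum_hasSum {I : Type} (F : I -> C) : absSum F -> exists l, hasSum F l.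
Proof.
  intros H.
  assert (Hpart : forall f : I -> R, (forall i, Rabs (f i) <= Cmod (F i)) ->
            exists l, hasSum (fun i => RtoC (f i)) l).
  { intros f Hf.
    destruct (hasSum_nonneg (fun i => (Rabs (f i) + f i) / 2)) as [l1 H1].
    - intros i. pose proof (Rle_abs (- f i)). rewrite Rabs_Ropp in H0. lra.
    - apply (bddSum_le _ (fun i => Cmod (F i))); auto.
      intros i. pose proof (Rle_abs (f i)). specialize (Hf i). lra.
    - destruct (hasSum_nonneg (fun i => (Rabs (f i) - f i) / 2)) as [l2 H2].
      + intros i. pose proof (Rle_abs (f i)). lra.
      + apply (bddSum_le _ (fun i => Cmod (F i))); auto.
        intros i. pose proof (Rle_abs (- f i)). rewrite Rabs_Ropp in H0.
        specialize (Hf i). lra.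
      + exists (RtoC l1 + RtoC (-1) * RtoC l2)%C.
        eapply hasSum_ext; [|apply hasSum_plus; [apply H1 | apply hasSum_scal, H2]].
        intros i. cbv beta. rewrite <- RtoC_mult, <- RtoC_plus. f_equal. field. }
  destruct (Hpart (fun i => Re (F i))) as [l1 H1]; [intros; apply re_le_Cmod|].
  destruct (Hpart (fun i => Im (F i))) as [l2 H2]; [intros; apply im_le_Cmod|].
  exists (l1 + Ci * l2)%C.
  eapply hasSum_ext; [|apply hasSum_plus; [apply H1 | apply hasSum_scal, H2]].
  intros i. cbv beta. destruct (F i) as [x y]. unfold Re, Im, Ci, RtoC, Cmult, Cplus. simpl.
  f_equal; ring.
Qed.

Lemma lsum_preimage {I J : Type} (F : I -> C) (u : J -> I) (s : list I) :
  (forall j j', u j = u j' -> j = j') ->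
  (forall i, (forall j, u j <> i) -> F i = RtoC 0) -> NoDup s ->
  exists t, NoDup t /\ (forall j, In j t <-> In (u j) s) /\
    lsum F s = lsum (fun j => F (u j)) t.
Proof.
  intros Hu HF. induction s as [|i s IH]; intros Hs.
  - exists nil. repeat split; auto; constructor.
  - inversion Hs; subst. destruct (IH H2) as [t [Ht [Hin E]]].
    destruct (classic (exists j, u j = i)) as [[j Hj]|Hn].
    + exists (j :: t). split; [|split].
      * constructor; auto. rewrite Hin, Hj. auto.
      * intros j'. simpl. rewrite Hin. split; intros [H|H]; auto.
        -- left. congruence.
        -- left. apply Hu. congruence.
      * simpl. rewrite E, Hj. auto.
    + exists t. split; auto. split.
      * intros j. rewrite Hin. simpl. split; auto. intros [H|H]; auto.
        exfalso. apply Hn. exists j. auto.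
      * simpl. rewrite E, (HF i). ring. intros j Hj. apply Hn. exists j. auto.
Qed.

Lemma hasSum_inj {I J : Type} (F : I -> C) (u : J -> I) l :
  (forall j j', u j = u j' -> j = j') ->
  (forall i, (forall j, u j <> i) -> F i = RtoC 0) ->
  hasSum (fun j => F (u j)) l -> hasSum F l.
Proof.
  intros Hu HF H eps He. destruct (H eps He) as [t0 Ht0].
  exists (map u t0). intros s Hs Hi.
  destruct (lsum_preimage F u s Hu HF Hs) as [t [Ht [Hin E]]]. rewrite E.
  apply Ht0; auto. intros j Hj. apply Hin, Hi, in_map; auto.
Qed.

Lemma lsum_flat_map {I J : Type} (F : I * J -> C) (t : I -> list J) (s : list I) :
  lsum F (flat_map (fun i => map (pair i) (t i)) s) =
  lsum (fun i => lsum (fun j => F (i, j)) (t i)) s.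
Proof.
  induction s as [|i s IH]; simpl; auto.
  rewrite lsum_app, IH, lsum_map. auto.
Qed.

Lemma NoDup_flat_pairs {I J : Type} (t : I -> list J) (s : list I) :
  NoDup s -> (forall i, NoDup (t i)) -> NoDup (flat_map (fun i => map (pair i) (t i)) s).
Proof.
  intros Hs Ht. induction Hs as [|i s Hi Hs IH]; simpl; [constructor|].
  apply NoDup_app; auto.
  - apply NoDup_map_inv with (f := snd). rewrite map_map. simpl. rewrite map_id. auto.
  - intros [i' j] H1 H2. apply in_map_iff in H1. destruct H1 as [j' [E _]].
    apply in_flat_map in H2. destruct H2 as [i2 [H2 H3]].
    apply in_map_iff in H3. destruct H3 as [j2 [E2 _]].
    inversion E; inversion E2; subst. contradiction.
Qed.

(** In each row of [s] a finite piece is chosen that contains the part of [s0] in that row and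
    misses the row sum by less than [d]. The union of the pieces is then admissible for the total
    sum, and [d] is scaled so that the row errors add up to less than [eps / 2]. *)
Lemma hasSum_fubini {I J : Type} (F : I * J -> C) (r : I -> C) l :
  hasSum F l -> (forall i, hasSum (fun j => F (i, j)) (r i)) -> hasSum r l.
Proof.
  intros HF Hr eps He.
  destruct (HF (eps / 2)) as [s0 Hs0]; [lra|].
  exists (map fst s0). intros s Hs Hi.
  set (d := eps / (2 * (INR (length s) + 1))).
  assert (HL := pos_INR (length s)).
  assert (Hd : 0 < d) by (apply Rdiv_lt_0_compat; lra).
  assert (Hch : forall i, exists t, NoDup t /\ (forall j, In (i, j) s0 -> In j t) /\
            Cmod (lsum (fun j => F (i, j)) t - r i) < d).
  { intros i. destruct (Hr i d Hd) as [t0 Ht0].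
    exists (nodup cdec (t0 ++ map snd s0)).
    split; [apply NoDup_nodup|]. split.
    - intros j Hj. apply nodup_In, in_or_app. right.
      change j with (snd (i, j)). apply in_map; auto.
    - apply Ht0; [apply NoDup_nodup|]. intros x Hx. apply nodup_In, in_or_app; auto. }
  destruct (choice _ Hch) as [t Ht].
  set (U := flat_map (fun i => map (pair i) (t i)) s).
  assert (HU : Cmod (lsum F U - l) < eps / 2).
  { apply Hs0.
    - apply NoDup_flat_pairs; auto. intros i. apply Ht.
    - intros [i j] Hij. apply in_flat_map. exists i. split.
      + apply Hi. change i with (fst (i, j)). apply in_map; auto.
      + apply in_map. apply Ht; auto. }
  unfold U in HU. rewrite lsum_flat_map in HU.
  set (Y := fun i => lsum (fun j => F (i, j)) (t i)) in HU.
  assert (HY : Cmod (lsum Y s - lsum r s) <= INR (length s) * d).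
  { clear HU U Hi Hs. clearbody d. clear HL. induction s as [|i s IH].
    - simpl. replace (RtoC 0 - RtoC 0)%C with (RtoC 0) by ring. rewrite Cmod_0. lra.
    - cbn [lsum fold_right length]. rewrite S_INR.
      fold (lsum Y s). fold (lsum r s).
      replace (Y i + lsum Y s - (r i + lsum r s))%C
        with ((Y i - r i) + (lsum Y s - lsum r s))%C by ring.
      eapply Rle_trans; [apply Cmod_triangle|].
      destruct (Ht i) as [_ [_ H]]. fold (Y i) in H. lra. }
  assert (Hd2 : INR (length s) * d < eps / 2).
  { unfold d. apply Rmult_lt_reg_r with (2 * (INR (length s) + 1)); [lra|].
    field_simplify; [|lra]. nra. }
  replace (lsum r s - l)%C with (- (lsum Y s - lsum r s) + (lsum Y s - l))%C by ring.
  eapply Rle_lt_trans; [apply Cmod_triangle|]. rewrite Cmod_opp. lra.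
Qed.

Lemma rsum_prod {I J : Type} (f : I -> R) (g : J -> R) s t :
  rsum (fun ij => f (fst ij) * g (snd ij)) (list_prod s t) = rsum f s * rsum g t.
Proof.
  induction s as [|i s IH]; simpl; [ring|].
  rewrite rsum_app, IH, rsum_map. simpl. rewrite rsum_scal. ring.
Qed.

Lemma bddSum_prod {I J : Type} (f : I -> R) (g : J -> R) :
  (forall i, 0 <= f i) -> (forall j, 0 <= g j) -> bddSum f -> bddSum g ->
  bddSum (fun ij : I * J => f (fst ij) * g (snd ij)).
Proof.
  intros Hf Hg [M HM] [M' HM']. exists (M * M'). intros s Hs.
  set (s1 := nodup cdec (map fst s)). set (s2 := nodup cdec (map snd s)).
  eapply Rle_trans.
  - apply rsum_incl with (t := list_prod s1 s2); auto.
    + intros. apply Rmult_le_pos; auto.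
    + intros [i j] H. apply in_prod; apply nodup_In.
      * change i with (fst (i, j)). apply in_map; auto.
      * change j with (snd (i, j)). apply in_map; auto.
  - rewrite rsum_prod.
    apply Rmult_le_compat; try apply rsum_pos; auto.
    + apply HM, NoDup_nodup.
    + apply HM', NoDup_nodup.
Qed.

Lemma absSum_prod {I J : Type} (F : I -> C) (G : J -> C) :
  absSum F -> absSum G -> absSum (fun ij : I * J => (F (fst ij) * G (snd ij))%C).
Proof.
  intros HF HG. unfold absSum.
  eapply bddSum_le; [|apply (bddSum_prod (fun i => Cmod (F i)) (fun j => Cmod (G j)))]; auto.
  - intros. simpl. rewrite Cmod_mult. lra.
  - intros; apply Cmod_ge_0.
  - intros; apply Cmod_ge_0.
Qed.

Lemma hasSum_prod {I J : Type} (F : I -> C) (G : J -> C) l m :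
  absSum F -> absSum G -> hasSum F l -> hasSum G m ->
  hasSum (fun ij : I * J => (F (fst ij) * G (snd ij))%C) (l * m)%C.
Proof.
  intros HF HG Hl Hm.
  destruct (absSum_hasSum _ (absSum_prod F G HF HG)) as [L HL].
  assert (H : hasSum (fun i => (m * F i)%C) L).
  { apply (hasSum_fubini _ _ _ HL). intros i. simpl.
    apply hasSum_ext with (fun j => (F i * G j)%C); auto.
    replace (m * F i)%C with (F i * m)%C by ring. apply hasSum_scal; auto. }
  replace (l * m)%C with L; auto.
  rewrite Cmult_comm. eapply hasSum_unique; [apply H|]. apply hasSum_scal; auto.
Qed.

(** A total summation operator by choice; its value carries information only when some sum
    exists. *)
Definition csum {I : Type} (F : I -> C) : C := epsilon (inhabits (RtoC 0)) (hasSum F).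

Lemma csum_correct {I : Type} (F : I -> C) : absSum F -> hasSum F (csum F).
Proof. intros H. unfold csum. apply epsilon_spec. apply absSum_hasSum; auto. Qed.

Lemma csum_unique {I : Type} (F : I -> C) l : hasSum F l -> csum F = l.
Proof.
  intros H. apply (hasSum_unique F); auto. unfold csum. apply epsilon_spec. exists l; auto.
Qed.

Lemma hasSum_finite {I : Type} (F : I -> C) (s : list I) :
  NoDup s -> (forall i, ~ In i s -> F i = RtoC 0) -> hasSum F (lsum F s).
Proof.
  revert F. induction s as [|i s IH]; intros F Hs HF.
  - simpl. eapply hasSum_ext; [|apply hasSum_0]. intros i. symmetry. apply HF. auto.
  - inversion Hs; subst.
    pose (F1 := fun j => if cdec j i then F i else RtoC 0).
    pose (F2 := fun j => if cdec j i then RtoC 0 else F j).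
    apply hasSum_ext with (fun j => (F1 j + F2 j)%C).
    { intros j. unfold F1, F2. destruct (cdec j i); subst; ring. }
    simpl. apply hasSum_plus.
    + replace (F i) with (F1 i) by (unfold F1; destruct (cdec i i); congruence).
      apply hasSum_single. intros j Hj. unfold F1. destruct (cdec j i); congruence.
    + replace (lsum F s) with (lsum F2 s).
      * apply IH; auto. intros j Hj. unfold F2. destruct (cdec j i); auto.
        apply HF. intros [E|E]; congruence.
      * apply lsum_ext. intros j Hj. unfold F2. destruct (cdec j i); congruence.
Qed.

Lemma hasSum_shift (a : nat -> C) l :
  hasSum (fun n => a (S n)) l -> hasSum a (a O + l)%C.
Proof.
  intros H.
  pose (a1 := fun n : nat => match n with O => a O | _ => RtoC 0 end).
  pose (a2 := fun n : nat => match n with O => RtoC 0 | _ => a n end).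
  apply hasSum_ext with (fun n => (a1 n + a2 n)%C).
  { intros [|n]; simpl; ring. }
  apply hasSum_plus.
  - change (a O) with (a1 O). apply hasSum_single. intros [|n]; simpl; congruence.
  - apply hasSum_inj with (u := S); auto.
    intros [|n] Hn; auto. exfalso. apply (Hn n); auto.
Qed.

(** * Comparison with ordered complex series *)

Lemma lsum_seq (a : nat -> C) n : lsum a (seq 0 (S n)) = sum_n (G := C_AbelianMonoid) a n.
Proof.
  induction n as [|n IH].
  - rewrite sum_O. simpl. ring.
  - rewrite sum_Sn, <- IH, (seq_S (S n)), lsum_app. simpl. unfold plus. simpl.
    unfold AbelianMonoid.plus. simpl. ring.
Qed.

Lemma is_C_series_iff (a : nat -> C) l :
  is_C_series a l <->
  (forall eps, 0 < eps -> exists N, forall n, (N <= n)%nat ->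
     Cmod (sum_n (G := C_AbelianMonoid) a n - l) < eps).
Proof.
  unfold is_C_series, is_series. split.
  - intros H eps He.
    assert (H1 : locally_norm (K := C_AbsRing) (V := C_NormedModule) l (fun y => Cmod (y - l) < eps)).
    { exists (mkposreal eps He). intros y Hy. exact Hy. }
    apply (locally_le_locally_norm (K := C_AbsRing) (V := C_NormedModule)) in H1.
    specialize (H _ H1). destruct H as [N HN]. exists N. exact HN.
  - intros H P HP.
    apply (locally_norm_le_locally (K := C_AbsRing) (V := C_NormedModule)) in HP.
    destruct HP as [eps He]. destruct (H eps (cond_pos eps)) as [N HN].
    exists N. intros n Hn. apply He. apply HN; auto.
Qed.

Lemma hasSum_is_series (a : nat -> C) l : hasSum a l -> is_C_series a l.
Proof.
  intros H. apply is_C_series_iff. intros eps He.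
  destruct (H eps He) as [s0 Hs0].
  assert (HN : exists N, forall n, In n s0 -> (n <= N)%nat).
  { clear. induction s0 as [|n s IH]; [exists O; intros n []|].
    destruct IH as [N HN]. exists (max n N). intros m [->|Hm]; [lia|].
    specialize (HN m Hm). lia. }
  destruct HN as [N HN]. exists N. intros n Hn. rewrite <- lsum_seq.
  apply Hs0; [apply seq_NoDup|]. intros m Hm. apply in_seq. specialize (HN m Hm). lia.
Qed.

Lemma is_C_series_unique (a : nat -> C) l l' : is_C_series a l -> is_C_series a l' -> l = l'.
Proof.
  intros H H'. unfold is_C_series, is_series in *.
  apply (filterlim_locally_unique (K := C_AbsRing) (V := C_NormedModule) (F := Hierarchy.eventually)
    (sum_n (G := C_AbelianMonoid) a)); auto.
Qed.

Lemma sum_n_Re (a : nat -> C) n :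
  Re (sum_n (G := C_AbelianMonoid) a n) = sum_n (fun k => Re (a k)) n.
Proof.
  induction n as [|n IH]; [rewrite !sum_O; auto|].
  rewrite !sum_Sn, <- IH. reflexivity.
Qed.

Lemma sum_n_Im (a : nat -> C) n :
  Im (sum_n (G := C_AbelianMonoid) a n) = sum_n (fun k => Im (a k)) n.
Proof.
  induction n as [|n IH]; [rewrite !sum_O; auto|].
  rewrite !sum_Sn, <- IH. reflexivity.
Qed.

Lemma CSeries_unique (a : nat -> C) l : is_C_series a l -> CSeries a = l.
Proof.
  intros H. rewrite is_C_series_iff in H. unfold CSeries.
  assert (Hre : is_series (fun n => Re (a n)) (Re l)).
  { apply is_series_Reals. intros eps He. destruct (H eps He) as [N HN].
    exists N. intros n Hn. unfold Rdist. rewrite <- sum_n_Reals, <- sum_n_Re.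
    eapply Rle_lt_trans; [|apply (HN n Hn)].
    eapply Rle_trans; [|apply re_le_Cmod]. apply Req_le. f_equal. }
  assert (Him : is_series (fun n => Im (a n)) (Im l)).
  { apply is_series_Reals. intros eps He. destruct (H eps He) as [N HN].
    exists N. intros n Hn. unfold Rdist. rewrite <- sum_n_Reals, <- sum_n_Im.
    eapply Rle_lt_trans; [|apply (HN n Hn)].
    eapply Rle_trans; [|apply im_le_Cmod]. apply Req_le. f_equal. }
  rewrite (is_series_unique _ _ Hre), (is_series_unique _ _ Him). destruct l; auto.
Qed.

Lemma CSeries_hasSum (a : nat -> C) l : hasSum a l -> CSeries a = l.
Proof. intros H. apply CSeries_unique, hasSum_is_series, H. Qed.

(** * Power series on the unit disk *)

(* Convergence on the open unit disk. *)
Definition tame (a : nat -> C) : Prop :=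
  forall r, 0 <= r < 1 -> bddSum (fun n => Cmod (a n) * r ^ n).

Lemma tame_absSum a x : tame a -> Cmod x < 1 -> absSum (fun n => (a n * x ^ n)%C).
Proof.
  intros H Hx. unfold absSum.
  eapply bddSum_le; [|apply (H (Cmod x))].
  - intros n. simpl. rewrite Cmod_mult, Cmod_pow. lra.
  - split; auto. apply Cmod_ge_0.
Qed.

Definition PS (a : nat -> C) (x : C) : C := csum (fun n => (a n * x ^ n)%C).

Lemma PS_correct a x : tame a -> Cmod x < 1 -> hasSum (fun n => (a n * x ^ n)%C) (PS a x).
Proof. intros. apply csum_correct, tame_absSum; auto. Qed.

Lemma rsum_seq_geom r n : 0 <= r < 1 -> rsum (fun k => r ^ k) (seq 0 n) <= / (1 - r).
Proof.
  intros Hr.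
  assert (H : forall n, rsum (fun k => r ^ k) (seq 0 n) * (1 - r) = 1 - r ^ n).
  { induction n0 as [|m IH]; [simpl; ring|].
    rewrite seq_S, rsum_app, Rmult_plus_distr_r, IH. simpl. ring. }
  specialize (H n). assert (0 <= r ^ n) by (apply pow_le; lra).
  apply Rmult_le_reg_r with (1 - r); [lra|]. rewrite H, Rinv_l; lra.
Qed.

Lemma list_max_seq (s : list nat) : exists N, incl s (seq 0 N).
Proof.
  exists (S (list_max s)). intros n Hn. apply in_seq.
  assert (H := proj1 (list_max_le s (list_max s)) (le_n _)).
  rewrite Forall_forall in H. specialize (H n Hn). lia.
Qed.

Lemma bddSum_geom r : 0 <= r < 1 -> bddSum (fun n : nat => r ^ n).
Proof.
  intros Hr. exists (/ (1 - r)). intros s Hs. destruct (list_max_seq s) as [N HN].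
  eapply Rle_trans; [apply rsum_incl with (t := seq 0 N); auto|].
  - intros; apply pow_le; lra.
  - apply rsum_seq_geom; auto.
Qed.

Lemma pow_le_1 r n : 0 <= r <= 1 -> 0 <= r ^ n <= 1.
Proof.
  intros Hr. split; [apply pow_le; lra|].
  induction n; simpl; [lra|]. assert (0 <= r ^ n) by (apply pow_le; lra). nra.
Qed.

Lemma pow_decr r m n : 0 <= r <= 1 -> (m <= n)%nat -> r ^ n <= r ^ m.
Proof.
  intros Hr H. replace n with (m + (n - m))%nat by lia. rewrite pow_add.
  assert (H1 := pow_le_1 r m Hr). assert (H2 := pow_le_1 r (n - m) Hr). nra.
Qed.

(** Each of the first [n] powers of [r] is at least [r ^ n], so [n] copies of the latter stay below
    the geometric sum. *)
Lemma INR_pow_bound r n : 0 <= r < 1 -> INR n * r ^ n <= / (1 - r).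
Proof.
  intros Hr. eapply Rle_trans; [|apply (rsum_seq_geom r n Hr)].
  assert (H : forall m, (m <= n)%nat -> INR m * r ^ n <= rsum (fun k => r ^ k) (seq 0 m)).
  { induction m as [|m IH]; intros Hm; [simpl; lra|].
    rewrite seq_S, rsum_app, S_INR. simpl.
    assert (r ^ n <= r ^ m) by (apply pow_decr; [lra | lia]).
    assert (H1 := IH ltac:(lia)). lra. }
  apply H; auto.
Qed.

(** The factor [n] is absorbed by enlarging the radius to [r'], since [n (r / r')^n] stays
    bounded. *)
Lemma tame_mult_INR a : tame a -> tame (fun n => (CN n * a n)%C).
Proof.
  intros Ha r Hr.
  set (r' := (r + 1) / 2).
  assert (Hr' : 0 < r' < 1) by (unfold r'; lra).
  assert (Hq : 0 <= r / r' < 1).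
  { split; [apply Rmult_le_pos; [lra | left; apply Rinv_0_lt_compat; lra]|].
    apply Rmult_lt_reg_r with r'; [lra|]. field_simplify; [|lra]. unfold r'. lra. }
  apply bddSum_le with (fun n => / (1 - r / r') * (Cmod (a n) * r' ^ n)).
  - intros n. rewrite Cmod_mult. unfold CN. rewrite Cmod_R, Rabs_pos_eq by apply pos_INR.
    replace (r ^ n) with ((r / r') ^ n * r' ^ n).
    2: { rewrite <- Rpow_mult_distr. f_equal. field. lra. }
    assert (H := INR_pow_bound (r / r') n Hq).
    assert (0 <= Cmod (a n) * r' ^ n).
    { apply Rmult_le_pos; [apply Cmod_ge_0 | apply pow_le; lra]. }
    nra.
  - apply bddSum_scal; [|apply Ha; lra].
    left. apply Rinv_0_lt_compat. lra.
Qed.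

Lemma tame_le a b : (forall n, Cmod (a n) <= Cmod (b n)) -> tame b -> tame a.
Proof.
  intros H Hb r Hr. eapply bddSum_le; [|apply (Hb r Hr)].
  intros n. simpl. apply Rmult_le_compat_r; auto. apply pow_le; lra.
Qed.

Lemma tame_const c : tame (fun _ => c).
Proof. intros r Hr. apply bddSum_scal; [apply Cmod_ge_0 | apply bddSum_geom; auto]. Qed.

Lemma tame_plus a b : tame a -> tame b -> tame (fun n => (a n + b n)%C).
Proof.
  intros Ha Hb r Hr.
  eapply bddSum_le; [|apply bddSum_plus; [apply (Ha r Hr) | apply (Hb r Hr)]].
  intros n. simpl. rewrite <- Rmult_plus_distr_r.
  apply Rmult_le_compat_r; [apply pow_le; lra | apply Cmod_triangle].
Qed.

Lemma tame_scal c a : tame a -> tame (fun n => (c * a n)%C).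
Proof.
  intros Ha r Hr.
  eapply bddSum_le; [|apply (bddSum_scal (Cmod c)); [apply Cmod_ge_0 | apply (Ha r Hr)]].
  intros n. simpl. rewrite Cmod_mult. lra.
Qed.

Lemma bddSum_shift (f : nat -> R) :
  (forall n, 0 <= f n) -> bddSum f -> bddSum (fun n => f (S n)).
Proof.
  intros Hf [M HM]. exists M. intros s Hs.
  rewrite <- (rsum_map f S). apply HM. apply Injective_map_NoDup; auto.
  intros x y; congruence.
Qed.

Lemma tame_shift a : tame a -> tame (fun n => a (S n)).
Proof.
  intros Ha r Hr.
  (* Unlike [r], the enlarged radius is never zero, so one power of it can be divided out. *)
  set (r' := (r + 1) / 2).
  assert (Hr' : 0 < r' < 1) by (unfold r'; lra).
  apply bddSum_le with (fun n => / r' * (Cmod (a (S n)) * r' ^ S n)).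
  - intros n. simpl.
    replace (/ r' * (Cmod (a (S n)) * (r' * r' ^ n))) with (Cmod (a (S n)) * r' ^ n)
      by (field; lra).
    apply Rmult_le_compat_l; [apply Cmod_ge_0|]. apply pow_incr. unfold r'; lra.
  - apply bddSum_scal; [left; apply Rinv_0_lt_compat; lra|].
    apply (bddSum_shift (fun n => Cmod (a n) * r' ^ n)).
    + intros n. apply Rmult_le_pos; [apply Cmod_ge_0 | apply pow_le; lra].
    + apply Ha. lra.
Qed.

(** * Complex derivatives *)

Definition Cder (f : C -> C) (z l : C) : Prop :=
  is_derive (K := C_AbsRing) (V := C_NormedModule) f z l.

Lemma Cder_intro f x l :
  (forall eps, 0 < eps -> exists d, 0 < d /\ forall y, Cmod (y - x) < d ->
     Cmod (f y - f x - (y - x) * l) <= eps * Cmod (y - x)) -> Cder f x l.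
Proof.
  intros H. split; [apply is_linear_scal_l|].
  intros x' Hx'.
  assert (E : x = x').
  { apply (is_filter_lim_locally_unique (K := C_AbsRing) (V := AbsRing_NormedModule C_AbsRing)). exact Hx'. }
  subst x'. intros eps.
  destruct (H eps (cond_pos eps)) as [d [Hd HD]].
  apply (locally_norm_le_locally (K := C_AbsRing) (V := AbsRing_NormedModule C_AbsRing)).
  exists (mkposreal d Hd). intros y Hy. apply HD. exact Hy.
Qed.

Lemma Cder_elim f x l : Cder f x l ->
  forall eps, 0 < eps -> exists d, 0 < d /\ forall y, Cmod (y - x) < d ->
     Cmod (f y - f x - (y - x) * l) <= eps * Cmod (y - x).
Proof.
  intros [_ H] eps He.
  specialize (H x (fun P HP => HP) (mkposreal eps He)).
  assert (H' := H).
  apply (locally_norm_le_locally (K := C_AbsRing) (V := AbsRing_NormedModule C_AbsRing)) in H'.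
  destruct H' as [d Hd]. exists d. split; [apply cond_pos|].
  intros y Hy. apply (Hd y Hy).
Qed.

Lemma Cder_eq f x l l' : Cder f x l -> l = l' -> Cder f x l'.
Proof. intros H <-. auto. Qed.

Lemma Cder_const c x : Cder (fun _ => c) x 0.
Proof. apply (is_derive_const (K := C_AbsRing) (V := C_NormedModule)). Qed.

Lemma Cder_id x : Cder (fun y => y) x 1.
Proof.
  apply Cder_intro. intros eps He. exists 1. split; [lra|]. intros y _.
  replace (y - x - (y - x) * 1)%C with (RtoC 0) by ring. rewrite Cmod_0.
  apply Rmult_le_pos; [lra | apply Cmod_ge_0].
Qed.

Lemma Cder_plus f g x a b : Cder f x a -> Cder g x b -> Cder (fun y => (f y + g y)%C) x (a + b)%C.
Proof. intros. apply (is_derive_plus (K := C_AbsRing) (V := C_NormedModule)); auto. Qed.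

Lemma Cder_ring f x l :
  Cder f x l <-> is_derive (K := C_AbsRing) (V := AbsRing_NormedModule C_AbsRing) f x l.
Proof.
  split; intros [_ H]; (split; [apply is_linear_scal_l | exact H]).
Qed.

Lemma Cder_mult f g x a b : Cder f x a -> Cder g x b ->
  Cder (fun y => (f y * g y)%C) x (a * g x + f x * b)%C.
Proof.
  rewrite !Cder_ring. intros.
  apply (is_derive_mult (K := C_AbsRing)); auto. intros; apply Cmult_comm.
Qed.

Lemma Cder_comp f g x a b : Cder f (g x) a -> Cder g x b -> Cder (fun y => f (g y)) x (b * a)%C.
Proof.
  intros Hf Hg. apply Cder_ring in Hg.
  apply (is_derive_comp (K := C_AbsRing) (V := C_NormedModule)); [exact Hf | exact Hg].
Qed.

Lemma Cder_scal c f x a : Cder f x a -> Cder (fun y => (c * f y)%C) x (c * a)%C.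
Proof.
  intros H. eapply Cder_eq; [apply Cder_mult; [apply Cder_const | apply H]|]. cbv beta. ring.
Qed.

Lemma Cder_opp f x a : Cder f x a -> Cder (fun y => (- f y)%C) x (- a)%C.
Proof. intros. apply (is_derive_opp (K := C_AbsRing) (V := C_NormedModule)); auto. Qed.

Lemma Cder_minus f g x a b : Cder f x a -> Cder g x b -> Cder (fun y => (f y - g y)%C) x (a - b)%C.
Proof. intros. apply Cder_plus; auto. apply Cder_opp; auto. Qed.

Lemma Cder_unique f x a b : Cder f x a -> Cder f x b -> a = b.
Proof.
  intros Ha Hb. rewrite <- (is_C_derive_unique f x a Ha). apply is_C_derive_unique, Hb.
Qed.

Lemma Cder_ext_loc f g x a d : 0 < d -> (forall y, Cmod (y - x) < d -> f y = g y) ->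
  Cder f x a -> Cder g x a.
Proof.
  intros Hd Hfg Hf. apply Cder_intro. intros eps He.
  destruct (Cder_elim f x a Hf eps He) as [d' [Hd' H]].
  exists (Rmin d d'). split; [apply Rmin_pos; auto|].
  intros y Hy. rewrite <- !Hfg.
  - apply H. eapply Rlt_le_trans; [apply Hy | apply Rmin_r].
  - replace (x - x)%C with (RtoC 0) by ring. rewrite Cmod_0. auto.
  - eapply Rlt_le_trans; [apply Hy | apply Rmin_l].
Qed.

Lemma Cder_ext f g x a : (forall y, f y = g y) -> Cder f x a -> Cder g x a.
Proof. intros H. apply Cder_ext_loc with 1; auto. lra. Qed.

Lemma Cder_pow f x a n : Cder f x a ->
  Cder (fun y => (f y ^ n)%C) x (CN n * a * f x ^ pred n)%C.
Proof.
  intros H. induction n as [|n IH].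
  - simpl. eapply Cder_eq; [apply Cder_const|]. unfold CN. simpl. ring.
  - eapply Cder_ext; [|eapply Cder_eq; [apply (Cder_mult _ _ _ _ _ H IH)|]].
    + intros y. simpl. ring.
    + unfold CN. rewrite S_INR, RtoC_plus. destruct n; simpl; ring.
Qed.

Lemma Cder_continuous f x l : Cder f x l ->
  forall eps, 0 < eps -> exists d, 0 < d /\ forall y, Cmod (y - x) < d -> Cmod (f y - f x) < eps.
Proof.
  intros H eps He. destruct (Cder_elim f x l H 1) as [d [Hd HD]]; [lra|].
  assert (Hl := Cmod_ge_0 l).
  exists (Rmin d (eps / (2 + Cmod l))). split.
  - apply Rmin_pos; auto. apply Rdiv_lt_0_compat; lra.
  - intros y Hy.
    assert (H1 : Cmod (y - x) < d) by (eapply Rlt_le_trans; [apply Hy | apply Rmin_l]).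
    assert (H2 : Cmod (y - x) < eps / (2 + Cmod l))
      by (eapply Rlt_le_trans; [apply Hy | apply Rmin_r]).
    specialize (HD y H1).
    replace (f y - f x)%C with ((f y - f x - (y - x) * l) + (y - x) * l)%C by ring.
    eapply Rle_lt_trans; [apply Cmod_triangle|]. rewrite Cmod_mult.
    apply Rmult_lt_compat_r with (r := 2 + Cmod l) in H2; [|lra].
    replace (eps / (2 + Cmod l) * (2 + Cmod l)) with eps in H2 by (field; lra).
    assert (H3 := Cmod_ge_0 (y - x)). nra.
Qed.

Lemma Cder_inv (x : C) : x <> RtoC 0 -> Cder Cinv x (- / (x * x))%C.
Proof.
  intros Hx. assert (Hm : 0 < Cmod x) by (apply (proj1 (Cmod_gt_0 x)); exact Hx).
  apply Cder_intro. intros eps He.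
  exists (Rmin (Cmod x / 2) (eps * (Cmod x ^ 3) / 2)). split.
  - apply Rmin_pos; [lra|]. assert (0 < Cmod x ^ 3) by (apply pow_lt; auto). nra.
  - intros y Hy.
    assert (H1 : Cmod (y - x) < Cmod x / 2) by (eapply Rlt_le_trans; [apply Hy | apply Rmin_l]).
    assert (H2 : Cmod (y - x) < eps * Cmod x ^ 3 / 2)
      by (eapply Rlt_le_trans; [apply Hy | apply Rmin_r]).
    assert (Hym : Cmod x / 2 < Cmod y).
    { assert (Cmod x <= Cmod (y - x) + Cmod y); [|lra].
      replace x with (- (y - x) + y)%C at 1 by ring.
      eapply Rle_trans; [apply Cmod_triangle|]. rewrite Cmod_opp. lra. }
    assert (Hy0 : y <> RtoC 0) by (apply (proj2 (Cmod_gt_0 y)); lra).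
    replace (/ y - / x - (y - x) * - / (x * x))%C with ((y - x) * ((y - x) / (x * x * y)))%C
      by (field; auto).
    rewrite Cmod_mult, Rmult_comm. apply Rmult_le_compat_r; [apply Cmod_ge_0|].
    rewrite Cmod_div by (repeat apply Cmult_neq_0; auto).
    rewrite !Cmod_mult.
    set (m := Cmod x) in *. set (n := Cmod y) in *.
    apply Rmult_le_reg_r with (m * m * n); [apply Rmult_lt_0_compat; nra|].
    unfold Rdiv. rewrite Rmult_assoc, Rinv_l by (apply Rgt_not_eq; apply Rmult_lt_0_compat; nra).
    rewrite Rmult_1_r.
    assert (m * m * (m / 2) <= m * m * n) by (apply Rmult_le_compat_l; nra).
    simpl in H2. nra.
Qed.

(** * Termwise differentiation and vanishing of power series *)

Lemma CN_S n : CN (S n) = (CN n + 1)%C.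
Proof. unfold CN. rewrite S_INR, RtoC_plus. auto. Qed.

Lemma Cmod_CN n : Cmod (CN n) = INR n.
Proof. unfold CN. rewrite Cmod_R. apply Rabs_pos_eq, pos_INR. Qed.

Lemma PS_shift (a : nat -> C) (x : C) : tame a -> Cmod x < 1 ->
  PS a x = (a O + x * PS (fun n => a (S n)) x)%C.
Proof.
  intros Ha Hx. apply csum_unique.
  replace (a O) with (a O * x ^ 0)%C by (simpl; ring).
  apply (hasSum_shift (fun n => (a n * x ^ n)%C)).
  eapply hasSum_ext; [|apply hasSum_scal, PS_correct; [apply tame_shift, Ha | auto]].
  intros n. simpl. ring.
Qed.

Lemma PS_plus (a b : nat -> C) (x : C) : tame a -> tame b -> Cmod x < 1 ->
  PS (fun n => (a n + b n)%C) x = (PS a x + PS b x)%C.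
Proof.
  intros Ha Hb Hx. apply csum_unique.
  eapply hasSum_ext; [|apply hasSum_plus; apply PS_correct; auto].
  intros n. simpl. ring.
Qed.

Lemma PS_scal c (a : nat -> C) (x : C) : tame a -> Cmod x < 1 ->
  PS (fun n => (c * a n)%C) x = (c * PS a x)%C.
Proof.
  intros Ha Hx. apply csum_unique.
  eapply hasSum_ext; [|apply hasSum_scal, PS_correct; auto].
  intros n. simpl. ring.
Qed.

Lemma PS_ext a b x : (forall n, a n = b n) -> PS a x = PS b x.
Proof. intros H. replace a with b; auto. apply functional_extensionality. auto. Qed.

Lemma Cmod_csum_le {I : Type} (F : I -> C) (f : I -> R) l M :
  hasSum F l -> (forall i, Cmod (F i) <= f i) -> (forall s, NoDup s -> rsum f s <= M) ->
  Cmod l <= M.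
Proof.
  intros H Hf HM. apply Rnot_lt_le. intros Hlt.
  destruct (H (Cmod l - M)) as [s0 Hs0]; [lra|].
  specialize (Hs0 (nodup cdec s0) (NoDup_nodup _ _)
    (fun x Hx => proj2 (nodup_In _ _ _) Hx)).
  specialize (HM (nodup cdec s0) (NoDup_nodup _ _)).
  assert (H1 := Cmod_lsum F (nodup cdec s0)).
  assert (H2 : rsum (fun i => Cmod (F i)) (nodup cdec s0) <= rsum f (nodup cdec s0))
    by (apply rsum_le; auto).
  assert (Cmod l <= Cmod (lsum F (nodup cdec s0) - l) + Cmod (lsum F (nodup cdec s0))); [|lra].
  replace l with (- (lsum F (nodup cdec s0) - l) + lsum F (nodup cdec s0))%C at 1 by ring.
  eapply Rle_trans; [apply Cmod_triangle|]. rewrite Cmod_opp. lra.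
Qed.

(* [(x + h)^n] agrees with its first-order Taylor polynomial up to [n^2 r^(n-2) |h|^2]. *)
Lemma pow_taylor (x h : C) r n : 0 < r -> Cmod x <= r -> Cmod (x + h) <= r ->
  r ^ 2 * Cmod ((x + h) ^ n - x ^ n - CN n * x ^ pred n * h) <= INR n ^ 2 * r ^ n * Cmod h ^ 2.
Proof.
  intros Hr Hx Hxh. induction n as [|n IH].
  - cbn [Cpow pred]. unfold CN. simpl INR.
    replace (1 - 1 - 0 * 1 * h)%C with (RtoC 0) by ring. rewrite Cmod_0. nra.
  - set (d := ((x + h) ^ n - x ^ n - CN n * x ^ pred n * h)%C) in *.
    (* Multiplication by [x + h] propagates the remainder [d] with a single new term
       [n x^(n-1) h^2]. The factor [r ^ 2] in the statement keeps the truncated exponent [n - 2] out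
       of it. *)
    replace ((x + h) ^ S n - x ^ S n - CN (S n) * x ^ pred (S n) * h)%C
      with ((x + h) * d + CN n * x ^ pred n * (h * h))%C.
    2:{ unfold d. rewrite CN_S. destruct n; cbn [Cpow pred]; [unfold CN; simpl INR|]; ring. }
    assert (H1 : Cmod ((x + h) * d + CN n * x ^ pred n * (h * h)) <=
      r * Cmod d + INR n * Cmod x ^ pred n * (Cmod h ^ 2)).
    { eapply Rle_trans; [apply Cmod_triangle|].
      rewrite !Cmod_mult, Cmod_pow, Cmod_CN. assert (0 <= Cmod d) by apply Cmod_ge_0.
      simpl (Cmod h ^ 2). rewrite Rmult_1_r. apply Rplus_le_compat_r. nra. }
    assert (H2 : INR n * Cmod x ^ pred n * r ^ 2 <= INR n * r ^ S n).
    { destruct n as [|n]; [simpl; lra|]. rewrite Rmult_assoc.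
      apply Rmult_le_compat_l; [apply pos_INR|]. simpl pred.
      replace (r ^ S (S n)) with (r ^ n * r ^ 2) by (simpl; ring).
      apply Rmult_le_compat_r; [nra|]. apply pow_incr. split; [apply Cmod_ge_0 | auto]. }
    rewrite S_INR.
    assert (H3 : 0 <= Cmod h ^ 2) by apply pow2_ge_0.
    assert (H4 := pos_INR n). assert (0 < r ^ n) by (apply pow_lt; auto).
    apply Rle_trans with (r * (INR n ^ 2 * r ^ n * Cmod h ^ 2) + INR n * r ^ S n * Cmod h ^ 2).
    + eapply Rle_trans; [apply Rmult_le_compat_l; [nra | apply H1]|].
      rewrite Rmult_plus_distr_l. apply Rplus_le_compat; [nra|].
      replace (r ^ 2 * (INR n * Cmod x ^ pred n * Cmod h ^ 2)) with
        (INR n * Cmod x ^ pred n * r ^ 2 * Cmod h ^ 2) by ring.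
      apply Rmult_le_compat_r; auto.
    + simpl (r ^ S n).
      replace ((INR n + 1) ^ 2 * (r * r ^ n) * Cmod h ^ 2) with
        (r * (INR n ^ 2 * r ^ n * Cmod h ^ 2) + INR n * (r * r ^ n) * Cmod h ^ 2 +
         (INR n + 1) * (r * r ^ n) * Cmod h ^ 2) by ring.
      assert (0 <= (INR n + 1) * (r * r ^ n) * Cmod h ^ 2); [|lra].
      apply Rmult_le_pos; [apply Rmult_le_pos; nra | auto].
Qed.

Definition PSd (a : nat -> C) : nat -> C := fun n => (CN (S n) * a (S n))%C.

Lemma tame_PSd a : tame a -> tame (PSd a).
Proof. intros H. apply (tame_shift (fun n => (CN n * a n)%C)), tame_mult_INR, H. Qed.

Lemma PS_theta (a : nat -> C) (x : C) : tame a -> Cmod x < 1 ->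
  (x * PS (PSd a) x)%C = PS (fun n => (CN n * a n)%C) x.
Proof.
  intros Ha Hx. rewrite (PS_shift (fun n => (CN n * a n)%C)); auto.
  - unfold PSd, CN. simpl INR. ring.
  - apply tame_mult_INR; auto.
Qed.

(** The remainders of [pow_taylor] add up to at most [M |h|^2 / r^2], where [M] bounds the sum of
    [n^2 |a_n| r^n] at a radius [r] strictly between [|x|] and 1. *)
Lemma Cder_PS (a : nat -> C) (x : C) : tame a -> Cmod x < 1 -> Cder (PS a) x (PS (PSd a) x).
Proof.
  intros Ha Hx.
  set (r := (Cmod x + 1) / 2). assert (Hx0 := Cmod_ge_0 x).
  assert (Hr : 0 < r < 1) by (unfold r; lra).
  destruct (tame_mult_INR _ (tame_mult_INR _ Ha) r ltac:(lra)) as [M HM].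
  assert (HM0 : 0 <= M) by (apply (HM nil); constructor).
  apply Cder_intro. intros eps He.
  exists (Rmin (r - Cmod x) (eps * r ^ 2 / (M + 1))). split.
  { apply Rmin_pos; [unfold r; lra|]. apply Rdiv_lt_0_compat; [|lra].
    apply Rmult_lt_0_compat; [auto | nra]. }
  intros y Hy. set (h := (y - x)%C) in *.
  replace y with (x + h)%C by (unfold h; ring).
  assert (Hh1 : Cmod h < r - Cmod x) by (eapply Rlt_le_trans; [apply Hy | apply Rmin_l]).
  assert (Hh2 : Cmod h < eps * r ^ 2 / (M + 1)) by (eapply Rlt_le_trans; [apply Hy | apply Rmin_r]).
  assert (Hxh : Cmod (x + h) <= r) by (eapply Rle_trans; [apply Cmod_triangle | lra]).
  assert (Hd : hasSum (fun n => (a n * ((x + h) ^ n - x ^ n - CN n * x ^ pred n * h))%C)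
             (PS a (x + h) - PS a x - h * PS (PSd a) x)%C).
  { replace (PS a (x + h) - PS a x - h * PS (PSd a) x)%C with
      ((PS a (x + h) + (-1) * PS a x) + (-h) * PS (PSd a) x)%C by ring.
    apply hasSum_ext with (fun n => ((a n * (x + h) ^ n + (-1) * (a n * x ^ n)) +
      (-h) * (CN n * a n * x ^ pred n))%C); [intros n; ring|].
    apply hasSum_plus; [apply hasSum_plus; [|apply hasSum_scal]; apply PS_correct; auto; lra|].
    apply hasSum_scal.
    replace (PS (PSd a) x) with (CN 0 * a O * x ^ pred 0 + PS (PSd a) x)%C
      by (unfold CN; simpl; ring).
    apply hasSum_shift. simpl pred. apply PS_correct; auto. apply tame_PSd; auto. }
  apply Rle_trans with (M * Cmod h ^ 2 / r ^ 2).
  - apply (Cmod_csum_le _ (fun n => Cmod h ^ 2 / r ^ 2 *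
      (Cmod (CN n * (CN n * a n)) * r ^ n)) _ _ Hd).
    + intros n. rewrite !Cmod_mult, Cmod_CN.
      assert (H := pow_taylor x h r n ltac:(lra) ltac:(unfold r; lra) Hxh).
      assert (Hr2 : 0 < r ^ 2) by nra.
      apply Rmult_le_reg_l with (r ^ 2); auto.
      replace (r ^ 2 * (Cmod h ^ 2 / r ^ 2 * (INR n * (INR n * Cmod (a n)) * r ^ n))) with
        (Cmod (a n) * (INR n ^ 2 * r ^ n * Cmod h ^ 2)) by (field; lra).
      rewrite <- Rmult_assoc, (Rmult_comm (r ^ 2)), Rmult_assoc.
      apply Rmult_le_compat_l; auto. apply Cmod_ge_0.
    + intros s Hs. rewrite rsum_scal.
      replace (M * Cmod h ^ 2 / r ^ 2) with (Cmod h ^ 2 / r ^ 2 * M) by (field; lra).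
      apply Rmult_le_compat_l; [|apply HM; auto].
      apply Rmult_le_pos; [apply pow2_ge_0 | left; apply Rinv_0_lt_compat; nra].
  - assert (Hr2 : 0 < r ^ 2) by nra. assert (H0 := Cmod_ge_0 h).
    apply Rmult_le_reg_r with (r ^ 2); auto.
    replace (M * Cmod h ^ 2 / r ^ 2 * r ^ 2) with (M * Cmod h * Cmod h) by (field; lra).
    apply Rmult_lt_compat_r with (r := M + 1) in Hh2; [|lra].
    replace (eps * r ^ 2 / (M + 1) * (M + 1)) with (eps * r ^ 2) in Hh2 by (field; lra).
    nra.
Qed.

Lemma PS_0 a : tame a -> PS a 0 = a O.
Proof. intros Ha. rewrite PS_shift; auto; [ring|]. rewrite Cmod_0. lra. Qed.

Lemma PS_head_0 (a : nat -> C) : tame a ->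
  (forall x : R, 0 < x < 1 -> PS a x = RtoC 0) -> a O = RtoC 0.
Proof.
  intros Ha H. destruct (Req_dec (Cmod (a O)) 0) as [E|E]; [apply Cmod_eq_0, E|].
  assert (Hp : 0 < Cmod (a O)) by (pose proof (Cmod_ge_0 (a O)); lra).
  assert (H0 : Cmod 0 < 1) by (rewrite Cmod_0; lra).
  destruct (Cder_continuous _ _ _ (Cder_PS a 0 Ha H0) _ Hp) as [d [Hd HD]].
  set (x := Rmin (d / 2) (1 / 2)).
  assert (Hx : 0 < x) by (apply Rmin_pos; lra).
  assert (Hx1 : x <= 1 / 2) by apply Rmin_r. assert (Hx2 : x <= d / 2) by apply Rmin_l.
  specialize (HD (RtoC x)). rewrite H, PS_0 in HD; auto; [|lra].
  replace (RtoC x - 0)%C with (RtoC x) in HD by ring.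
  rewrite Cmod_R, Rabs_pos_eq in HD by lra.
  replace (0 - a O)%C with (- a O)%C in HD by ring. rewrite Cmod_opp in HD. lra.
Qed.

(** Only positive real arguments are tested, because these are the nomes of points on the imaginary
    axis. The leading coefficient vanishes by continuity at 0, and dividing by [x] lowers the
    degree. *)
Lemma PS_coef_0 (a : nat -> C) : tame a ->
  (forall x : R, 0 < x < 1 -> PS a x = RtoC 0) -> forall n, a n = RtoC 0.
Proof.
  intros Ha H n. revert a Ha H. induction n as [|n IH]; intros a Ha H;
    [apply PS_head_0; auto|].
  assert (H0 := PS_head_0 a Ha H).
  apply (IH (fun n => a (S n))); [apply tame_shift; auto|].
  intros x Hx. specialize (H x Hx). rewrite PS_shift, H0 in H; auto.
  2: { rewrite Cmod_R, Rabs_pos_eq; lra. }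
  assert (Hx0 : RtoC x <> RtoC 0) by (intros E; apply RtoC_inj in E; lra).
  replace (PS (fun n0 => a (S n0)) x) with (/ x * (0 + x * PS (fun n0 => a (S n0)) x))%C
    by (field; auto).
  rewrite H. ring.
Qed.

(** * Collecting the terms of a double series by degree *)

(** The coefficient of [x^N] after collecting terms. Under [idx_ge] the whole fibre over [N] lies in
    the box with sides [0..N], which makes this a finite sum. *)
Definition fib (idx : nat * nat -> nat) (c : nat * nat -> C) (N : nat) : C :=
  lsum (fun mn => if Nat.eqb (idx mn) N then c mn else RtoC 0)
    (list_prod (seq 0 (S N)) (seq 0 (S N))).

Definition idx_ge (idx : nat * nat -> nat) : Prop :=
  forall mn, (fst mn <= idx mn /\ snd mn <= idx mn)%nat.

Lemma NoDup_list_prod {A B : Type} (s : list A) (t : list B) :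
  NoDup s -> NoDup t -> NoDup (list_prod s t).
Proof.
  intros Hs Ht. rewrite list_prod_as_flat_map. apply NoDup_flat_pairs; auto.
Qed.

(** The family is moved onto the graph of [idx] inside the triples [(N, (m, n))] and extended by
    zero; Fubini over [N] then collects each fibre. *)
Lemma fib_sum idx c (x l : C) : idx_ge idx ->
  hasSum (fun mn => (c mn * x ^ idx mn)%C) l ->
  hasSum (fun N => (fib idx c N * x ^ N)%C) l.
Proof.
  intros Hidx H.
  pose (F := fun p : nat * (nat * nat) =>
    if Nat.eqb (idx (snd p)) (fst p) then (c (snd p) * x ^ fst p)%C else RtoC 0).
  assert (HF : hasSum F l).
  { apply hasSum_inj with (u := fun mn => (idx mn, mn)).
    - intros p p' E. congruence.
    - intros [N mn] Hn. unfold F. simpl. destruct (Nat.eqb_spec (idx mn) N); auto.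
      exfalso. apply (Hn mn). congruence.
    - eapply hasSum_ext; [|apply H]. intros mn. unfold F. simpl.
      rewrite Nat.eqb_refl. auto. }
  apply (hasSum_fubini F _ _ HF). intros N.
  replace (fib idx c N * x ^ N)%C with
    (lsum (fun mn => F (N, mn)) (list_prod (seq 0 (S N)) (seq 0 (S N)))).
  - apply hasSum_finite.
    + apply NoDup_list_prod; apply seq_NoDup.
    + intros [m n] Hmn. unfold F. simpl. destruct (Nat.eqb_spec (idx (m, n)) N); auto.
      exfalso. apply Hmn. specialize (Hidx (m, n)). simpl in Hidx.
      apply in_prod; apply in_seq; lia.
  - unfold fib. rewrite Cmult_comm, <- lsum_scal. apply lsum_ext. intros mn _.
    unfold F. simpl. destruct (Nat.eqb (idx mn) N); ring.
Qed.

Lemma fib_tame idx c : idx_ge idx ->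
  (forall r, 0 <= r < 1 -> bddSum (fun mn => Cmod (c mn) * r ^ idx mn)) -> tame (fib idx c).
Proof.
  intros Hidx H.
  (* Absolute summability follows by running [fib_sum] on the moduli: the fibre sums [v N] of moduli
     have a convergent series and dominate [fib idx c]. *)
  pose (c' := fun mn => RtoC (Cmod (c mn))).
  assert (Hc : forall N, exists v, 0 <= v /\ fib idx c' N = RtoC v /\ Cmod (fib idx c N) <= v).
  { intros N. unfold fib.
    exists (rsum (fun mn => if Nat.eqb (idx mn) N then Cmod (c mn) else 0)
      (list_prod (seq 0 (S N)) (seq 0 (S N)))). split; [|split].
    - apply rsum_pos. intros mn. destruct (Nat.eqb (idx mn) N); [apply Cmod_ge_0 | lra].
    - rewrite <- lsum_RtoC. apply lsum_ext. intros mn _. unfold c'.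
      destruct (Nat.eqb (idx mn) N); auto.
    - eapply Rle_trans; [apply Cmod_lsum|]. apply rsum_le. intros mn _.
      destruct (Nat.eqb (idx mn) N); [|rewrite Cmod_0]; lra. }
  apply choice in Hc. destruct Hc as [v Hv].
  intros r Hr.
  destruct (hasSum_nonneg (fun mn => Cmod (c mn) * r ^ idx mn)) as [l Hl].
  - intros. apply Rmult_le_pos; [apply Cmod_ge_0 | apply pow_le; lra].
  - auto.
  - apply bddSum_le with (fun N => v N * r ^ N).
    { intros N. apply Rmult_le_compat_r; [apply pow_le; lra | apply Hv]. }
    apply hasSum_bdd with (RtoC l).
    { intros N. apply Rmult_le_pos; [apply Hv | apply pow_le; lra]. }
    apply hasSum_ext with (fun N => (fib idx c' N * RtoC r ^ N)%C).
    { intros N. destruct (Hv N) as [_ [E _]]. rewrite E, RtoC_mult, RtoC_pow. auto. }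
    apply fib_sum; auto.
    eapply hasSum_ext; [|apply Hl]. intros mn. unfold c'. rewrite RtoC_mult, RtoC_pow. auto.
Qed.

Definition conv (a b : nat -> C) : nat -> C :=
  fib (fun mn => (fst mn + snd mn)%nat) (fun mn => (a (fst mn) * b (snd mn))%C).

Lemma conv_0 a b : conv a b O = (a O * b O)%C.
Proof. unfold conv, fib. simpl. ring. Qed.

Lemma tame_conv a b : tame a -> tame b -> tame (conv a b).
Proof.
  intros Ha Hb. apply fib_tame; [intros mn; lia|].
  intros r Hr.
  eapply bddSum_le; [|apply (bddSum_prod (fun n => Cmod (a n) * r ^ n)
    (fun n => Cmod (b n) * r ^ n)); auto].
  - intros [m n]. simpl. rewrite Cmod_mult, pow_add. lra.
  - intros. apply Rmult_le_pos; [apply Cmod_ge_0 | apply pow_le; lra].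
  - intros. apply Rmult_le_pos; [apply Cmod_ge_0 | apply pow_le; lra].
Qed.

Lemma PS_conv a b (x : C) : tame a -> tame b -> Cmod x < 1 ->
  PS (conv a b) x = (PS a x * PS b x)%C.
Proof.
  intros Ha Hb Hx. apply csum_unique. apply fib_sum; [intros mn; lia|].
  eapply hasSum_ext; [|apply hasSum_prod; [apply (tame_absSum a x) | apply (tame_absSum b x)
   | apply PS_correct | apply PS_correct]]; auto.
  intros [m n]. simpl. rewrite Cpow_add_r. ring.
Qed.

(** * Lambert series *)

(** Coefficients of the sum of [w(m) c(n) x^(m n)] over [m, n >= 1]. The successors make both
    indices positive, so the product bounds them and its fibres are finite. *)
Definition lamc (w c : nat -> C) : nat -> C :=
  fib (fun mn => (S (fst mn) * S (snd mn))%nat) (fun mn => (w (S (fst mn)) * c (S (snd mn)))%C).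

Definition Lam (w c : nat -> C) : C -> C := PS (lamc w c).

Lemma lamc_0 w c : lamc w c O = RtoC 0.
Proof. unfold lamc, fib. simpl. ring. Qed.

Lemma bddSum_lam w c r : tame w -> tame c -> 0 <= r < 1 ->
  bddSum (fun mn : nat * nat =>
    Cmod (w (S (fst mn)) * c (S (snd mn))) * r ^ (S (fst mn) * S (snd mn))).
Proof.
  intros Hw Hc Hr.
  eapply bddSum_le; [|apply (bddSum_prod (fun n => Cmod (w (S n)) * r ^ n)
    (fun n => Cmod (c (S n)) * r ^ n))].
  - intros [m n]. cbn [fst snd]. rewrite Cmod_mult.
    assert (r ^ (S m * S n) <= r ^ m * r ^ n).
    { rewrite <- pow_add. apply pow_decr; [lra | lia]. }
    assert (0 <= Cmod (w (S m)) * Cmod (c (S n))).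
    { apply Rmult_le_pos; apply Cmod_ge_0. }
    nra.
  - intros. apply Rmult_le_pos; [apply Cmod_ge_0 | apply pow_le; lra].
  - intros. apply Rmult_le_pos; [apply Cmod_ge_0 | apply pow_le; lra].
  - apply (tame_shift _ Hw); auto.
  - apply (tame_shift _ Hc); auto.
Qed.

Lemma tame_lamc w c : tame w -> tame c -> tame (lamc w c).
Proof.
  intros Hw Hc. apply fib_tame; [intros mn; lia|]. intros r Hr. apply bddSum_lam; auto.
Qed.

Lemma hasSum_Lam2 w c (x : C) : tame w -> tame c -> Cmod x < 1 ->
  hasSum (fun mn : nat * nat =>
    (w (S (fst mn)) * c (S (snd mn)) * x ^ (S (fst mn) * S (snd mn)))%C) (Lam w c x).
Proof.
  intros Hw Hc Hx.
  destruct (absSum_hasSum (fun mn : nat * nat =>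
    (w (S (fst mn)) * c (S (snd mn)) * x ^ (S (fst mn) * S (snd mn)))%C)) as [l Hl].
  - unfold absSum. eapply bddSum_le; [|apply (bddSum_lam w c (Cmod x)); auto].
    + intros mn. cbv beta. rewrite Cmod_mult, Cmod_pow. lra.
    + split; auto. apply Cmod_ge_0.
  - replace (Lam w c x) with l; auto. symmetry. apply csum_unique.
    apply fib_sum; auto. intros mn; lia.
Qed.

Lemma Cmod_pow_lt (x : C) n : Cmod x < 1 -> Cmod (x ^ S n) < 1.
Proof.
  intros Hx. rewrite Cmod_pow. assert (H0 := Cmod_ge_0 x).
  assert (H := pow_decr (Cmod x) 1 (S n) ltac:(lra) ltac:(lia)). simpl in *. lra.
Qed.

Lemma hasSum_Lam w c (x : C) : tame w -> tame c -> c O = RtoC 0 -> Cmod x < 1 ->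
  hasSum (fun n => (w (S n) * PS c (x ^ S n))%C) (Lam w c x).
Proof.
  intros Hw Hc Hc0 Hx.
  apply (hasSum_fubini _ _ _ (hasSum_Lam2 w c x Hw Hc Hx)). intros n. cbn [fst snd].
  assert (Hn := Cmod_pow_lt x n Hx).
  rewrite PS_shift, Hc0 by auto.
  replace (w (S n) * (0 + x ^ S n * PS (fun k => c (S k)) (x ^ S n)))%C with
    (w (S n) * (x ^ S n * PS (fun k => c (S k)) (x ^ S n)))%C by ring.
  eapply hasSum_ext; [|apply hasSum_scal, hasSum_scal, PS_correct; [apply tame_shift, Hc | auto]].
  intros k. cbv beta. rewrite Cpow_mult_r, !Cpow_S. ring.
Qed.

(** Exchanging the complementary divisors [m] and [n] relates the two Lambert forms of the same
    power series. *)
Lemma Lam_sym w c (x : C) : tame w -> tame c -> Cmod x < 1 -> Lam w c x = Lam c w x.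
Proof.
  intros Hw Hc Hx. symmetry.
  eapply hasSum_unique; [|apply hasSum_Lam2; auto].
  apply hasSum_inj with (u := fun mn : nat * nat => (snd mn, fst mn)).
  - intros [m n] [m' n']. simpl. congruence.
  - intros [m n] H. exfalso. apply (H (n, m)). auto.
  - eapply hasSum_ext; [|apply (hasSum_Lam2 c w x); auto].
    intros [m n]. cbn [fst snd]. rewrite Nat.mul_comm. ring.
Qed.

(** * Arithmetic weights and their generating functions *)

Definition one1 (k : nat) : C := match k with O => 0 | _ => 1 end.
Definition alt (k : nat) : C := match k with O => RtoC 0 | S j => (RtoC (-1) ^ j)%C end.
(** The nontrivial Dirichlet character modulo 4, encoded by [chi4 (j + 2) = - chi4 j], which is what
    yields the generating function [y / (1 + y^2)]. *)
Fixpoint chi4 (k : nat) : C :=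
  match k with O => RtoC 0 | S O => RtoC 1 | S (S j) => (- chi4 j)%C end.

(* The coefficients of [x d/dx]. *)
Definition nm (a : nat -> C) : nat -> C := fun n => (CN n * a n)%C.

Lemma tame_nm a : tame a -> tame (nm a).
Proof. apply tame_mult_INR. Qed.

Lemma tame_bd (a : nat -> C) : (forall n, Cmod (a n) <= 1) -> tame a.
Proof.
  intros H. apply tame_le with (fun _ => RtoC 1); [|apply tame_const].
  intros n. rewrite Cmod_1. auto.
Qed.

Lemma tame_one1 : tame one1.
Proof. apply tame_bd. intros [|n]; simpl; [rewrite Cmod_0 | rewrite Cmod_1]; lra. Qed.

Lemma tame_alt : tame alt.
Proof.
  apply tame_bd. intros [|n]; simpl; [rewrite Cmod_0; lra|].
  rewrite Cmod_pow, Cmod_R. replace (Rabs (-1)) with 1 by (rewrite Rabs_left; lra).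
  rewrite pow1. lra.
Qed.

Lemma tame_chi4 : tame chi4.
Proof.
  apply tame_bd.
  assert (H : forall n, Cmod (chi4 n) <= 1 /\ Cmod (chi4 (S n)) <= 1); [|intros n; apply H].
  induction n as [|n [H1 H2]]; simpl.
  - rewrite Cmod_0, Cmod_1. lra.
  - split; auto. rewrite Cmod_opp. auto.
Qed.

Lemma tame_n1 : tame (nm one1).
Proof. apply tame_nm, tame_one1. Qed.
Lemma tame_n3 : tame (nm (nm (nm one1))).
Proof. repeat apply tame_nm. apply tame_one1. Qed.
Lemma tame_nalt : tame (nm alt).
Proof. apply tame_nm, tame_alt. Qed.
Lemma tame_nchi4 : tame (nm chi4).
Proof. apply tame_nm, tame_chi4. Qed.
#[export] Hint Resolve tame_one1 tame_alt tame_chi4 tame_n1 tame_n3 tame_nalt tame_nchi4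
  tame_nm tame_PSd tame_shift tame_lamc tame_conv tame_plus tame_scal : tame.

Lemma one_minus_neq (y : C) : Cmod y < 1 -> (1 - y)%C <> RtoC 0.
Proof.
  intros H E. replace y with (RtoC 1) in H; [rewrite Cmod_1 in H; lra|].
  replace y with (1 - (1 - y))%C by ring. rewrite E. ring.
Qed.

Lemma one_plus_neq (y : C) : Cmod y < 1 -> (1 + y)%C <> RtoC 0.
Proof.
  intros H. replace (1 + y)%C with (1 - - y)%C by ring. apply one_minus_neq.
  rewrite Cmod_opp. auto.
Qed.

Lemma Cmod_sqr_lt (y : C) : Cmod y < 1 -> Cmod (y * y) < 1.
Proof. intros H. rewrite Cmod_mult. assert (H0 := Cmod_ge_0 y). nra. Qed.

(** The recursion of the coefficients gives a linear equation for the series, and the closed form is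
    its solution. The weights [chi4], [alt] and their multiples by [n] are handled in the same
    way. *)
Lemma PS_one1 (y : C) : Cmod y < 1 -> PS one1 y = (y / (1 - y))%C.
Proof.
  intros Hy. assert (Hn := one_minus_neq y Hy).
  assert (E : PS (fun n => one1 (S n)) y = (1 + PS one1 y)%C).
  { rewrite (PS_shift (fun n => one1 (S n))) by auto with tame.
    rewrite (PS_shift one1) by auto with tame. simpl. ring. }
  assert (E2 : PS one1 y = (y * (1 + PS one1 y))%C).
  { rewrite <- E. rewrite PS_shift at 1 by auto with tame. simpl. ring. }
  replace (PS one1 y) with ((PS one1 y - y * (1 + PS one1 y) + y) / (1 - y))%C by (field; auto).
  rewrite <- E2. field. auto.
Qed.

Lemma PS_shift2 (a : nat -> C) (x : C) : tame a -> Cmod x < 1 ->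
  PS a x = (a O + x * a 1%nat + x * x * PS (fun n => a (S (S n))) x)%C.
Proof.
  intros Ha Hx. rewrite PS_shift by auto.
  rewrite (PS_shift (fun n => a (S n))) by auto with tame. ring.
Qed.

Lemma PS_chi4 (y : C) : Cmod y < 1 -> PS chi4 y = (y / (1 + y * y))%C.
Proof.
  intros Hy. assert (Hn := one_plus_neq _ (Cmod_sqr_lt y Hy)).
  assert (E : PS chi4 y = (y - y * y * PS chi4 y)%C).
  { rewrite PS_shift2 at 1 by auto with tame.
    rewrite (PS_ext _ (fun n => (-1 * chi4 n)%C)) by (intros n; simpl; ring).
    rewrite PS_scal by auto with tame. simpl. ring. }
  replace (PS chi4 y) with ((PS chi4 y - (y - y * y * PS chi4 y) + y) / (1 + y * y))%C
    by (field; auto).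
  rewrite <- E. field. auto.
Qed.

Lemma PS_nchi4 (y : C) : Cmod y < 1 ->
  PS (nm chi4) y = (y * (1 - y * y) / ((1 + y * y) * (1 + y * y)))%C.
Proof.
  intros Hy. assert (Hn := one_plus_neq _ (Cmod_sqr_lt y Hy)).
  assert (E : PS (nm chi4) y = (y - y * y * PS (nm chi4) y - 2 * y * y * PS chi4 y)%C).
  { rewrite PS_shift2 at 1 by auto with tame.
    rewrite (PS_ext _ (fun n => (-1 * nm chi4 n + -2 * chi4 n)%C)).
    - rewrite PS_plus, !PS_scal by auto with tame. unfold nm, CN. simpl. ring.
    - intros n. unfold nm. rewrite !CN_S. simpl. ring. }
  rewrite PS_chi4 in E by auto.
  replace (PS (nm chi4) y) with ((PS (nm chi4) y -
    (y - y * y * PS (nm chi4) y - 2 * y * y * (y / (1 + y * y)))) / (1 + y * y) +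
    y * (1 - y * y) / ((1 + y * y) * (1 + y * y)))%C by (field; auto).
  rewrite <- E. field. auto.
Qed.

Lemma PS_alt (y : C) : Cmod y < 1 -> PS alt y = (y / (1 + y))%C.
Proof.
  intros Hy. assert (Hn := one_plus_neq y Hy).
  assert (E : PS alt y = (y - y * PS alt y)%C).
  { rewrite PS_shift2 at 1 by auto with tame.
    rewrite (PS_ext _ (fun n => (-1 * alt (S n))%C)) by (intros n; simpl; ring).
    rewrite PS_scal by auto with tame.
    rewrite (PS_shift alt) by auto with tame. simpl. ring. }
  replace (PS alt y) with ((PS alt y - (y - y * PS alt y) + y) / (1 + y))%C by (field; auto).
  rewrite <- E. field. auto.
Qed.

Lemma PS_nalt (y : C) : Cmod y < 1 -> PS (nm alt) y = (y / ((1 + y) * (1 + y)))%C.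
Proof.
  intros Hy. assert (Hn := one_plus_neq y Hy).
  assert (E : PS (nm alt) y = (y - y * PS (nm alt) y - y * PS alt y)%C).
  { rewrite PS_shift2 at 1 by auto with tame.
    rewrite (PS_ext _ (fun n => (-1 * nm alt (S n) + -1 * alt (S n))%C)).
    - rewrite PS_plus, !PS_scal by auto with tame.
      rewrite (PS_shift (nm alt)), (PS_shift alt) by auto with tame.
      unfold nm, CN. simpl. ring.
    - intros n. unfold nm. rewrite !CN_S. simpl. ring. }
  rewrite PS_alt in E by auto.
  replace (PS (nm alt) y) with ((PS (nm alt) y -
    (y - y * PS (nm alt) y - y * (y / (1 + y)))) / (1 + y) +
    y / ((1 + y) * (1 + y)))%C by (field; auto).
  rewrite <- E. field. auto.
Qed.

Lemma PS_theta_Lam w c (x : C) : PS (nm (lamc w c)) x = Lam (nm w) (nm c) x.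
Proof.
  apply PS_ext. intros N. unfold nm, lamc, fib. rewrite <- lsum_scal.
  apply lsum_ext. intros [m n] _. cbn [fst snd].
  destruct (Nat.eqb_spec (S m * S n) N) as [E|E]; [|ring].
  rewrite <- E. unfold CN. rewrite mult_INR, RtoC_mult. ring.
Qed.

(** [Sf] and [Tf] generate the divisor sums [sigma_1] and [sigma_3]; [L4] generates the divisor sums
    of the character, that is, a quarter of the number of representations as a sum of two
    squares. *)
Definition Sf : C -> C := Lam (nm one1) one1.
Definition Tf : C -> C := Lam (nm (nm (nm one1))) one1.
Definition L4 : C -> C := Lam one1 chi4.
(* [theta_3^2 / 2]. *)
Definition af (x : C) : C := (1 / 2 + 2 * L4 x)%C.

Lemma hasSum_Sf (x : C) : Cmod x < 1 ->
  hasSum (fun n => (CN (S n) * (x ^ S n / (1 - x ^ S n)))%C) (Sf x).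
Proof.
  intros Hx. eapply hasSum_ext; [|apply (hasSum_Lam (nm one1) one1 x); auto with tame].
  intros n. cbv beta. rewrite PS_one1 by (apply Cmod_pow_lt; auto). unfold nm. simpl. ring.
Qed.

Lemma hasSum_Tf (x : C) : Cmod x < 1 ->
  hasSum (fun n => (CN (S n) ^ 3 * (x ^ S n / (1 - x ^ S n)))%C) (Tf x).
Proof.
  intros Hx. eapply hasSum_ext; [|apply (hasSum_Lam (nm (nm (nm one1))) one1 x); auto with tame].
  intros n. cbv beta. rewrite PS_one1 by (apply Cmod_pow_lt; auto). unfold nm. simpl. ring.
Qed.

Lemma hasSum_L4 (x : C) : Cmod x < 1 ->
  hasSum (fun n => (x ^ S n / (1 + x ^ S n * x ^ S n))%C) (L4 x).
Proof.
  intros Hx. eapply hasSum_ext; [|apply (hasSum_Lam one1 chi4 x); auto with tame].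
  intros n. cbv beta. rewrite PS_chi4 by (apply Cmod_pow_lt; auto). simpl. ring.
Qed.

Lemma hasSum_thL4 (x : C) : Cmod x < 1 ->
  hasSum (fun n => (CN (S n) * (x ^ S n * (1 - x ^ S n * x ^ S n) /
    ((1 + x ^ S n * x ^ S n) * (1 + x ^ S n * x ^ S n))))%C) (Lam (nm one1) (nm chi4) x).
Proof.
  intros Hx. eapply hasSum_ext; [|apply (hasSum_Lam (nm one1) (nm chi4) x); auto with tame].
  - intros n. cbv beta. rewrite PS_nchi4 by (apply Cmod_pow_lt; auto). unfold nm. simpl. ring.
  - unfold nm. simpl. ring.
Qed.

(** Termwise [y / (1 + y) = y / (1 - y) - 2 y^2 / (1 - y^2)] with [y = x^n]. *)
Lemma hasSum_A (x : C) : Cmod x < 1 ->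
  hasSum (fun n => (CN (S n) * (x ^ S n / (1 + x ^ S n)))%C) (Sf x - 2 * Sf (x * x))%C.
Proof.
  intros Hx.
  replace (Sf x - 2 * Sf (x * x))%C with (Sf x + -2 * Sf (x * x))%C by ring.
  eapply hasSum_ext; [|apply hasSum_plus; [apply hasSum_Sf; auto
    | apply hasSum_scal, hasSum_Sf, Cmod_sqr_lt; auto]].
  intros n. cbv beta. rewrite Cpow_mult_l.
  set (y := (x ^ S n)%C). assert (Hy : Cmod y < 1) by (apply Cmod_pow_lt; auto).
  assert (H1 := one_plus_neq y Hy). assert (H2 := one_minus_neq y Hy).
  assert (H3 := one_minus_neq _ (Cmod_sqr_lt y Hy)).
  assert (H4 : (1 - y * y)%C = ((1 - y) * (1 + y))%C) by ring.
  field; auto.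
Qed.

(** The sign [(-1)^n] sits on the term of index [n + 1], so the minus signs fall on the even
    indices: the alternating sum is the full one minus twice its even part. *)
Lemma hasSum_alternate (a : nat -> C) l l2 :
  hasSum (fun n => a (S n)) l -> hasSum (fun n => a (2 * S n)%nat) l2 ->
  hasSum (fun n => (RtoC (-1) ^ n * a (S n))%C) (l - 2 * l2)%C.
Proof.
  intros H H2.
  replace (l - 2 * l2)%C with (l + -2 * l2)%C by ring.
  pose (b := fun n => if Nat.even (S n) then a (S n) else RtoC 0).
  apply hasSum_ext with (fun n => (a (S n) + -2 * b n)%C).
  - intros n. unfold b. rewrite Nat.even_succ.
    destruct (Nat.odd n) eqn:E.
    + rewrite Nat.odd_spec in E. destruct E as [m ->].
      rewrite Cpow_add_r, Cpow_mult_r.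
      replace (RtoC (-1) ^ 2)%C with (RtoC 1) by (simpl; ring). rewrite Cpow_1_l. simpl. ring.
    + rewrite <- Nat.negb_even in E. destruct (Nat.even n) eqn:E2; [|discriminate].
      rewrite Nat.even_spec in E2. destruct E2 as [m ->].
      rewrite Cpow_mult_r. replace (RtoC (-1) ^ 2)%C with (RtoC 1) by (simpl; ring).
      rewrite Cpow_1_l. ring.
  - apply hasSum_plus; auto. apply hasSum_scal.
    apply hasSum_inj with (u := fun n => (2 * n + 1)%nat).
    + intros; lia.
    + intros n Hn. unfold b. destruct (Nat.even (S n)) eqn:E; auto.
      rewrite Nat.even_spec in E. destruct E as [m Hm].
      exfalso. apply (Hn (m - 1)%nat). lia.
    + eapply hasSum_ext; [|apply H2]. intros n. unfold b.
      replace (S (2 * n + 1)) with (2 * S n)%nat by lia.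
      rewrite Nat.even_even; auto.
Qed.

Lemma pow_2mul (x : C) n : (x ^ (2 * n))%C = ((x * x) ^ n)%C.
Proof. rewrite Cpow_mult_r. f_equal. simpl. ring. Qed.

Lemma CN_mul m n : CN (m * n) = (CN m * CN n)%C.
Proof. unfold CN. rewrite mult_INR, RtoC_mult. auto. Qed.

Lemma CN_2 : CN 2 = RtoC 2.
Proof. unfold CN. simpl. auto. Qed.

Lemma hasSum_B (x : C) : Cmod x < 1 ->
  hasSum (fun n => (RtoC (-1) ^ n * (CN (S n) * (x ^ S n / (1 - x ^ S n))))%C)
    (Sf x - 4 * Sf (x * x))%C.
Proof.
  intros Hx.
  replace (Sf x - 4 * Sf (x * x))%C with (Sf x - 2 * (2 * Sf (x * x)))%C by ring.
  apply (hasSum_alternate (fun n => (CN n * (x ^ n / (1 - x ^ n)))%C)).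
  - apply hasSum_Sf; auto.
  - eapply hasSum_ext; [|apply hasSum_scal, hasSum_Sf, Cmod_sqr_lt; auto].
    intros n. cbv beta. rewrite pow_2mul, CN_mul, CN_2. unfold Cdiv. ring.
Qed.

Lemma hasSum_C4 (x : C) : Cmod x < 1 ->
  hasSum (fun n => (RtoC (-1) ^ n * (CN (S n) ^ 3 * (x ^ S n / (1 - x ^ S n))))%C)
    (Tf x - 16 * Tf (x * x))%C.
Proof.
  intros Hx.
  replace (Tf x - 16 * Tf (x * x))%C with (Tf x - 2 * (8 * Tf (x * x)))%C by ring.
  apply (hasSum_alternate (fun n => (CN n ^ 3 * (x ^ n / (1 - x ^ n)))%C)).
  - apply hasSum_Tf; auto.
  - eapply hasSum_ext; [|apply hasSum_scal, hasSum_Tf, Cmod_sqr_lt; auto].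
    intros n. cbv beta. rewrite pow_2mul, CN_mul, CN_2. unfold Cdiv. ring.
Qed.

(* [sum q^n / (1 + q^n)^2], the constant term in the expansion of the square of [f]. *)
Lemma hasSum_c0 (x : C) : Cmod x < 1 ->
  hasSum (fun n => (x ^ S n / ((1 + x ^ S n) * (1 + x ^ S n)))%C) (Sf x - 4 * Sf (x * x))%C.
Proof.
  intros Hx.
  replace (Sf x - 4 * Sf (x * x))%C with (Lam one1 (nm alt) x).
  - eapply hasSum_ext; [|apply (hasSum_Lam one1 (nm alt) x); auto with tame].
    + intros n. cbv beta. rewrite PS_nalt by (apply Cmod_pow_lt; auto). simpl. ring.
    + unfold nm. simpl. ring.
  - rewrite Lam_sym by auto with tame.
    eapply hasSum_unique; [apply (hasSum_Lam (nm alt) one1 x); auto with tame|].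
    eapply hasSum_ext; [|apply hasSum_B; auto].
    intros n. cbv beta. rewrite PS_one1 by (apply Cmod_pow_lt; auto). unfold nm. cbn [alt]. ring.
Qed.

Lemma hasSum_h (x : C) : Cmod x < 1 ->
  hasSum (fun n => (CN (S n) * (x ^ S n / (1 - x ^ S n * x ^ S n)))%C) (Sf x - Sf (x * x))%C.
Proof.
  intros Hx.
  replace (Sf x - Sf (x * x))%C with (Sf x + -1 * Sf (x * x))%C by ring.
  eapply hasSum_ext; [|apply hasSum_plus; [apply hasSum_Sf; auto
    | apply hasSum_scal, hasSum_Sf, Cmod_sqr_lt; auto]].
  intros n. cbv beta. rewrite Cpow_mult_l.
  set (y := (x ^ S n)%C). assert (Hy : Cmod y < 1) by (apply Cmod_pow_lt; auto).
  assert (H2 := one_minus_neq y Hy).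
  assert (H3 := one_minus_neq _ (Cmod_sqr_lt y Hy)).
  field; auto.
Qed.

Lemma hasSum_h3 (x : C) : Cmod x < 1 ->
  hasSum (fun n => (CN (S n) ^ 3 * (x ^ S n / (1 - x ^ S n * x ^ S n)))%C) (Tf x - Tf (x * x))%C.
Proof.
  intros Hx.
  replace (Tf x - Tf (x * x))%C with (Tf x + -1 * Tf (x * x))%C by ring.
  eapply hasSum_ext; [|apply hasSum_plus; [apply hasSum_Tf; auto
    | apply hasSum_scal, hasSum_Tf, Cmod_sqr_lt; auto]].
  intros n. cbv beta. rewrite Cpow_mult_l.
  set (y := (x ^ S n)%C). assert (Hy : Cmod y < 1) by (apply Cmod_pow_lt; auto).
  assert (H2 := one_minus_neq y Hy).
  assert (H3 := one_minus_neq _ (Cmod_sqr_lt y Hy)).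
  field; auto.
Qed.

(** For odd [phi] the term at [(-x)^n] is [(-1)^n] times the term at [x^n], so odd indices cancel
    and even ones double. The proof equates two evaluations of the alternating sum. *)
Lemma hasSum_even_part (w : nat -> C) (phi : C -> C) (x l l' l2 : C) :
  (forall y, phi (- y)%C = (- phi y)%C) ->
  hasSum (fun n => (w (S n) * phi (x ^ S n))%C) l ->
  hasSum (fun n => (w (S n) * phi ((- x) ^ S n))%C) l' ->
  hasSum (fun n => (w (2 * S n)%nat * phi ((x * x) ^ S n))%C) l2 ->
  (l + l')%C = (2 * l2)%C.
Proof.
  intros Hphi H H' H2.
  assert (E := hasSum_alternate (fun n => (w n * phi (x ^ n))%C) l l2 H).
  assert (E' : hasSum (fun n => (RtoC (-1) ^ n * (w (S n) * phi (x ^ S n)))%C) (l - 2 * l2)%C).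
  { apply E. eapply hasSum_ext; [|apply H2]. intros n. cbv beta. rewrite pow_2mul. auto. }
  assert (E2 : hasSum (fun n => (RtoC (-1) ^ n * (w (S n) * phi (x ^ S n)))%C) (-1 * l')%C).
  { eapply hasSum_ext; [|apply hasSum_scal, H']. intros n. cbv beta.
    replace (- x)%C with (RtoC (-1) * x)%C by ring. rewrite Cpow_mult_l.
    assert (Hm : forall n, (RtoC (-1) ^ n)%C = RtoC 1 \/ (RtoC (-1) ^ n)%C = RtoC (-1)).
    { induction n0 as [|k [IH|IH]]; [left; auto| |]; rewrite Cpow_S, IH; [right | left]; ring. }
    rewrite (Cpow_S (RtoC (-1))). destruct (Hm n) as [->| ->].
    - replace (RtoC (-1) * 1 * x ^ S n)%C with (- x ^ S n)%C by ring. rewrite Hphi. ring.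
    - replace (RtoC (-1) * RtoC (-1) * x ^ S n)%C with (x ^ S n)%C by ring. ring. }
  assert (E3 := hasSum_unique _ _ _ E' E2).
  replace l' with (- (-1 * l'))%C by ring. rewrite <- E3. ring.
Qed.

(** The summand [y / (1 - y)] of [Sf] is not odd in [y], but the summand [y / (1 - y^2)] of
    [Sf x - Sf (x^2)] is, and [hasSum_even_part] applies to that combination. *)
Lemma Sf_neg (x : C) : Cmod x < 1 ->
  Sf (- x) = (- Sf x + 6 * Sf (x * x) - 4 * Sf (x * x * (x * x)))%C.
Proof.
  intros Hx. assert (Hx' : Cmod (- x) < 1) by (rewrite Cmod_opp; auto).
  assert (H := hasSum_even_part CN (fun y => (y / (1 - y * y))%C) x _ _
    (2 * (Sf (x * x) - Sf (x * x * (x * x))))%C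
    ltac:(intros y; cbv beta; replace (1 - - y * - y)%C with (1 - y * y)%C by ring; unfold Cdiv; ring)
    (hasSum_h x Hx) (hasSum_h _ Hx')).
  replace (- x * - x)%C with (x * x)%C in H by ring.
  assert (E : (Sf x - Sf (x * x) + (Sf (- x) - Sf (x * x)))%C =
    (2 * (2 * (Sf (x * x) - Sf (x * x * (x * x)))))%C).
  { apply H. eapply hasSum_ext; [|apply hasSum_scal, hasSum_h, Cmod_sqr_lt; auto].
    intros n. cbv beta. rewrite CN_mul, CN_2. ring. }
  replace (Sf (- x)) with ((Sf x - Sf (x * x) + (Sf (- x) - Sf (x * x))) - Sf x + 2 * Sf (x * x))%C
    by ring.
  rewrite E. ring.
Qed.

(** Classically [theta_3^2 + theta_4^2 = 2 theta_3(q^2)^2]. It is the arithmetic-mean half of the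
    mean iteration. *)
Lemma af_even (x : C) : Cmod x < 1 -> (af x + af (- x))%C = (2 * af (x * x))%C.
Proof.
  intros Hx. assert (Hx' : Cmod (- x) < 1) by (rewrite Cmod_opp; auto).
  unfold af.
  assert (E : (L4 x + L4 (- x))%C = (2 * L4 (x * x))%C).
  { apply (hasSum_even_part (fun _ => RtoC 1) (fun y => (y / (1 + y * y))%C) x).
    - intros y; cbv beta; replace (1 + - y * - y)%C with (1 + y * y)%C by ring; unfold Cdiv; ring.
    - eapply hasSum_ext; [|apply hasSum_L4; auto]. intros n. cbv beta. ring.
    - eapply hasSum_ext; [|apply hasSum_L4; auto]. intros n. cbv beta. ring.
    - eapply hasSum_ext; [|apply hasSum_L4, Cmod_sqr_lt; auto]. intros n. cbv beta. ring. }
  replace (1 / 2 + 2 * L4 x + (1 / 2 + 2 * L4 (- x)))%C with (1 + 2 * (L4 x + L4 (- x)))%C by field.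
  rewrite E. field.
Qed.

(** * Sums over the integers *)

Lemma CZ_nat n : CZ (Z.of_nat n) = CN n.
Proof. unfold CZ, CN. rewrite <- INR_IZR_INZ. auto. Qed.

Lemma CZ_opp n : CZ (- n) = (- CZ n)%C.
Proof. unfold CZ. rewrite opp_IZR, RtoC_opp. auto. Qed.

Lemma CZ_add m n : CZ (m + n) = (CZ m + CZ n)%C.
Proof. unfold CZ. rewrite plus_IZR, RtoC_plus. auto. Qed.

Lemma CZ_mul m n : CZ (m * n) = (CZ m * CZ n)%C.
Proof. unfold CZ. rewrite mult_IZR, RtoC_mult. auto. Qed.

Lemma CZ_sub m n : CZ (m - n) = (CZ m - CZ n)%C.
Proof. unfold CZ. rewrite minus_IZR, RtoC_minus. auto. Qed.

Lemma Z_cases (n : Z) :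
  n = 0%Z \/ (exists k, n = Z.of_nat (S k)) \/ (exists k, n = (- Z.of_nat (S k))%Z).
Proof.
  destruct (Z.lt_trichotomy n 0) as [H|[H|H]]; auto.
  - right; right. exists (Z.to_nat (- n) - 1)%nat. lia.
  - right; left. exists (Z.to_nat n - 1)%nat. lia.
Qed.

Lemma hasSum_Z (F : Z -> C) l l' :
  hasSum (fun n => F (Z.of_nat (S n))) l -> hasSum (fun n => F (- Z.of_nat (S n))%Z) l' ->
  hasSum F (F 0%Z + (l + l'))%C.
Proof.
  intros H H'.
  apply hasSum_ext with (fun n => ((if Z.eqb n 0 then F n else 0) +
    ((if Z.ltb 0 n then F n else 0) + (if Z.ltb n 0 then F n else 0)))%C).
  { intros n. destruct (Z.eqb_spec n 0), (Z.ltb_spec 0 n), (Z.ltb_spec n 0); try lia; ring. }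
  apply hasSum_plus; [|apply hasSum_plus].
  - apply (hasSum_single 0%Z (fun n => if Z.eqb n 0 then F n else RtoC 0)).
    intros n Hn. destruct (Z.eqb_spec n 0); auto. contradiction.
  - apply hasSum_inj with (u := fun n => Z.of_nat (S n)).
    + intros; lia.
    + intros n Hn. destruct (Z.ltb_spec 0 n); auto.
      exfalso. apply (Hn (Z.to_nat n - 1)%nat). lia.
    + eapply hasSum_ext; [|apply H]. intros n. destruct (Z.ltb_spec 0 (Z.of_nat (S n))); auto. lia.
  - apply hasSum_inj with (u := fun n => (- Z.of_nat (S n))%Z).
    + intros; lia.
    + intros n Hn. destruct (Z.ltb_spec n 0); auto.
      exfalso. apply (Hn (Z.to_nat (- n) - 1)%nat). lia.
    + eapply hasSum_ext; [|apply H']. intros n.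
      destruct (Z.ltb_spec (- Z.of_nat (S n)) 0); auto. lia.
Qed.

Lemma hasSum_Z_even (F : Z -> C) l :
  (forall n, F (- n)%Z = F n) -> hasSum (fun n => F (Z.of_nat (S n))) l ->
  hasSum F (F 0%Z + 2 * l)%C.
Proof.
  intros He H. replace (2 * l)%C with (l + l)%C by ring. apply hasSum_Z; auto.
  eapply hasSum_ext; [|apply H]. intros n. auto.
Qed.

Lemma hasSum_Z_opp (F : Z -> C) l : hasSum F l -> hasSum (fun n => F (- n)%Z) l.
Proof.
  intros H. apply hasSum_inj with (u := Z.opp).
  - intros; lia.
  - intros n Hn. exfalso. apply (Hn (- n)%Z). lia.
  - eapply hasSum_ext; [|apply H]. intros n. rewrite Z.opp_involutive. auto.
Qed.

Lemma hasSum_Z_shift (F : Z -> C) l k : hasSum F l -> hasSum (fun n => F (n - k)%Z) l.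
Proof.
  intros H. apply hasSum_inj with (u := fun n => (n + k)%Z).
  - intros; lia.
  - intros n Hn. exfalso. apply (Hn (n - k)%Z). lia.
  - eapply hasSum_ext; [|apply H]. intros n. f_equal. lia.
Qed.

(** Reflection of the index turns the sum into its own negative. *)
Lemma hasSum_Z_odd (F : Z -> C) : (forall n, F (- n)%Z = (- F n)%C) -> absSum F -> hasSum F 0.
Proof.
  intros Ho Ha. destruct (absSum_hasSum F Ha) as [l Hl].
  assert (H := hasSum_scal (-1) _ _ Hl).
  assert (E : l = (-1 * l)%C).
  { apply (hasSum_unique (fun n => F (- n)%Z)).
    - apply hasSum_Z_opp; auto.
    - eapply hasSum_ext; [|apply H]. intros n. cbv beta. rewrite Ho. ring. }
  replace (RtoC 0) with l; auto.
  replace l with ((l - -1 * l) / 2)%C by field. rewrite <- E. field.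
Qed.

Lemma bddSum_inj {I J : Type} (f : I -> R) (u : J -> I) :
  (forall i, 0 <= f i) -> (forall j j', u j = u j' -> j = j') ->
  (forall i, (forall j, u j <> i) -> f i = 0) ->
  bddSum (fun j => f (u j)) -> bddSum f.
Proof.
  intros Hf Hu Hz H.
  destruct (hasSum_nonneg (fun j => f (u j))) as [l Hl]; auto.
  apply hasSum_bdd with (RtoC l); auto.
  apply hasSum_inj with (u := u); auto. intros i Hi. rewrite Hz; auto.
Qed.

Lemma bddSum_Z (f : Z -> R) : (forall n, 0 <= f n) ->
  bddSum (fun n => f (Z.of_nat n)) -> bddSum (fun n => f (- Z.of_nat n)%Z) -> bddSum f.
Proof.
  intros Hf H H'.
  apply bddSum_le with (fun n => (if Z.leb 0 n then f n else 0) + (if Z.leb n 0 then f n else 0)).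
  { intros n. specialize (Hf n). destruct (Z.leb_spec 0 n), (Z.leb_spec n 0); try lra. lia. }
  apply bddSum_plus.
  - apply bddSum_inj with (u := Z.of_nat).
    + intros n. specialize (Hf n). destruct (Z.leb 0 n); lra.
    + intros; lia.
    + intros n Hn. destruct (Z.leb_spec 0 n); auto. exfalso. apply (Hn (Z.to_nat n)). lia.
    + eapply bddSum_le; [|apply H]. intros n. cbv beta. specialize (Hf (Z.of_nat n)).
      destruct (Z.leb 0 (Z.of_nat n)); lra.
  - apply bddSum_inj with (u := fun n => (- Z.of_nat n)%Z).
    + intros n. specialize (Hf n). destruct (Z.leb n 0); lra.
    + intros; lia.
    + intros n Hn. destruct (Z.leb_spec n 0); auto. exfalso. apply (Hn (Z.to_nat (- n))). lia.
    + eapply bddSum_le; [|apply H']. intros n. cbv beta. specialize (Hf (- Z.of_nat n)%Z).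
      destruct (Z.leb (- Z.of_nat n) 0); lra.
Qed.

Lemma absSum_Z (F : Z -> C) K r : 0 <= r < 1 -> 0 <= K ->
  (forall n, Cmod (F (- n)%Z) = Cmod (F n)) ->
  (forall n, Cmod (F (Z.of_nat n)) <= K * ((INR n ^ 2 + 1) * r ^ n)) -> absSum F.
Proof.
  intros Hr HK Hs HF.
  assert (H : bddSum (fun n => Cmod (F (Z.of_nat n)))).
  { apply bddSum_le with (fun n => K * ((INR n ^ 2 + 1) * r ^ n)); auto.
    apply bddSum_scal; auto.
    eapply bddSum_le; [|apply bddSum_plus;
      [apply (tame_nm _ (tame_nm _ (tame_const 1)) r Hr) | apply (tame_const 1 r Hr)]].
    intros n. cbv beta. unfold nm. rewrite !Cmod_mult, Cmod_CN, Cmod_1. lra. }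
  apply bddSum_Z; auto.
  - intros n. apply Cmod_ge_0.
  - eapply bddSum_le; [|apply H]. intros n. cbv beta. rewrite Hs. lra.
Qed.

(** Along a diagonal [m + n = N] the product [x^m x^n] is constant; this is why products of
    bilateral series are evaluated in this order. *)
Lemma hasSum_diag (F : Z * Z -> C) (r : Z -> C) l :
  hasSum F l -> (forall N, hasSum (fun m => F (m, N - m)%Z) (r N)) -> hasSum r l.
Proof.
  intros H Hr.
  apply (hasSum_fubini (fun p => F (snd p, fst p - snd p)%Z)); auto.
  apply hasSum_inj with (u := fun p => (fst p + snd p, fst p)%Z).
  - intros [m n] [m' n'] E. simpl in E. inversion E. f_equal. lia.
  - intros [N m] Hn. exfalso. apply (Hn (m, N - m)%Z). simpl. f_equal. lia.
  - eapply hasSum_ext; [|apply H]. intros [m n]. simpl. f_equal. f_equal. lia.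
Qed.

(** * Integer powers and bilateral families *)

Definition zp (x : C) (n : Z) : C :=
  if Z.leb 0 n then (x ^ Z.to_nat n)%C else (/ (x ^ Z.to_nat (- n)))%C.

Lemma zp_nat x n : zp x (Z.of_nat n) = (x ^ n)%C.
Proof. unfold zp. rewrite Nat2Z.id. destruct (Z.leb_spec 0 (Z.of_nat n)); auto. lia. Qed.

Lemma zp_0 x : zp x 0 = RtoC 1.
Proof. reflexivity. Qed.

Lemma zp_succ (x : C) n : x <> RtoC 0 -> zp x (Z.succ n) = (x * zp x n)%C.
Proof.
  intros Hx. unfold zp.
  destruct (Z.leb_spec 0 n), (Z.leb_spec 0 (Z.succ n)); try lia.
  - replace (Z.to_nat (Z.succ n)) with (S (Z.to_nat n)) by lia. apply Cpow_S.
  - replace n with (-1)%Z by lia. simpl. field. auto.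
  - replace (Z.to_nat (- n)) with (S (Z.to_nat (- Z.succ n))) by lia.
    rewrite Cpow_S. field. split; auto. apply Cpow_nz; auto.
Qed.

(** Discharges the side conditions left by [field] when they agree with a hypothesis only up to
    [ring] or up to sign. *)
Ltac cneq :=
  repeat split; auto;
  match goal with
  | H : ?a <> RtoC 0 |- ?b <> RtoC 0 =>
      let E := fresh in intros E; apply H; replace a with b by ring; exact E
  | H : ?a <> RtoC 0 |- ?b <> RtoC 0 =>
      let E := fresh in intros E; apply H; replace a with (-1 * b)%C by ring; rewrite E; ring
  end.

Lemma Cinv_nz (x : C) : x <> RtoC 0 -> (/ x)%C <> RtoC 0.
Proof.
  intros Hx E. assert (H := Cinv_r x Hx). rewrite E, Cmult_0_r in H.
  apply RtoC_inj in H. lra.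
Qed.

Lemma zp_neq (x : C) n : x <> RtoC 0 -> zp x n <> RtoC 0.
Proof.
  intros Hx. unfold zp. destruct (Z.leb 0 n).
  - apply Cpow_nz; auto.
  - apply Cinv_nz, Cpow_nz; auto.
Qed.

Lemma zp_add (x : C) m n : x <> RtoC 0 -> zp x (m + n) = (zp x m * zp x n)%C.
Proof.
  intros Hx. revert n. apply Z.bi_induction.
  - intros a b E; unfold Z.eq in E; subst; apply iff_refl.
  - rewrite Z.add_0_r, zp_0. ring.
  - intros n. rewrite Z.add_succ_r, !zp_succ by auto. split; intros H.
    + rewrite H. ring.
    + replace (zp x (m + n)) with (/ x * (x * zp x (m + n)))%C by (field; auto).
      rewrite H. field. auto.
Qed.

Lemma zp_opp (x : C) n : x <> RtoC 0 -> zp x (- n) = (/ zp x n)%C.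
Proof.
  intros Hx. assert (H := zp_add x n (- n) Hx). rewrite Z.add_opp_diag_r, zp_0 in H.
  assert (Hn := zp_neq x n Hx).
  replace (zp x (- n)) with (/ zp x n * (zp x n * zp x (- n)))%C by (field; auto).
  rewrite <- H. field. auto.
Qed.

Lemma zp_minus (x : C) n : x <> RtoC 0 -> Cmod x < 1 -> n <> 0%Z ->
  (1 - zp x n * zp x n)%C <> RtoC 0.
Proof.
  intros Hx H1 Hn. destruct (Z_cases n) as [|[[k ->]|[k ->]]]; [contradiction| |].
  - rewrite zp_nat. apply one_minus_neq, Cmod_sqr_lt, Cmod_pow_lt; auto.
  - rewrite zp_opp, zp_nat by auto.
    assert (H2 := one_minus_neq _ (Cmod_sqr_lt _ (Cmod_pow_lt x k H1))).
    assert (H3 := Cpow_nz x (S k) Hx). set (y := (x ^ S k)%C) in *.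
    replace (1 - / y * / y)%C with (- (1 - y * y) / (y * y))%C by (field; auto).
    apply Cmult_neq_0; [|apply Cinv_nz, Cmult_neq_0; auto].
    replace (- (1 - y * y))%C with (-1 * (1 - y * y))%C by ring.
    apply Cmult_neq_0; auto. intros E. apply RtoC_inj in E. lra.
Qed.

Lemma zp_plus (x : C) n : x <> RtoC 0 -> Cmod x < 1 -> (1 + zp x n * zp x n)%C <> RtoC 0.
Proof.
  intros Hx H1. destruct (Z_cases n) as [->|[[k ->]|[k ->]]].
  - rewrite zp_0. replace (1 + 1 * 1)%C with (RtoC 2) by ring.
    intros E. apply RtoC_inj in E. lra.
  - rewrite zp_nat. apply one_plus_neq, Cmod_sqr_lt, Cmod_pow_lt; auto.
  - rewrite zp_opp, zp_nat by auto.
    assert (H2 := one_plus_neq _ (Cmod_sqr_lt _ (Cmod_pow_lt x k H1))).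
    assert (H3 := Cpow_nz x (S k) Hx). set (y := (x ^ S k)%C) in *.
    replace (1 + / y * / y)%C with ((1 + y * y) / (y * y))%C by (field; auto).
    apply Cmult_neq_0; [|apply Cinv_nz, Cmult_neq_0]; auto.
Qed.

(* With [q = x^2]: the coefficients of [f(t) = sum t^n / (1 + q^n)] and of [sum t^n / (1 - q^n)] are
   [gz] and [uz] (where [1/2] replaces the undefined value at [n = 0]); [Gz] and [kz] are the terms
   at [t = x].  Subtracting their common limit behaviour [st] leaves odd summable families. *)
Definition gz (x : C) (n : Z) : C := (/ (1 + zp x n * zp x n))%C.
Definition Gz (x : C) (n : Z) : C := (zp x n * gz x n)%C.
Definition kz (x : C) (n : Z) : C :=
  if Z.eqb n 0 then RtoC 0 else (zp x n / (1 - zp x n * zp x n))%C.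
Definition uz (x : C) (n : Z) : C :=
  if Z.eqb n 0 then (/ 2)%C else (/ (1 - zp x n * zp x n))%C.
Definition st (n : Z) : C :=
  if Z.eqb n 0 then (/ 2)%C else if Z.ltb 0 n then RtoC 1 else RtoC 0.

Lemma gz_opp (x : C) n : x <> RtoC 0 -> Cmod x < 1 -> gz x (- n) = (1 - gz x n)%C.
Proof.
  intros Hx H1. unfold gz. rewrite zp_opp by auto.
  assert (H2 := zp_plus x n Hx H1). assert (H3 := zp_neq x n Hx).
  set (y := zp x n) in *. field; cneq.
Qed.

Lemma Gz_opp (x : C) n : x <> RtoC 0 -> Cmod x < 1 -> Gz x (- n) = Gz x n.
Proof.
  intros Hx H1. unfold Gz, gz. rewrite zp_opp by auto.
  assert (H2 := zp_plus x n Hx H1). assert (H3 := zp_neq x n Hx).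
  set (y := zp x n) in *. field; cneq.
Qed.

Lemma eqb_opp n : Z.eqb (- n) 0 = Z.eqb n 0.
Proof. destruct (Z.eqb_spec (- n) 0), (Z.eqb_spec n 0); auto; lia. Qed.

Lemma kz_opp (x : C) n : x <> RtoC 0 -> Cmod x < 1 -> kz x (- n) = (- kz x n)%C.
Proof.
  intros Hx H1. unfold kz. rewrite zp_opp, eqb_opp by auto.
  destruct (Z.eqb_spec n 0) as [E|E]; [ring|].
  assert (H2 := zp_minus x n Hx H1 E). assert (H3 := zp_neq x n Hx).
  set (y := zp x n) in *. field; cneq.
Qed.

Lemma uz_opp (x : C) n : x <> RtoC 0 -> Cmod x < 1 -> uz x (- n) = (1 - uz x n)%C.
Proof.
  intros Hx H1. unfold uz. rewrite zp_opp, eqb_opp by auto.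
  destruct (Z.eqb_spec n 0) as [E|E]; [field|].
  assert (H2 := zp_minus x n Hx H1 E). assert (H3 := zp_neq x n Hx).
  set (y := zp x n) in *. field; cneq.
Qed.

Lemma st_opp n : st (- n) = (1 - st n)%C.
Proof.
  unfold st. rewrite eqb_opp. destruct (Z.eqb_spec n 0); [field|].
  destruct (Z.ltb_spec 0 n), (Z.ltb_spec 0 (- n)); try lia; ring.
Qed.

Lemma Cmod_one_pm (y : C) r : Cmod y <= r -> 1 - r <= Cmod (1 + y) /\ 1 - r <= Cmod (1 - y).
Proof.
  intros H. split.
  - assert (H1 := Cmod_triangle (1 + y) (- y)). rewrite Cmod_opp in H1.
    replace (1 + y + - y)%C with (RtoC 1) in H1 by ring. rewrite Cmod_1 in H1. lra.
  - assert (H1 := Cmod_triangle (1 - y) y).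
    replace (1 - y + y)%C with (RtoC 1) in H1 by ring. rewrite Cmod_1 in H1. lra.
Qed.

Lemma Cmod_sqr_pow (x : C) n : Cmod x < 1 -> Cmod (x ^ S n * x ^ S n) <= Cmod x ^ 2.
Proof.
  intros Hx. assert (H0 := Cmod_ge_0 x).
  rewrite Cmod_mult, Cmod_pow, <- pow_add. apply pow_decr; [lra | lia].
Qed.

Lemma frac_bound (x y d : C) n : Cmod x < 1 -> Cmod y <= Cmod x ^ n ->
  1 - Cmod x ^ 2 <= Cmod d -> Cmod (y / d) <= / (1 - Cmod x ^ 2) * Cmod x ^ n.
Proof.
  intros Hx Hy Hd. assert (H0 := Cmod_ge_0 x).
  assert (Hp : 0 < 1 - Cmod x ^ 2) by nra.
  assert (Hd0 : d <> RtoC 0) by (apply (proj2 (Cmod_gt_0 d)); lra).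
  rewrite Cmod_div by auto. unfold Rdiv. rewrite Rmult_comm.
  apply Rmult_le_compat; auto; try apply Cmod_ge_0.
  - left. apply Rinv_0_lt_compat. lra.
  - apply Rinv_le_contravar; auto.
Qed.

Lemma Gz_bound (x : C) n : x <> RtoC 0 -> Cmod x < 1 ->
  Cmod (Gz x (Z.of_nat n)) <= / (1 - Cmod x ^ 2) * Cmod x ^ n.
Proof.
  intros Hx0 Hx. unfold Gz, gz. rewrite zp_nat. apply frac_bound; auto.
  - rewrite Cmod_pow. lra.
  - destruct n.
    + simpl (x ^ 0)%C. replace (1 + 1 * 1)%C with (RtoC 2) by ring.
      rewrite Cmod_R, Rabs_pos_eq by lra. assert (H0 := pow2_ge_0 (Cmod x)). lra.
    + apply Cmod_one_pm, Cmod_sqr_pow; auto.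
Qed.

Lemma kz_bound (x : C) n : x <> RtoC 0 -> Cmod x < 1 ->
  Cmod (kz x (Z.of_nat n)) <= / (1 - Cmod x ^ 2) * Cmod x ^ n.
Proof.
  intros Hx0 Hx. unfold kz. rewrite zp_nat. destruct n.
  - simpl. rewrite Cmod_0, Rmult_1_r. left. apply Rinv_0_lt_compat.
    assert (H0 := Cmod_ge_0 x). nra.
  - destruct (Z.eqb_spec (Z.of_nat (S n)) 0); [lia|]. apply frac_bound; auto.
    + rewrite Cmod_pow. lra.
    + apply Cmod_one_pm, Cmod_sqr_pow; auto.
Qed.

Lemma gst_bound (x : C) n : x <> RtoC 0 -> Cmod x < 1 ->
  Cmod (gz x (Z.of_nat n) - st (Z.of_nat n)) <= / (1 - Cmod x ^ 2) * Cmod x ^ n.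
Proof.
  intros Hx0 Hx. unfold gz, st. rewrite zp_nat. destruct n.
  - simpl. replace (/ (1 + 1 * 1) - / 2)%C with (RtoC 0) by field.
    rewrite Cmod_0, Rmult_1_r. left. apply Rinv_0_lt_compat.
    assert (H0 := Cmod_ge_0 x). nra.
  - destruct (Z.eqb_spec (Z.of_nat (S n)) 0); [lia|].
    destruct (Z.ltb_spec 0 (Z.of_nat (S n))); [|lia].
    assert (H2 := one_plus_neq _ (Cmod_sqr_lt _ (Cmod_pow_lt x n Hx))).
    replace (/ (1 + x ^ S n * x ^ S n) - 1)%C with
      ((- (x ^ S n * x ^ S n)) / (1 + x ^ S n * x ^ S n))%C by (field; auto).
    apply frac_bound; auto.
    + rewrite Cmod_opp, Cmod_mult, !Cmod_pow.
      assert (H3 := pow_le_1 (Cmod x) (S n) (conj (Cmod_ge_0 x) (Rlt_le _ _ Hx))). nra.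
    + apply Cmod_one_pm, Cmod_sqr_pow; auto.
Qed.

Lemma ust_bound (x : C) n : x <> RtoC 0 -> Cmod x < 1 ->
  Cmod (uz x (Z.of_nat n) - st (Z.of_nat n)) <= / (1 - Cmod x ^ 2) * Cmod x ^ n.
Proof.
  intros Hx0 Hx. unfold uz, st. rewrite zp_nat. destruct n.
  - simpl. replace (/ 2 - / 2)%C with (RtoC 0) by ring.
    rewrite Cmod_0, Rmult_1_r. left. apply Rinv_0_lt_compat.
    assert (H0 := Cmod_ge_0 x). nra.
  - destruct (Z.eqb_spec (Z.of_nat (S n)) 0); [lia|].
    destruct (Z.ltb_spec 0 (Z.of_nat (S n))); [|lia].
    assert (H2 := one_minus_neq _ (Cmod_sqr_lt _ (Cmod_pow_lt x n Hx))).
    replace (/ (1 - x ^ S n * x ^ S n) - 1)%C with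
      ((x ^ S n * x ^ S n) / (1 - x ^ S n * x ^ S n))%C by (field; auto).
    apply frac_bound; auto.
    + rewrite Cmod_mult, !Cmod_pow.
      assert (H3 := pow_le_1 (Cmod x) (S n) (conj (Cmod_ge_0 x) (Rlt_le _ _ Hx))). nra.
    + apply Cmod_one_pm, Cmod_sqr_pow; auto.
Qed.

Lemma absSum_weight (x : C) (F : Z -> C) j : Cmod x < 1 -> (j <= 2)%nat ->
  (forall n, Cmod (F (- n)%Z) = Cmod (F n)) ->
  (forall n, Cmod (F (Z.of_nat n)) <= / (1 - Cmod x ^ 2) * Cmod x ^ n) ->
  absSum (fun n => (CZ n ^ j * F n)%C).
Proof.
  intros Hx Hj Hs HF. assert (H0 := Cmod_ge_0 x).
  assert (HK : 0 <= / (1 - Cmod x ^ 2)) by (left; apply Rinv_0_lt_compat; nra).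
  apply (absSum_Z _ (/ (1 - Cmod x ^ 2)) (Cmod x)); auto.
  - intros n. rewrite !Cmod_mult, !Cmod_pow, Hs, CZ_opp, Cmod_opp. auto.
  - intros n. rewrite Cmod_mult, Cmod_pow, CZ_nat, Cmod_CN.
    assert (H1 : 0 <= INR n ^ j <= INR n ^ 2 + 1).
    { assert (H := pos_INR n). split; [apply pow_le; auto|].
      destruct j as [|[|[|j]]]; [simpl; nra | simpl; nra | simpl; nra | lia]. }
    replace (/ (1 - Cmod x ^ 2) * ((INR n ^ 2 + 1) * Cmod x ^ n)) with
      ((INR n ^ 2 + 1) * (/ (1 - Cmod x ^ 2) * Cmod x ^ n)) by ring.
    apply Rmult_le_compat; auto; [apply H1 | apply Cmod_ge_0 | apply H1].
Qed.

Lemma gst_sym (x : C) n : x <> RtoC 0 -> Cmod x < 1 ->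
  (gz x (- n) - st (- n))%C = (- (gz x n - st n))%C.
Proof. intros. rewrite gz_opp, st_opp by auto. ring. Qed.

Lemma ust_sym (x : C) n : x <> RtoC 0 -> Cmod x < 1 ->
  (uz x (- n) - st (- n))%C = (- (uz x n - st n))%C.
Proof. intros. rewrite uz_opp, st_opp by auto. ring. Qed.

Lemma absSum_nG (x : C) j : x <> RtoC 0 -> Cmod x < 1 -> (j <= 2)%nat ->
  absSum (fun n => (CZ n ^ j * Gz x n)%C).
Proof.
  intros Hx0 Hx Hj. apply (absSum_weight x); auto.
  - intros n. rewrite Gz_opp; auto.
  - intros n. apply Gz_bound; auto.
Qed.

Lemma absSum_nk (x : C) j : x <> RtoC 0 -> Cmod x < 1 -> (j <= 2)%nat ->
  absSum (fun n => (CZ n ^ j * kz x n)%C).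
Proof.
  intros Hx0 Hx Hj. apply (absSum_weight x); auto.
  - intros n. rewrite kz_opp, Cmod_opp; auto.
  - intros n. apply kz_bound; auto.
Qed.

Lemma absSum_ngst (x : C) j : x <> RtoC 0 -> Cmod x < 1 -> (j <= 2)%nat ->
  absSum (fun n => (CZ n ^ j * (gz x n - st n))%C).
Proof.
  intros Hx0 Hx Hj. apply (absSum_weight x (fun n => (gz x n - st n)%C)); auto.
  - intros n. rewrite gst_sym, Cmod_opp; auto.
  - intros n. apply gst_bound; auto.
Qed.

Lemma absSum_nust (x : C) j : x <> RtoC 0 -> Cmod x < 1 -> (j <= 2)%nat ->
  absSum (fun n => (CZ n ^ j * (uz x n - st n))%C).
Proof.
  intros Hx0 Hx Hj. apply (absSum_weight x (fun n => (uz x n - st n)%C)); auto.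
  - intros n. rewrite ust_sym, Cmod_opp; auto.
  - intros n. apply ust_bound; auto.
Qed.

(** * Zeroth and first moments of the bilateral families *)

Lemma hasSum_gst (x : C) : x <> RtoC 0 -> Cmod x < 1 -> hasSum (fun n => (gz x n - st n)%C) 0.
Proof.
  intros Hx0 Hx. apply hasSum_Z_odd.
  - intros n. apply gst_sym; auto.
  - assert (H := absSum_ngst x 0 Hx0 Hx ltac:(lia)).
    unfold absSum in *. eapply bddSum_le; [|apply H]. intros n. cbv beta. simpl Cpow.
    rewrite Cmult_1_l. lra.
Qed.

Lemma hasSum_ust (x : C) : x <> RtoC 0 -> Cmod x < 1 -> hasSum (fun n => (uz x n - st n)%C) 0.
Proof.
  intros Hx0 Hx. apply hasSum_Z_odd.
  - intros n. apply ust_sym; auto.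
  - assert (H := absSum_nust x 0 Hx0 Hx ltac:(lia)).
    unfold absSum in *. eapply bddSum_le; [|apply H]. intros n. cbv beta. simpl Cpow.
    rewrite Cmult_1_l. lra.
Qed.

Lemma hasSum_ngst (x : C) : x <> RtoC 0 -> Cmod x < 1 ->
  hasSum (fun n => (CZ n * (gz x n - st n))%C)
    (-2 * (Sf (x * x) - 2 * Sf (x * x * (x * x))))%C.
Proof.
  intros Hx0 Hx.
  replace (-2 * (Sf (x * x) - 2 * Sf (x * x * (x * x))))%C with
    (CZ 0 * (gz x 0 - st 0) + 2 * (-1 * (Sf (x * x) - 2 * Sf (x * x * (x * x)))))%C.
  2:{ unfold CZ. ring. }
  apply (hasSum_Z_even (fun n => (CZ n * (gz x n - st n))%C)).
  - intros n. rewrite gst_sym, CZ_opp by auto. ring.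
  - eapply hasSum_ext; [|apply hasSum_scal, hasSum_A, Cmod_sqr_lt; auto].
    intros n. cbv beta. rewrite CZ_nat, Cpow_mult_l. unfold gz, st. rewrite zp_nat.
    destruct (Z.eqb_spec (Z.of_nat (S n)) 0); [lia|].
    destruct (Z.ltb_spec 0 (Z.of_nat (S n))); [|lia].
    assert (H2 := one_plus_neq _ (Cmod_sqr_lt _ (Cmod_pow_lt x n Hx))).
    field. auto.
Qed.

Lemma hasSum_nust (x : C) : x <> RtoC 0 -> Cmod x < 1 ->
  hasSum (fun n => (CZ n * (uz x n - st n))%C) (2 * Sf (x * x))%C.
Proof.
  intros Hx0 Hx.
  replace (2 * Sf (x * x))%C with (CZ 0 * (uz x 0 - st 0) + 2 * Sf (x * x))%C.
  2:{ unfold CZ. ring. }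
  apply (hasSum_Z_even (fun n => (CZ n * (uz x n - st n))%C)).
  - intros n. rewrite ust_sym, CZ_opp by auto. ring.
  - eapply hasSum_ext; [|apply hasSum_Sf, Cmod_sqr_lt; auto].
    intros n. cbv beta. rewrite CZ_nat, Cpow_mult_l. unfold uz, st. rewrite zp_nat.
    destruct (Z.eqb_spec (Z.of_nat (S n)) 0); [lia|].
    destruct (Z.ltb_spec 0 (Z.of_nat (S n))); [|lia].
    assert (H2 := one_minus_neq _ (Cmod_sqr_lt _ (Cmod_pow_lt x n Hx))).
    field. auto.
Qed.

(** The half value of [st] at 0 spreads the unit jump equally over [K] and [K + 1], so its first
    moment is [K + 1/2]. *)
Lemma hasSum_st_step K :
  hasSum (fun m => (st (m - K) - st (m - K - 1))%C) 1 /\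
  hasSum (fun m => (CZ m * (st (m - K) - st (m - K - 1)))%C) (CZ K + / 2)%C.
Proof.
  assert (Hnd : NoDup [K; (K + 1)%Z]).
  { constructor; [intros [H|[]]; lia|]. constructor; [intros []|constructor]. }
  assert (H0 : forall m, ~ In m [K; (K + 1)%Z] -> (st (m - K) - st (m - K - 1))%C = RtoC 0).
  { intros m Hm. assert (m <> K /\ m <> K + 1)%Z as [H1 H2].
    { split; intros ->; apply Hm; simpl; auto. }
    unfold st. destruct (Z.eqb_spec (m - K) 0); [lia|]. destruct (Z.eqb_spec (m - K - 1) 0); [lia|].
    destruct (Z.ltb_spec 0 (m - K)), (Z.ltb_spec 0 (m - K - 1)); try lia; ring. }
  assert (E1 : (st (K - K) - st (K - K - 1))%C = (/ 2)%C).
  { replace (K - K)%Z with 0%Z by lia. unfold st. simpl. ring. }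
  assert (E2 : (st (K + 1 - K) - st (K + 1 - K - 1))%C = (/ 2)%C).
  { replace (K + 1 - K)%Z with 1%Z by lia. unfold st. simpl. field. }
  split.
  - replace (RtoC 1) with (lsum (fun m => (st (m - K) - st (m - K - 1))%C) [K; (K + 1)%Z]).
    + apply hasSum_finite; auto.
    + simpl lsum. rewrite E1, E2. field.
  - replace (CZ K + / 2)%C with
      (lsum (fun m => (CZ m * (st (m - K) - st (m - K - 1)))%C) [K; (K + 1)%Z]).
    + apply hasSum_finite; auto. intros m Hm. rewrite H0 by auto. ring.
    + simpl lsum. rewrite E1, E2, CZ_add. change (CZ 1) with (RtoC 1). field.
Qed.

(** Unit steps are added or removed one at a time, by induction on [K] in both directions; the first
    moments [j + 1/2] accumulate to [K^2 / 2]. *)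
Lemma hasSum_st K :
  hasSum (fun m => (st m - st (m - K))%C) (CZ K) /\
  hasSum (fun m => (CZ m * (st m - st (m - K)))%C) (CZ K * CZ K / 2)%C.
Proof.
  revert K. apply Z.bi_induction.
  - intros a b E; unfold Z.eq in E; subst; apply iff_refl.
  - assert (E : forall m, (st m - st (m - 0))%C = RtoC 0) by (intros m; rewrite Z.sub_0_r; ring).
    split.
    + eapply hasSum_ext; [|apply hasSum_0]. intros m. rewrite E. auto.
    + replace (CZ 0 * CZ 0 / 2)%C with (RtoC 0) by (unfold CZ; field).
      eapply hasSum_ext; [|apply hasSum_0]. intros m. rewrite E. ring.
  - intros K. destruct (hasSum_st_step K) as [A1 A2].
    assert (EK : CZ (Z.succ K) = (CZ K + 1)%C) by (unfold Z.succ; rewrite CZ_add; auto).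
    assert (Em : forall m, (m - Z.succ K)%Z = (m - K - 1)%Z) by (intros; lia).
    split; intros [H1 H2]; split.
    + rewrite EK. eapply hasSum_ext; [|apply hasSum_plus; [apply H1 | apply A1]].
      intros m. cbv beta. rewrite Em. ring.
    + replace (CZ (Z.succ K) * CZ (Z.succ K) / 2)%C with (CZ K * CZ K / 2 + (CZ K + / 2))%C
        by (rewrite EK; field).
      eapply hasSum_ext; [|apply hasSum_plus; [apply H2 | apply A2]].
      intros m. cbv beta. rewrite Em. ring.
    + replace (CZ K) with (CZ (Z.succ K) + -1 * 1)%C by (rewrite EK; ring).
      eapply hasSum_ext; [|apply hasSum_plus; [apply H1 | apply hasSum_scal, A1]].
      intros m. cbv beta. rewrite Em. ring.
    + replace (CZ K * CZ K / 2)%C with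
        (CZ (Z.succ K) * CZ (Z.succ K) / 2 + -1 * (CZ K + / 2))%C by (rewrite EK; field).
      eapply hasSum_ext; [|apply hasSum_plus; [apply H2 | apply hasSum_scal, A2]].
      intros m. cbv beta. rewrite Em. ring.
Qed.

(** The two copies of [gz] are not summable separately. Each is replaced by [st] plus an odd family
    of sum 0, so only the telescoping of the step function contributes. *)
Lemma hasSum_gg (x : C) K : x <> RtoC 0 -> Cmod x < 1 ->
  hasSum (fun m => (gz x m - gz x (m - K))%C) (CZ K).
Proof.
  intros Hx0 Hx.
  replace (CZ K) with (CZ K + (0 + -1 * 0))%C by ring.
  eapply hasSum_ext; [|apply hasSum_plus; [apply (proj1 (hasSum_st K))
    | apply hasSum_plus; [apply hasSum_gst; [apply Hx0 | auto]
      | apply hasSum_scal, (hasSum_Z_shift (fun n => (gz x n - st n)%C) 0 K), hasSum_gst; auto]]].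
  intros m. cbv beta. ring.
Qed.

Lemma hasSum_ug (x : C) K : x <> RtoC 0 -> Cmod x < 1 ->
  hasSum (fun m => (uz x m - gz x (m - K))%C) (CZ K).
Proof.
  intros Hx0 Hx.
  replace (CZ K) with (CZ K + (0 + -1 * 0))%C by ring.
  eapply hasSum_ext; [|apply hasSum_plus; [apply (proj1 (hasSum_st K))
    | apply hasSum_plus; [apply (hasSum_ust x Hx0 Hx)
      | apply hasSum_scal, (hasSum_Z_shift (fun n => (gz x n - st n)%C) 0 K), hasSum_gst; auto]]].
  intros m. cbv beta. ring.
Qed.

(** Besides [K^2 / 2] from the step function, the moments of [uz - st] and [gz - st] contribute
    [2 Sf(x^2)] and [2 (Sf(x^2) - 2 Sf(x^4))]. The shift by [K] adds only a multiple of a zero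
    sum. *)
Lemma hasSum_nug (x : C) K : x <> RtoC 0 -> Cmod x < 1 ->
  hasSum (fun m => (CZ m * (uz x m - gz x (m - K)))%C)
    (4 * (Sf (x * x) - Sf (x * x * (x * x))) + CZ K * CZ K / 2)%C.
Proof.
  intros Hx0 Hx.
  assert (H := hasSum_plus _ _ _ _ (hasSum_ngst x Hx0 Hx) (hasSum_scal (CZ K) _ _ (hasSum_gst x Hx0 Hx))).
  apply (hasSum_Z_shift _ _ K) in H. apply (hasSum_scal (-1)) in H.
  replace (4 * (Sf (x * x) - Sf (x * x * (x * x))) + CZ K * CZ K / 2)%C with
    (CZ K * CZ K / 2 + (2 * Sf (x * x) +
      -1 * (-2 * (Sf (x * x) - 2 * Sf (x * x * (x * x))) + CZ K * 0)))%C by field.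
  eapply hasSum_ext; [|apply hasSum_plus; [apply (proj2 (hasSum_st K))
    | apply hasSum_plus; [apply (hasSum_nust x Hx0 Hx) | apply H]]].
  intros m. cbv beta. rewrite CZ_sub. ring.
Qed.

Lemma absSum_ext {I : Type} (F G : I -> C) : (forall i, F i = G i) -> absSum F -> absSum G.
Proof.
  intros H. unfold absSum. apply bddSum_le. intros i. rewrite H. lra.
Qed.

Lemma absSum_G (x : C) : x <> RtoC 0 -> Cmod x < 1 -> absSum (Gz x).
Proof.
  intros Hx0 Hx. eapply absSum_ext; [|apply (absSum_nG x 0 Hx0 Hx); lia].
  intros n. simpl. ring.
Qed.

Lemma absSum_k (x : C) : x <> RtoC 0 -> Cmod x < 1 -> absSum (kz x).
Proof.
  intros Hx0 Hx. eapply absSum_ext; [|apply (absSum_nk x 0 Hx0 Hx); lia].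
  intros n. simpl. ring.
Qed.

Lemma absSum_nG1 (x : C) : x <> RtoC 0 -> Cmod x < 1 -> absSum (fun n => (CZ n * Gz x n)%C).
Proof.
  intros Hx0 Hx. eapply absSum_ext; [|apply (absSum_nG x 1 Hx0 Hx); lia].
  intros n. simpl. ring.
Qed.

Lemma absSum_nk1 (x : C) : x <> RtoC 0 -> Cmod x < 1 -> absSum (fun n => (CZ n * kz x n)%C).
Proof.
  intros Hx0 Hx. eapply absSum_ext; [|apply (absSum_nk x 1 Hx0 Hx); lia].
  intros n. simpl. ring.
Qed.

Lemma hasSum_G (x : C) : x <> RtoC 0 -> Cmod x < 1 -> hasSum (Gz x) (af x).
Proof.
  intros Hx0 Hx. replace (af x) with (Gz x 0 + 2 * L4 x)%C.
  - apply hasSum_Z_even.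
    + intros n. apply Gz_opp; auto.
    + eapply hasSum_ext; [|apply hasSum_L4; auto].
      intros n. cbv beta. unfold Gz, gz. rewrite zp_nat. auto.
  - unfold Gz, gz, af. rewrite zp_0. field.
Qed.

Lemma hasSum_nG_0 (x : C) : x <> RtoC 0 -> Cmod x < 1 -> hasSum (fun n => (CZ n * Gz x n)%C) 0.
Proof.
  intros Hx0 Hx. apply hasSum_Z_odd; [|apply absSum_nG1; auto].
  intros n. rewrite CZ_opp, Gz_opp by auto. ring.
Qed.

Lemma hasSum_nk (x : C) : x <> RtoC 0 -> Cmod x < 1 ->
  hasSum (fun n => (CZ n * kz x n)%C) (2 * (Sf x - Sf (x * x)))%C.
Proof.
  intros Hx0 Hx.
  replace (2 * (Sf x - Sf (x * x)))%C with (CZ 0 * kz x 0 + 2 * (Sf x - Sf (x * x)))%C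
    by (unfold CZ; ring).
  apply (hasSum_Z_even (fun n => (CZ n * kz x n)%C)).
  - intros n. rewrite CZ_opp, kz_opp by auto. ring.
  - eapply hasSum_ext; [|apply hasSum_h; auto].
    intros n. cbv beta. rewrite CZ_nat. unfold kz. rewrite zp_nat.
    destruct (Z.eqb_spec (Z.of_nat (S n)) 0); [lia|]. auto.
Qed.

Lemma hasSum_n3k (x : C) : x <> RtoC 0 -> Cmod x < 1 ->
  hasSum (fun n => (CZ n ^ 3 * kz x n)%C) (2 * (Tf x - Tf (x * x)))%C.
Proof.
  intros Hx0 Hx.
  replace (2 * (Tf x - Tf (x * x)))%C with (CZ 0 ^ 3 * kz x 0 + 2 * (Tf x - Tf (x * x)))%C
    by (unfold CZ; ring).
  apply (hasSum_Z_even (fun n => (CZ n ^ 3 * kz x n)%C)).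
  - intros n. rewrite CZ_opp, kz_opp by auto. ring.
  - eapply hasSum_ext; [|apply hasSum_h3; auto].
    intros n. cbv beta. rewrite CZ_nat. unfold kz. rewrite zp_nat.
    destruct (Z.eqb_spec (Z.of_nat (S n)) 0); [lia|]. auto.
Qed.

(** Write [gz = 1/2 + (2 gz - 1) / 2]. Against the odd weight [n Gz] the constant sums to 0, while
    [2 gz - 1 = (1 - y^2) / (1 + y^2)] is odd and reproduces the terms of [hasSum_thL4]. *)
Lemma hasSum_nGg (x : C) : x <> RtoC 0 -> Cmod x < 1 ->
  hasSum (fun n => (CZ n * Gz x n * gz x n)%C) (Lam (nm one1) (nm chi4) x).
Proof.
  intros Hx0 Hx.
  assert (H : hasSum (fun n => (CZ n * Gz x n * (2 * gz x n - 1))%C)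
    (CZ 0 * Gz x 0 * (2 * gz x 0 - 1) + 2 * Lam (nm one1) (nm chi4) x)%C).
  { apply (hasSum_Z_even (fun n => (CZ n * Gz x n * (2 * gz x n - 1))%C)).
    - intros n. rewrite CZ_opp, Gz_opp, gz_opp by auto. ring.
    - eapply hasSum_ext; [|apply hasSum_thL4; auto].
      intros n. cbv beta. rewrite CZ_nat. unfold Gz, gz. rewrite zp_nat.
      assert (H2 := one_plus_neq _ (Cmod_sqr_lt _ (Cmod_pow_lt x n Hx))).
      field. auto. }
  replace (Lam (nm one1) (nm chi4) x) with
    (/ 2 * ((CZ 0 * Gz x 0 * (2 * gz x 0 - 1) + 2 * Lam (nm one1) (nm chi4) x) + 0))%C
    by (unfold CZ; field).
  eapply hasSum_ext; [|apply hasSum_scal, hasSum_plus; [apply H | apply (hasSum_nG_0 x Hx0 Hx)]].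
  intros n. cbv beta. field.
Qed.

(* The rows of the double sums: partial fractions in [zp x m] and [zp x (N - m)]. *)
Lemma row_GG (x : C) N m : x <> RtoC 0 -> Cmod x < 1 -> N <> 0%Z ->
  (Gz x m * Gz x (N - m))%C = (kz x N * (gz x m - gz x (m - N)))%C.
Proof.
  intros Hx0 Hx HN. unfold kz. destruct (Z.eqb_spec N 0); [contradiction|].
  assert (H1 := zp_minus x N Hx0 Hx HN).
  assert (H2 := zp_plus x m Hx0 Hx). assert (H3 := zp_plus x (N - m) Hx0 Hx).
  replace (gz x (m - N)) with (1 - gz x (N - m))%C
    by (rewrite <- gz_opp by auto; f_equal; lia).
  unfold Gz, gz.
  assert (E : zp x N = (zp x m * zp x (N - m))%C) by (rewrite <- zp_add by auto; f_equal; lia).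
  rewrite E in *.
  set (a := zp x m) in *. set (b := zp x (N - m)) in *.
  field. auto.
Qed.

Lemma row_kG (x : C) N m : x <> RtoC 0 -> Cmod x < 1 -> m <> 0%Z ->
  (kz x m * Gz x (N - m))%C = (Gz x N * (uz x m - gz x (m - N)))%C.
Proof.
  intros Hx0 Hx Hm. unfold kz, uz. destruct (Z.eqb_spec m 0); [contradiction|].
  assert (H1 := zp_minus x m Hx0 Hx Hm).
  assert (H2 := zp_plus x N Hx0 Hx). assert (H3 := zp_plus x (N - m) Hx0 Hx).
  replace (gz x (m - N)) with (1 - gz x (N - m))%C
    by (rewrite <- gz_opp by auto; f_equal; lia).
  unfold Gz, gz.
  assert (E : zp x N = (zp x m * zp x (N - m))%C) by (rewrite <- zp_add by auto; f_equal; lia).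
  rewrite E in *.
  set (a := zp x m) in *. set (b := zp x (N - m)) in *.
  field. auto.
Qed.

(** * The quadratic identities *)

(** The zero diagonal of the square of the [Gz] series; it is a quarter of [cE2q] at [x^2], and this
    is how the quasimodular series enters. *)
Definition c0f (x : C) : C := (1 / 4 + 2 * (Sf (x * x) - 4 * Sf (x * x * (x * x))))%C.
(** The second moment of [Gz], an auxiliary unknown that occurs in several product evaluations and
    is eliminated in the end. *)
Definition etaf (x : C) : C := csum (fun n => (CZ n ^ 2 * Gz x n)%C).

Lemma hasSum_eta (x : C) : x <> RtoC 0 -> Cmod x < 1 ->
  hasSum (fun n => (CZ n ^ 2 * Gz x n)%C) (etaf x).
Proof. intros. apply csum_correct, absSum_nG; auto. Qed.

Lemma kz_0 x : kz x 0 = RtoC 0.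
Proof. reflexivity. Qed.

(** Off the zero diagonal the partial fractions telescope. At [N = 0] they degenerate, because
    [1 - x^(2N)] vanishes, and the diagonal is summed by [hasSum_c0] instead. *)
Lemma row_GG_sum (x : C) N : x <> RtoC 0 -> Cmod x < 1 ->
  hasSum (fun m => (Gz x m * Gz x (N - m))%C)
    ((if Z.eqb N 0 then c0f x else 0) + CZ N * kz x N)%C.
Proof.
  intros Hx0 Hx. destruct (Z.eqb_spec N 0) as [->|HN].
  - rewrite kz_0. replace (c0f x + CZ 0 * 0)%C with
      (Gz x 0 * Gz x (0 - 0) + 2 * (Sf (x * x) - 4 * Sf (x * x * (x * x))))%C.
    2:{ unfold c0f, Gz, gz. simpl. rewrite zp_0. field. }
    apply (hasSum_Z_even (fun m => (Gz x m * Gz x (0 - m))%C)).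
    + intros n. replace (0 - - n)%Z with n by lia. replace (0 - n)%Z with (- n)%Z by lia. ring.
    + eapply hasSum_ext; [|apply (hasSum_c0 (x * x)), Cmod_sqr_lt; auto].
      intros n. cbv beta. replace (0 - Z.of_nat (S n))%Z with (- Z.of_nat (S n))%Z by lia.
      rewrite Gz_opp by auto. unfold Gz, gz. rewrite zp_nat, Cpow_mult_l.
      assert (H2 := one_plus_neq _ (Cmod_sqr_lt _ (Cmod_pow_lt x n Hx))). field. auto.
  - replace (0 + CZ N * kz x N)%C with (kz x N * CZ N)%C by ring.
    eapply hasSum_ext; [|apply hasSum_scal, (hasSum_gg x N Hx0 Hx)].
    intros m. cbv beta. rewrite row_GG; auto.
Qed.

Lemma af_sqr_aux (x : C) : x <> RtoC 0 -> Cmod x < 1 ->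
  (af x * af x)%C = (c0f x + 2 * (Sf x - Sf (x * x)))%C.
Proof.
  intros Hx0 Hx.
  assert (H := hasSum_prod _ _ _ _ (absSum_G x Hx0 Hx) (absSum_G x Hx0 Hx)
    (hasSum_G x Hx0 Hx) (hasSum_G x Hx0 Hx)).
  assert (H1 := hasSum_diag _ _ _ H (fun N => row_GG_sum x N Hx0 Hx)).
  eapply hasSum_unique; [apply H1|]. apply hasSum_plus; [|apply hasSum_nk; auto].
  apply (hasSum_single 0%Z (fun N => if Z.eqb N 0 then c0f x else RtoC 0)).
  intros N HN. destruct (Z.eqb_spec N 0); auto. contradiction.
Qed.

(** The square of the series is weighted by [N^2 = m^2 + (N - m)^2 + 2 m (N - m)] on each diagonal.
    The cross term factors into first moments of [Gz], which vanish by parity; the rest gives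
    [etaf * af] twice. *)
Lemma Tf_eta (x : C) : x <> RtoC 0 -> Cmod x < 1 ->
  (Tf x - Tf (x * x))%C = (etaf x * af x)%C.
Proof.
  intros Hx0 Hx.
  assert (A0 := absSum_G x Hx0 Hx). assert (A1 := absSum_nG1 x Hx0 Hx).
  assert (A2 := absSum_nG x 2 Hx0 Hx (le_n _)).
  assert (S0 := hasSum_G x Hx0 Hx). assert (S1 := hasSum_nG_0 x Hx0 Hx).
  assert (S2 := hasSum_eta x Hx0 Hx).
  assert (H := hasSum_plus _ _ _ _ (hasSum_plus _ _ _ _
    (hasSum_prod _ _ _ _ A2 A0 S2 S0) (hasSum_prod _ _ _ _ A0 A2 S0 S2))
    (hasSum_scal 2 _ _ (hasSum_prod _ _ _ _ A1 A1 S1 S1))).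
  assert (E : (etaf x * af x + af x * etaf x + 2 * (0 * 0))%C = (2 * (Tf x - Tf (x * x)))%C).
  { eapply hasSum_unique; [|apply (hasSum_n3k x Hx0 Hx)].
    apply (hasSum_diag _ _ _ H). intros N. cbn [fst snd].
    apply hasSum_ext with (fun m => (CZ N ^ 2 * (Gz x m * Gz x (N - m)))%C).
    - intros m. rewrite CZ_sub. ring.
    - replace (CZ N ^ 3 * kz x N)%C with (CZ N ^ 2 *
        ((if Z.eqb N 0 then c0f x else 0) + CZ N * kz x N))%C.
      + apply hasSum_scal, row_GG_sum; auto.
      + destruct (Z.eqb_spec N 0) as [->|]; [rewrite kz_0|]; unfold CZ; ring. }
  replace (Tf x - Tf (x * x))%C with (/ 2 * (2 * (Tf x - Tf (x * x))))%C by field.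
  rewrite <- E. field.
Qed.

(** On the diagonal [N] the factor [Gz x N] splits off and leaves the first moment [hasSum_nug],
    whose part [N^2 / 2] produces [etaf]. The exceptional term [m = 0] has weight 0. *)
Lemma nk_af_1 (x : C) : x <> RtoC 0 -> Cmod x < 1 ->
  (2 * (Sf x - Sf (x * x)) * af x)%C =
  (4 * (Sf (x * x) - Sf (x * x * (x * x))) * af x + / 2 * etaf x)%C.
Proof.
  intros Hx0 Hx.
  assert (H := hasSum_prod _ _ _ _ (absSum_nk1 x Hx0 Hx) (absSum_G x Hx0 Hx)
    (hasSum_nk x Hx0 Hx) (hasSum_G x Hx0 Hx)).
  eapply hasSum_unique; [|apply hasSum_plus; [apply (hasSum_scal _ _ _ (hasSum_G x Hx0 Hx))
    | apply (hasSum_scal (/ 2) _ _ (hasSum_eta x Hx0 Hx))]].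
  apply (hasSum_diag _ _ _ H). intros N. cbn [fst snd].
  replace (4 * (Sf (x * x) - Sf (x * x * (x * x))) * Gz x N + / 2 * (CZ N ^ 2 * Gz x N))%C
    with (Gz x N * (4 * (Sf (x * x) - Sf (x * x * (x * x))) + CZ N * CZ N / 2))%C by field.
  eapply hasSum_ext; [|apply hasSum_scal, (hasSum_nug x N Hx0 Hx)].
  intros m. cbv beta. destruct (Z.eqb_spec m 0) as [->|Hm]; [unfold CZ; ring|].
  rewrite <- Cmult_assoc, row_kG; auto. ring.
Qed.

(** A second evaluation of the same product. Adding the sum of [kz] times the vanishing first moment
    of [Gz] changes nothing, but turns the weight [m] into [m + (N - m) = N], so that zeroth moments
    suffice. *)
Lemma nk_af_2 (x : C) : x <> RtoC 0 -> Cmod x < 1 ->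
  (2 * (Sf x - Sf (x * x)) * af x)%C = (etaf x - Lam (nm one1) (nm chi4) x)%C.
Proof.
  intros Hx0 Hx.
  destruct (absSum_hasSum _ (absSum_k x Hx0 Hx)) as [lk Hk].
  assert (H := hasSum_plus _ _ _ _
    (hasSum_prod _ _ _ _ (absSum_nk1 x Hx0 Hx) (absSum_G x Hx0 Hx)
      (hasSum_nk x Hx0 Hx) (hasSum_G x Hx0 Hx))
    (hasSum_prod _ _ _ _ (absSum_k x Hx0 Hx) (absSum_nG1 x Hx0 Hx)
      Hk (hasSum_nG_0 x Hx0 Hx))).
  replace (2 * (Sf x - Sf (x * x)) * af x)%C with
    (2 * (Sf x - Sf (x * x)) * af x + lk * 0)%C by ring.
  replace (etaf x - Lam (nm one1) (nm chi4) x)%C with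
    (etaf x + (/ 2 * 0 + -1 * Lam (nm one1) (nm chi4) x))%C by ring.
  eapply hasSum_unique; [|apply hasSum_plus; [apply (hasSum_eta x Hx0 Hx)
    | apply hasSum_plus; [apply (hasSum_scal _ _ _ (hasSum_nG_0 x Hx0 Hx))
       | apply hasSum_scal, (hasSum_nGg x Hx0 Hx)]]].
  apply (hasSum_diag _ _ _ H). intros N. cbn [fst snd].
  (* At [m = 0] the product is 0, whereas the telescoping term is [1/2 - (1 - gz x N)]; the
     conditional summand removes it. *)
  apply hasSum_ext with (fun m => (CZ N * Gz x N *
    ((uz x m - gz x (m - N)) + (if Z.eqb m 0 then - (/ 2 - (1 - gz x N)) else 0)))%C).
  - intros m. replace (CZ m * kz x m * Gz x (N - m) + kz x m * (CZ (N - m) * Gz x (N - m)))%C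
      with (CZ N * (kz x m * Gz x (N - m)))%C by (rewrite CZ_sub; ring).
    destruct (Z.eqb_spec m 0) as [->|Hm].
    + rewrite kz_0. replace (0 - N)%Z with (- N)%Z by lia. rewrite gz_opp by auto.
      change (uz x 0) with (/ 2)%C. ring.
    + rewrite row_kG by auto. ring.
  - replace (CZ N ^ 2 * Gz x N + (/ 2 * (CZ N * Gz x N) + -1 * (CZ N * Gz x N * gz x N)))%C with
      (CZ N * Gz x N * (CZ N + - (/ 2 - (1 - gz x N))))%C by field.
    apply hasSum_scal, hasSum_plus; [apply hasSum_ug; auto|].
    apply (hasSum_single 0%Z (fun m => if Z.eqb m 0 then (- (/ 2 - (1 - gz x N)))%C else RtoC 0)).
    intros m Hm. destruct (Z.eqb_spec m 0); auto. contradiction.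
Qed.

Lemma Lam_0 w c : tame w -> tame c -> Lam w c 0 = RtoC 0.
Proof. intros. unfold Lam. rewrite PS_0 by auto with tame. apply lamc_0. Qed.

Lemma Sf_0 : Sf 0 = RtoC 0.
Proof. apply Lam_0; auto with tame. Qed.

Lemma Tf_0 : Tf 0 = RtoC 0.
Proof. apply Lam_0; auto with tame. Qed.

Lemma af_0 : af 0 = (/ 2)%C.
Proof. unfold af, L4. rewrite Lam_0 by auto with tame. field. Qed.

Lemma C_zero_dec (x : C) : x = RtoC 0 \/ x <> RtoC 0.
Proof. apply classic. Qed.

Definition Ls (x : C) : C := (af x * af x)%C.

(* Jacobi's four-square theorem: [Ls] is [theta^4 / 4]. *)
Lemma Ls_eq (x : C) : Cmod x < 1 ->
  Ls x = (1 / 4 + 2 * Sf x - 8 * Sf (x * x * (x * x)))%C.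
Proof.
  intros Hx. unfold Ls. destruct (C_zero_dec x) as [->|Hx0].
  - replace (0 * 0)%C with (RtoC 0) by ring. replace (0 * 0)%C with (RtoC 0) by ring.
    rewrite af_0, Sf_0. field.
  - rewrite af_sqr_aux by auto. unfold c0f. ring.
Qed.

Lemma Ls_neg_eq (x : C) : Cmod x < 1 ->
  Ls (- x) = (1 / 4 - 2 * Sf x + 12 * Sf (x * x) - 16 * Sf (x * x * (x * x)))%C.
Proof.
  intros Hx. rewrite Ls_eq by (rewrite Cmod_opp; auto). rewrite Sf_neg by auto.
  replace (- x * - x)%C with (x * x)%C by ring. ring.
Qed.

Lemma eta_eq (x : C) : x <> RtoC 0 -> Cmod x < 1 -> etaf x = (af x * (Ls x - Ls (- x)))%C.
Proof.
  intros Hx0 Hx. assert (H := nk_af_1 x Hx0 Hx).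
  rewrite Ls_eq, Ls_neg_eq by auto.
  replace (etaf x) with (2 * ((4 * (Sf (x * x) - Sf (x * x * (x * x))) * af x + / 2 * etaf x) -
    4 * (Sf (x * x) - Sf (x * x * (x * x))) * af x))%C by field.
  rewrite <- H. ring.
Qed.

Lemma Tf_diff (x : C) : Cmod x < 1 ->
  (Tf x - Tf (x * x))%C = (Ls x * (Ls x - Ls (- x)))%C.
Proof.
  intros Hx. destruct (C_zero_dec x) as [->|Hx0].
  - replace (0 * 0)%C with (RtoC 0) by ring. replace (- 0)%C with (RtoC 0) by ring. ring.
  - rewrite Tf_eta, eta_eq by auto. unfold Ls. ring.
Qed.

(** The left side is [x d/dx] of [L4], that is, half of that of [af]. Inserting the value of [etaf]
    into [nk_af_2] makes it a first-order differential equation. The point 0 is separate because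
    negative powers of [x] occur in the argument. *)
Lemma theta_af (x : C) : Cmod x < 1 ->
  Lam (nm one1) (nm chi4) x = (af x * (c0f x - Ls (- x)))%C.
Proof.
  intros Hx. destruct (C_zero_dec x) as [->|Hx0].
  - rewrite Lam_0 by auto with tame. unfold c0f, Ls.
    replace (0 * 0)%C with (RtoC 0) by ring. replace (0 * 0)%C with (RtoC 0) by ring.
    replace (- 0)%C with (RtoC 0) by ring. rewrite af_0, Sf_0. field.
  - assert (H := nk_af_2 x Hx0 Hx).
    replace (Lam (nm one1) (nm chi4) x) with
      (etaf x - (etaf x - Lam (nm one1) (nm chi4) x))%C by ring.
    rewrite <- H, eta_eq by auto. unfold c0f.
    rewrite Ls_eq, Ls_neg_eq by auto. ring.
Qed.

(** Squaring [af_even] expresses the product through values of [Ls], which the four-square formula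
    converts into [Sf]. This is the geometric-mean half of the iteration,
    [theta_3 theta_4 = theta_4(q^2)^2]. *)
Lemma Ls_dup (x : C) : Cmod x < 1 -> (af x * af (- x))%C = Ls (- (x * x)).
Proof.
  intros Hx. assert (Hq := Cmod_sqr_lt x Hx).
  assert (H := af_even x Hx).
  assert (E : (4 * Ls (x * x))%C = (Ls x + Ls (- x) + 2 * (af x * af (- x)))%C).
  { replace (4 * Ls (x * x))%C with ((2 * af (x * x)) * (2 * af (x * x)))%C by (unfold Ls; ring).
    rewrite <- H. unfold Ls. ring. }
  replace (af x * af (- x))%C with (/ 2 * (4 * Ls (x * x) - Ls x - Ls (- x)))%C
    by (rewrite E; field).
  rewrite !Ls_neg_eq, !Ls_eq by auto. field.
Qed.

(** * The functions of the nome [q] *)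

Definition cE2q (x : C) : C := (1 + 8 * (Sf x - 4 * Sf (x * x)))%C.
Definition e2q (x : C) : C := (1 + 24 * (Sf x - 2 * Sf (x * x)))%C.
Definition cE4q (x : C) : C := (1 - 16 * (Tf x - 16 * Tf (x * x)))%C.

Lemma c0f_cE2q (x : C) : c0f x = (cE2q (x * x) / 4)%C.
Proof. unfold c0f, cE2q. field. Qed.

Lemma e2q_Ls (x : C) : Cmod x < 1 -> e2q (x * x) = (2 * (Ls x + Ls (- x)))%C.
Proof. intros Hx. rewrite Ls_eq, Ls_neg_eq by auto. unfold e2q. field. Qed.

Lemma e2q_Ls2 (x : C) : Cmod x < 1 -> e2q x = (8 * Ls x - 4 * Ls (- x))%C.
Proof. intros Hx. rewrite Ls_eq, Ls_neg_eq by auto. unfold e2q. field. Qed.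

Lemma cE2q_dup (x : C) : Cmod x < 1 -> cE2q (x * x) = (cE2q x / 2 + 2 * Ls (- x))%C.
Proof. intros Hx. rewrite Ls_neg_eq by auto. unfold cE2q. field. Qed.

Lemma iter_sqr_bound (x : C) n : Cmod x < 1 -> Cmod (x ^ (2 ^ n)) <= Cmod x ^ n.
Proof.
  intros Hx. rewrite Cmod_pow. apply pow_decr.
  - split; [apply Cmod_ge_0 | lra].
  - assert (H := Nat.pow_gt_lin_r 2 n ltac:(lia)). lia.
Qed.

(* A function [h] with [h(x) = K h(x^2)] and [h(x) = O(x)] vanishes: iterate towards [0]. *)
Lemma sqr_recursion_0 (h : C -> C) (K M d : R) : 0 < d -> 0 <= M -> 0 <= K ->
  (forall x, Cmod x < 1 -> Cmod (h x) <= K * Cmod (h (x * x)%C)) ->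
  (forall x, Cmod x < d -> Cmod (h x) <= M * Cmod x) ->
  forall x, Cmod x < 1 -> h x = RtoC 0.
Proof.
  intros Hd HM HK Hr HO x Hx. apply Cmod_eq_0.
  assert (Hx0 := Cmod_ge_0 x).
  assert (Hit : forall n, Cmod (h x) <= K ^ n * Cmod (h (x ^ (2 ^ n))%C)).
  { induction n as [|n IH].
    - simpl. rewrite Cmult_1_r. lra.
    - eapply Rle_trans; [apply IH|]. simpl (K ^ S n).
      replace (2 ^ S n)%nat with (2 ^ n + 2 ^ n)%nat by (simpl; lia). rewrite Cpow_add_r.
      assert (H1 : Cmod (x ^ (2 ^ n)) < 1).
      { rewrite Cmod_pow. destruct (2 ^ n)%nat as [|m] eqn:E.
        - assert (H := Nat.pow_nonzero 2 n ltac:(lia)). lia.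
        - rewrite <- Cmod_pow. apply Cmod_pow_lt; auto. }
      specialize (Hr _ H1). assert (HKn : 0 <= K ^ n) by (apply pow_le; auto).
      replace (K * K ^ n * Cmod (h (x ^ 2 ^ n * x ^ 2 ^ n)%C)) with
        (K ^ n * (K * Cmod (h (x ^ 2 ^ n * x ^ 2 ^ n)%C))) by ring.
      apply Rmult_le_compat_l; auto. }
  (* Once [|x|^(2^n)] is below [1/(2K+2)], squaring beats the factor [K]. *)
  assert (Hlim : forall c, 0 < c -> exists N, forall n, (N <= n)%nat -> Cmod x ^ n < c).
  { intros c Hc. destruct (pow_lt_1_zero (Cmod x) ltac:(rewrite Rabs_pos_eq; lra) c Hc) as [N HN].
    exists N. intros n Hn. specialize (HN n Hn). rewrite Rabs_pos_eq in HN; auto.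
    apply pow_le; auto. }
  set (c := / (2 * K + 2)).
  assert (Hc : 0 < c) by (apply Rinv_0_lt_compat; lra).
  destruct (Hlim (Rmin c d) (Rmin_pos _ _ Hc Hd)) as [N HN].
  assert (Hsm : forall n, (N <= n)%nat -> Cmod (x ^ (2 ^ n)) < Rmin c d).
  { intros n Hn. eapply Rle_lt_trans; [apply iter_sqr_bound; auto | apply HN; auto]. }
  assert (Hdec : forall j, K ^ (N + j) * Cmod (x ^ (2 ^ (N + j))) <=
    K ^ N * Cmod (x ^ (2 ^ N)) * (/ 2) ^ j).
  { induction j as [|j IH].
    - rewrite Nat.add_0_r. simpl. lra.
    - replace (N + S j)%nat with (S (N + j)) by lia.
      replace (2 ^ S (N + j))%nat with (2 ^ (N + j) + 2 ^ (N + j))%nat by (simpl; lia).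
      rewrite Cpow_add_r, Cmod_mult. simpl (K ^ S (N + j)). simpl ((/ 2) ^ S j).
      assert (Hs := Hsm (N + j)%nat ltac:(lia)).
      assert (Hs' : Cmod (x ^ (2 ^ (N + j))) < c)
        by (eapply Rlt_le_trans; [apply Hs | apply Rmin_l]).
      set (y := Cmod (x ^ (2 ^ (N + j)))) in *.
      assert (Hy : 0 <= y) by apply Cmod_ge_0.
      assert (HKy : K * y <= / 2).
      { assert (K * c <= / 2); [|nra].
        unfold c. apply Rmult_le_reg_r with (2 * K + 2); [lra|].
        rewrite Rmult_assoc, Rinv_l by lra. lra. }
      assert (0 <= K ^ (N + j) * y) by (apply Rmult_le_pos; [apply pow_le|]; auto).
      replace (K * K ^ (N + j) * (y * y)) with ((K * y) * (K ^ (N + j) * y)) by ring.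
      replace (K ^ N * Cmod (x ^ 2 ^ N) * (/ 2 * (/ 2) ^ j)) with
        (/ 2 * (K ^ N * Cmod (x ^ 2 ^ N) * (/ 2) ^ j)) by ring.
      apply Rmult_le_compat; auto. apply Rmult_le_pos; auto. }
  apply Rle_antisym; [|apply Cmod_ge_0].
  apply Rnot_lt_le. intros Hpos.
  set (W := M * (K ^ N * Cmod (x ^ 2 ^ N))).
  assert (HW : 0 <= W).
  { unfold W. apply Rmult_le_pos; auto. apply Rmult_le_pos; [apply pow_le; auto | apply Cmod_ge_0]. }
  destruct (pow_lt_1_zero (/ 2) ltac:(rewrite Rabs_pos_eq; lra) (Cmod (h x) / (W + 1)))
    as [J HJ]; [apply Rdiv_lt_0_compat; lra|].
  specialize (HJ J (le_n _)). rewrite Rabs_pos_eq in HJ by (apply pow_le; lra).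
  specialize (Hit (N + J)%nat). specialize (Hdec J).
  assert (Hs := Hsm (N + J)%nat ltac:(lia)).
  specialize (HO (x ^ (2 ^ (N + J)))%C ltac:(eapply Rlt_le_trans; [apply Hs | apply Rmin_r])).
  assert (HKn : 0 <= K ^ (N + J)) by (apply pow_le; auto).
  assert (H1 : Cmod (h x) <= W * (/ 2) ^ J).
  { eapply Rle_trans; [apply Hit|].
    eapply Rle_trans; [apply Rmult_le_compat_l; [auto | apply HO]|].
    unfold W.
    replace (K ^ (N + J) * (M * Cmod (x ^ 2 ^ (N + J)))) with
      (M * (K ^ (N + J) * Cmod (x ^ 2 ^ (N + J)))) by ring.
    rewrite Rmult_assoc. apply Rmult_le_compat_l; auto. }
  apply Rmult_lt_compat_r with (r := W + 1) in HJ; [|lra].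
  replace (Cmod (h x) / (W + 1) * (W + 1)) with (Cmod (h x)) in HJ by (field; lra).
  assert (0 <= (/ 2) ^ J) by (apply pow_le; lra). nra.
Qed.

(** * Differential equations on the disk *)

Definition cdiff (f : C -> C) (x : C) : Prop := exists l, Cder f x l.

Lemma cdiff_const c x : cdiff (fun _ => c) x.
Proof. eexists. apply Cder_const. Qed.
Lemma cdiff_id x : cdiff (fun y => y) x.
Proof. eexists. apply Cder_id. Qed.
Lemma cdiff_plus f g x : cdiff f x -> cdiff g x -> cdiff (fun y => (f y + g y)%C) x.
Proof. intros [a Ha] [b Hb]. eexists. apply Cder_plus; eauto. Qed.
Lemma cdiff_minus f g x : cdiff f x -> cdiff g x -> cdiff (fun y => (f y - g y)%C) x.
Proof. intros [a Ha] [b Hb]. eexists. apply Cder_minus; eauto. Qed.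
Lemma cdiff_mult f g x : cdiff f x -> cdiff g x -> cdiff (fun y => (f y * g y)%C) x.
Proof. intros [a Ha] [b Hb]. eexists. apply Cder_mult; eauto. Qed.
Lemma cdiff_comp f g x : cdiff f (g x) -> cdiff g x -> cdiff (fun y => f (g y)) x.
Proof. intros [a Ha] [b Hb]. eexists. apply (Cder_comp f g); eauto. Qed.
Lemma cdiff_PS a (x : C) : tame a -> Cmod x < 1 -> cdiff (PS a) x.
Proof. intros. eexists. apply Cder_PS; auto. Qed.

Lemma Cder_sqr (x : C) : Cder (fun y => (y * y)%C) x (2 * x)%C.
Proof.
  eapply Cder_eq; [apply Cder_mult; apply Cder_id|]. cbv beta. ring.
Qed.

Lemma Cder_comp_sqr f (x d : C) : Cder f (x * x)%C d -> Cder (fun y => f (y * y)%C) x (2 * x * d)%C.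
Proof. intros H. apply (Cder_comp f (fun y => (y * y)%C)); auto. apply Cder_sqr. Qed.

Lemma Cder_comp_opp f (x d : C) : Cder f (- x)%C d -> Cder (fun y => f (- y)%C) x (- d)%C.
Proof.
  intros H. eapply Cder_eq;
    [apply (Cder_comp f (fun y => (- y)%C)); [apply H | apply Cder_opp, Cder_id]|]. ring.
Qed.

Ltac cdf :=
  match goal with
  | |- cdiff (fun y => (@?f y - @?g y)%C) _ => apply (cdiff_minus f g); cdf
  | |- cdiff (fun y => (@?f y + @?g y)%C) _ => apply (cdiff_plus f g); cdf
  | |- cdiff (fun y => (@?f y * @?g y)%C) _ => apply (cdiff_mult f g); cdf
  | |- cdiff (fun y => y) _ => apply cdiff_id
  | |- cdiff (fun y => ?c) _ => apply (cdiff_const c)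
  | |- _ => idtac
  end.

Definition dSf : C -> C := PS (PSd (lamc (nm one1) one1)).
Definition daf (x : C) : C := (2 * PS (PSd (lamc one1 chi4)) x)%C.
Definition dLs (x : C) : C := (2 * af x * daf x)%C.
Definition dPq (x : C) : C := (8 * (dSf x - 4 * (2 * x * dSf (x * x))))%C.

Lemma Cder_Sf (x : C) : Cmod x < 1 -> Cder Sf x (dSf x).
Proof. intros Hx. apply Cder_PS; auto with tame. Qed.

Lemma Cder_af' (x : C) : Cmod x < 1 -> Cder af x (daf x).
Proof.
  intros Hx. eapply Cder_eq; [apply Cder_plus; [apply Cder_const|];
    apply Cder_scal, Cder_PS; auto with tame|]. unfold daf. ring.
Qed.

Lemma Cder_Ls (x : C) : Cmod x < 1 -> Cder Ls x (dLs x).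
Proof.
  intros Hx. eapply Cder_eq; [apply Cder_mult; apply Cder_af'; auto|]. unfold dLs. ring.
Qed.

Lemma Cder_cE2q (x : C) : Cmod x < 1 -> Cder cE2q x (dPq x).
Proof.
  intros Hx. eapply Cder_eq.
  - apply Cder_plus; [apply Cder_const|]. apply Cder_scal. apply Cder_minus; [apply Cder_Sf; auto|].
    apply Cder_scal. apply (Cder_comp_sqr Sf). apply Cder_Sf, Cmod_sqr_lt; auto.
  - unfold dPq. ring.
Qed.

Lemma theta_Ls (x : C) : Cmod x < 1 ->
  (x * dLs x)%C = (4 * Ls x * (c0f x - Ls (- x)))%C.
Proof.
  intros Hx. unfold dLs, daf.
  replace (x * (2 * af x * (2 * PS (PSd (lamc one1 chi4)) x)))%C with
    (4 * af x * (x * PS (PSd (lamc one1 chi4)) x))%C by ring.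
  rewrite PS_theta by auto with tame.
  replace (PS (fun n => (CN n * lamc one1 chi4 n)%C) x) with (Lam (nm one1) (nm chi4) x)
    by (symmetry; apply PS_theta_Lam).
  rewrite theta_af by auto. unfold Ls. ring.
Qed.

Lemma theta_Ls_neg (x : C) : Cmod x < 1 ->
  (- x * dLs (- x))%C = (4 * Ls (- x) * (c0f x - Ls x))%C.
Proof.
  intros Hx. rewrite theta_Ls by (rewrite Cmod_opp; auto).
  replace (- - x)%C with x by ring. unfold c0f.
  replace (- x * - x)%C with (x * x)%C by ring. auto.
Qed.

Lemma cdiff_dSf (x : C) : Cmod x < 1 -> cdiff dSf x.
Proof. intros. apply cdiff_PS; auto with tame. Qed.

Lemma cdiff_dPq (x : C) : Cmod x < 1 -> cdiff dPq x.
Proof.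
  intros Hx. unfold dPq.
  cdf; [apply cdiff_dSf; auto|].
  apply (cdiff_comp dSf (fun y => (y * y)%C)); cdf. apply cdiff_dSf, Cmod_sqr_lt; auto.
Qed.

Lemma cE2q_0 : cE2q 0 = RtoC 1.
Proof. unfold cE2q. replace (0 * 0)%C with (RtoC 0) by ring. rewrite Sf_0. ring. Qed.

Lemma Ls_0 : Ls 0 = (/ 4)%C.
Proof. unfold Ls. rewrite af_0. field. Qed.

(** The derivative of the duplication formula [cE2q_dup]. *)
Lemma dPq_dup (x : C) : Cmod x < 1 -> (2 * x * dPq (x * x))%C = (dPq x / 2 - 2 * dLs (- x))%C.
Proof.
  intros Hx.
  apply (Cder_unique (fun y => cE2q (y * y)%C) x).
  - apply (Cder_comp_sqr cE2q). apply Cder_cE2q, Cmod_sqr_lt; auto.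
  - apply Cder_ext_loc with (f := fun y => (/ 2 * cE2q y + 2 * Ls (- y))%C) (d := 1 - Cmod x).
    + lra.
    + intros y Hy. rewrite cE2q_dup; [field|].
      replace y with ((y - x) + x)%C by ring. eapply Rle_lt_trans; [apply Cmod_triangle | lra].
    + eapply Cder_eq.
      * apply Cder_plus; apply Cder_scal; [apply Cder_cE2q; auto|].
        apply (Cder_comp_opp Ls). apply Cder_Ls. rewrite Cmod_opp. auto.
      * field.
Qed.

Lemma cdiff_O (h : C -> C) : cdiff h 0 -> h (RtoC 0) = RtoC 0 ->
  exists d M, 0 < d /\ 0 <= M /\ forall x, Cmod x < d -> Cmod (h x) <= M * Cmod x.
Proof.
  intros [l Hl] H0. destruct (Cder_elim _ _ _ Hl 1 ltac:(lra)) as [d [Hd HD]].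
  exists d, (1 + Cmod l). split; auto. split; [pose proof (Cmod_ge_0 l); lra|].
  intros x Hx. specialize (HD x). replace (x - 0)%C with x in HD by ring.
  specialize (HD Hx). rewrite H0 in HD.
  replace (h x) with ((h x - 0 - x * l) + x * l)%C by ring.
  eapply Rle_trans; [apply Cmod_triangle|]. rewrite Cmod_mult. lra.
Qed.

(** The term [16 Ls(-x)^2] is [cE4q] in another form. The duplication rules for [cE2q], its
    derivative and [Ls] give the defect the relation [h(y) = 4 h(y^2)], so [sqr_recursion_0] applies
    with [K = 4]. *)
Lemma theta_cE2q (x : C) : Cmod x < 1 ->
  (x * dPq x)%C = ((cE2q x * cE2q x - 16 * (Ls (- x) * Ls (- x))) / 4)%C.
Proof.
  pose (h := fun x => (x * dPq x - (cE2q x * cE2q x - 16 * (Ls (- x) * Ls (- x))) * / 4)%C).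
  assert (H0 : Cmod 0 < 1) by (rewrite Cmod_0; lra).
  assert (Hh : forall x, Cmod x < 1 -> h x = RtoC 0).
  { destruct (cdiff_O h) as [d [M [Hd [HM HO]]]].
    - unfold h.
      cdf; first [apply cdiff_dPq; assumption | exists (dPq 0); apply Cder_cE2q; assumption
        | exists (- dLs (- 0))%C; apply (Cder_comp_opp Ls), Cder_Ls; rewrite Cmod_opp; assumption].
    - unfold h. replace (- 0)%C with (RtoC 0) by ring. rewrite cE2q_0, Ls_0. field.
    - apply (sqr_recursion_0 h 4 M d); auto; [lra|].
      intros y Hy.
      assert (E : h y = (4 * h (y * y))%C).
      { assert (E1 := dPq_dup y Hy). assert (E2 := theta_Ls_neg y Hy).
        assert (E3 := Ls_dup y Hy). rewrite c0f_cE2q, cE2q_dup in E2 by auto.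
        unfold h. rewrite <- E3, cE2q_dup by auto.
        replace (y * y * dPq (y * y))%C with (/ 2 * y * (2 * y * dPq (y * y)))%C by field.
        rewrite E1.
        replace (/ 2 * y * (dPq y / 2 - 2 * dLs (- y)))%C with
          (y * dPq y / 4 + (- y * dLs (- y)))%C by field.
        rewrite E2. unfold Ls. field. }
      rewrite E, Cmod_mult, Cmod_R, Rabs_pos_eq; lra. }
  intros Hx. specialize (Hh x Hx). unfold h in Hh.
  replace (x * dPq x)%C with ((x * dPq x - (cE2q x * cE2q x - 16 * (Ls (- x) * Ls (- x))) * / 4) +
    (cE2q x * cE2q x - 16 * (Ls (- x) * Ls (- x))) * / 4)%C by ring.
  rewrite Hh. field.
Qed.

Lemma cdiff_Tf (x : C) : Cmod x < 1 -> cdiff Tf x.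
Proof. intros. apply cdiff_PS; auto with tame. Qed.

(** This is the level one identity [1 + 240 Tf = e2^2 + 192 D], written in [Ls]. By [Tf_diff] its
    defect is unchanged under [x -> x^2], which is the case [K = 1] of the recursion. *)
Lemma Tf_eq (x : C) : Cmod x < 1 ->
  Tf x = (((8 * Ls x - 4 * Ls (- x)) * (8 * Ls x - 4 * Ls (- x)) +
    192 * (Ls x * (Ls x - Ls (- x))) - 1) / 240)%C.
Proof.
  pose (h := fun x => (Tf x - ((8 * Ls x - 4 * Ls (- x)) * (8 * Ls x - 4 * Ls (- x)) +
    192 * (Ls x * (Ls x - Ls (- x))) - 1) * / 240)%C).
  assert (H0 : Cmod 0 < 1) by (rewrite Cmod_0; lra).
  assert (Hh : forall x, Cmod x < 1 -> h x = RtoC 0).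
  { destruct (cdiff_O h) as [d [M [Hd [HM HO]]]].
    - unfold h.
      cdf; first [apply cdiff_Tf; assumption | exists (dLs 0); apply Cder_Ls; assumption
        | exists (- dLs (- 0))%C; apply (Cder_comp_opp Ls), Cder_Ls; rewrite Cmod_opp; assumption].
    - unfold h. replace (- 0)%C with (RtoC 0) by ring. rewrite Tf_0, Ls_0. field.
    - apply (sqr_recursion_0 h 1 M d); auto; [lra|].
      intros y Hy. rewrite Rmult_1_l. apply Req_le. f_equal.
      assert (E1 := Tf_diff y Hy). assert (E3 := Ls_dup y Hy). assert (E4 := af_even y Hy).
      unfold h. rewrite <- E3.
      replace (Ls (y * y)) with ((/ 2 * (2 * af (y * y))) * (/ 2 * (2 * af (y * y))))%C
        by (unfold Ls; field).
      rewrite <- E4.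
      replace (Tf y) with ((Tf y - Tf (y * y)) + Tf (y * y))%C by ring.
      rewrite E1. unfold Ls. field. }
  intros Hx. specialize (Hh x Hx). unfold h in Hh.
  match type of Hh with (?a - ?b)%C = _ => replace a with ((a - b) + b)%C by ring end.
  rewrite Hh. field.
Qed.

Lemma cE4q_Ls (x : C) : Cmod x < 1 -> cE4q x = (16 * (Ls (- x) * Ls (- x)))%C.
Proof.
  intros Hx. assert (H := Tf_diff x Hx). unfold cE4q.
  replace (Tf (x * x)) with (Tf x - (Tf x - Tf (x * x)))%C by ring.
  rewrite H, Tf_eq by auto. field.
Qed.

(* Written with [a = Ls p], [b = Ls (-p)] for [p^2 = q]. *)
Lemma cE4q_sqr (x : C) : Cmod x < 1 -> cE4q (x * x) = (16 * (Ls x * Ls (- x)))%C.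
Proof.
  intros Hx. rewrite cE4q_Ls, <- Ls_dup by (auto using Cmod_sqr_lt). unfold Ls. ring.
Qed.

(** * The nome as a function of [z] *)

Lemma Cexp_add (w w' : C) : Cexp (w + w') = (Cexp w * Cexp w')%C.
Proof.
  destruct w as [x y], w' as [x' y']. unfold Cexp, Cmult, Cplus. simpl.
  rewrite exp_plus, cos_plus, sin_plus. apply injective_projections; simpl; ring.
Qed.

Lemma Cmod_Cexp (w : C) : Cmod (Cexp w) = exp (Re w).
Proof.
  unfold Cexp, Cmod. simpl fst. simpl snd.
  replace ((exp (Re w) * cos (Im w)) ^ 2 + (exp (Re w) * sin (Im w)) ^ 2) with
    (exp (Re w) ^ 2 * (Rsqr (sin (Im w)) + Rsqr (cos (Im w)))) by (unfold Rsqr; ring).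
  rewrite sin2_cos2, Rmult_1_r. apply sqrt_pow2. left. apply exp_pos.
Qed.

Lemma real_der_0 (f : R -> R) l : is_derive f 0 l ->
  forall eps, 0 < eps -> exists d, 0 < d /\ forall x, Rabs x < d ->
    Rabs (f x - f 0 - l * x) <= eps * Rabs x.
Proof.
  intros [_ H] eps He. specialize (H 0 (fun P HP => HP) (mkposreal eps He)).
  destruct H as [d Hd]. exists d. split; [apply cond_pos|].
  intros x Hx. specialize (Hd x).
  unfold ball in Hd. simpl in Hd. unfold AbsRing_ball, abs, minus, plus, opp in Hd. simpl in Hd.
  replace (x + - 0) with x in Hd by ring. specialize (Hd Hx).
  unfold norm, scal in Hd. simpl in Hd. unfold mult, abs in Hd. simpl in Hd.
  replace (f x - f 0 - l * x) with (f x + - f 0 + - (x * l)) by ring. exact Hd.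
Qed.

Lemma Cmod_le_sum (x y : R) : Cmod (x, y) <= Rabs x + Rabs y.
Proof.
  replace (x, y) with (RtoC x + Ci * RtoC y)%C
    by (unfold Cplus, Cmult, RtoC, Ci; simpl; f_equal; ring).
  eapply Rle_trans; [apply Cmod_triangle|]. rewrite Cmod_mult, Cmod_Ci, !Cmod_R. lra.
Qed.

Lemma Cder_Cexp_0 : Cder Cexp 0 1.
Proof.
  apply Cder_intro. intros eps He.
  (* Each coordinate of the error comes out below [4 e |w|], so [eps / 10] leaves room. *)
  set (e := Rmin 1 (eps / 10)). assert (He1 : 0 < e) by (apply Rmin_pos; lra).
  assert (He2 : e <= 1) by apply Rmin_l. assert (He3 : e <= eps / 10) by apply Rmin_r.
  pose proof (is_derive_exp 0) as E1. rewrite exp_0 in E1.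
  pose proof (is_derive_cos 0) as E2. rewrite sin_0, Ropp_0 in E2.
  pose proof (is_derive_sin 0) as E3. rewrite cos_0 in E3.
  destruct (real_der_0 exp 1 E1 e He1) as [d1 [Hd1 H1]].
  destruct (real_der_0 cos 0 E2 e He1) as [d2 [Hd2 H2]].
  destruct (real_der_0 sin 1 E3 e He1) as [d3 [Hd3 H3]].
  set (d := Rmin (Rmin d1 d2) (Rmin d3 (e / 2))).
  assert (Hd : 0 < d) by (repeat apply Rmin_pos; lra).
  assert (D1 : d <= d1) by (eapply Rle_trans; [apply Rmin_l | apply Rmin_l]).
  assert (D2 : d <= d2) by (eapply Rle_trans; [apply Rmin_l | apply Rmin_r]).
  assert (D3 : d <= d3) by (eapply Rle_trans; [apply Rmin_r | apply Rmin_l]).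
  assert (D4 : d <= e / 2) by (eapply Rle_trans; [apply Rmin_r | apply Rmin_r]).
  exists d. split; auto. intros w Hw.
  replace (w - 0)%C with w in * by ring.
  assert (Hx := re_le_Cmod w). assert (Hy := im_le_Cmod w).
  specialize (H1 (Re w) ltac:(lra)). specialize (H2 (Im w) ltac:(lra)).
  specialize (H3 (Im w) ltac:(lra)).
  rewrite exp_0, Rmult_1_l in H1. rewrite cos_0 in H2. rewrite sin_0 in H3.
  set (m := Cmod w) in *. destruct w as [x y]. simpl Re in *. simpl Im in *.
  replace (Cexp (x, y) - Cexp 0 - (x, y) * 1)%C with
    (exp x * (cos y - 1) + (exp x - 1 - x), exp x * (sin y - y) + (exp x - 1) * y).
  2:{ unfold Cexp, Cminus, Cplus, Copp, Cmult, RtoC. simpl.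
      rewrite exp_0, cos_0, sin_0. f_equal; ring. }
  assert (B1 : Rabs (exp x - 1 - x) <= e * m) by (eapply Rle_trans; [apply H1|]; nra).
  assert (B1' : Rabs (exp x - 1) <= 2 * Rabs x).
  { replace (exp x - 1) with ((exp x - 1 - x) + x) by ring.
    eapply Rle_trans; [apply Rabs_triang|]. assert (0 <= Rabs x) by apply Rabs_pos. nra. }
  assert (B2 : Rabs (cos y - 1) <= e * m).
  { replace (cos y - 1) with (cos y - 1 - 0 * y) by ring.
    eapply Rle_trans; [apply H2|]. nra. }
  assert (B3 : Rabs (sin y - y) <= e * m).
  { replace (sin y - y) with (sin y - 0 - 1 * y) by ring.
    eapply Rle_trans; [apply H3|]. nra. }
  assert (B4 : 0 <= exp x <= 3).
  { split; [left; apply exp_pos|]. assert (Hxx := Rle_abs (exp x - 1)). lra. }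
  assert (Hm : 0 <= m) by apply Cmod_ge_0.
  eapply Rle_trans; [apply Cmod_le_sum|].
  assert (C1 : Rabs (exp x * (cos y - 1) + (exp x - 1 - x)) <= 4 * e * m).
  { eapply Rle_trans; [apply Rabs_triang|]. rewrite Rabs_mult, (Rabs_pos_eq (exp x)) by lra.
    assert (0 <= Rabs (cos y - 1)) by apply Rabs_pos. nra. }
  assert (C2 : Rabs (exp x * (sin y - y) + (exp x - 1) * y) <= 4 * e * m).
  { eapply Rle_trans; [apply Rabs_triang|]. rewrite !Rabs_mult, (Rabs_pos_eq (exp x)) by lra.
    assert (0 <= Rabs (sin y - y)) by apply Rabs_pos. assert (0 <= Rabs (exp x - 1)) by apply Rabs_pos.
    assert (Rabs (exp x - 1) * Rabs y <= e * m).
    { apply Rmult_le_compat; auto; [apply Rabs_pos | lra]. }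
    nra. }
  nra.
Qed.

Lemma Cder_Cexp (w : C) : Cder Cexp w (Cexp w).
Proof.
  apply Cder_ext with (fun y => (Cexp w * Cexp (y - w))%C).
  { intros y. rewrite <- Cexp_add. f_equal. ring. }
  eapply Cder_eq.
  - apply Cder_scal. apply (Cder_comp Cexp (fun y => (y - w)%C)).
    + replace (w - w)%C with (RtoC 0) by ring. apply Cder_Cexp_0.
    + apply Cder_minus; [apply Cder_id | apply Cder_const].
  - ring.
Qed.

(* [d/dz = ipi * q d/dq]. *)
Definition ipi : C := (2 * PI * Ci)%C.

Lemma PI_nz : RtoC PI <> RtoC 0.
Proof. intros E. apply RtoC_inj in E. assert (H := PI_RGT_0). lra. Qed.

Lemma Ci_nz : Ci <> RtoC 0.
Proof. intros E. apply (f_equal snd) in E. simpl in E. lra. Qed.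

Lemma ipi_nz : ipi <> RtoC 0.
Proof.
  unfold ipi. repeat apply Cmult_neq_0; [|apply PI_nz | apply Ci_nz].
  intros E. apply RtoC_inj in E. lra.
Qed.

Lemma CN_nz n : (0 < n)%nat -> CN n <> RtoC 0.
Proof. intros H E. apply RtoC_inj in E. apply lt_INR in H. simpl in H. lra. Qed.

Lemma Cder_q_ N (z : C) : (0 < N)%nat -> Cder (q_ N) z (ipi / CN N * q_ N z)%C.
Proof.
  intros HN. assert (H := CN_nz N HN). unfold q_.
  eapply Cder_eq.
  - apply (Cder_comp Cexp (fun z => (2 * PI * Ci * z / CN N)%C)); [apply Cder_Cexp|].
    apply Cder_ext with (fun z => (2 * PI * Ci / CN N * z)%C); [intros y; field; auto|].
    apply Cder_scal, Cder_id.
  - unfold ipi. field. auto.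
Qed.

Lemma Re_q_arg N (z : C) : Re (2 * PI * Ci * z / CN N)%C = - (2 * PI * Im z / INR N).
Proof.
  destruct (Nat.eq_dec N 0) as [->|HN].
  - unfold CN, Cdiv, Cinv, Cmult, RtoC, Ci. simpl.
    destruct z as [x y]. simpl. unfold Rdiv.
    replace (0 * (0 * 1) + 0 * (0 * 1)) with 0 by ring. rewrite Rinv_0. ring.
  - assert (H : INR N <> 0) by (apply not_0_INR; auto).
    unfold CN, Cdiv. rewrite <- RtoC_inv by auto.
    destruct z as [x y]. unfold Cmult, RtoC, Ci. simpl. field. auto.
Qed.

Lemma Cmod_q_ N (z : C) : Cmod (q_ N z) = exp (- (2 * PI * Im z / INR N)).
Proof. unfold q_. rewrite Cmod_Cexp, Re_q_arg. auto. Qed.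

Lemma Cmod_q_lt N (z : C) : (0 < N)%nat -> upper z -> Cmod (q_ N z) < 1.
Proof.
  intros HN Hz. rewrite Cmod_q_, <- exp_0. apply exp_increasing.
  apply lt_INR in HN. simpl in HN. assert (HP := PI_RGT_0). unfold upper in Hz.
  assert (0 < 2 * PI * Im z / INR N); [|lra].
  apply Rdiv_lt_0_compat; auto. nra.
Qed.

Lemma q_sqr z : q z = (q_ 2 z * q_ 2 z)%C.
Proof.
  unfold q, q_. rewrite <- Cexp_add. f_equal. unfold CN. simpl INR.
  replace (1 + 1) with 2 by ring. field.
Qed.

Lemma Cexp_ipi_half : Cexp (PI * Ci)%C = RtoC (-1).
Proof.
  unfold Cexp, Cmult, Ci, RtoC. simpl.
  replace (PI * 0 - 0 * 1) with 0 by ring. replace (PI * 1 + 0 * 0) with PI by ring.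
  rewrite exp_0, cos_PI, sin_PI. f_equal; ring.
Qed.

Lemma q2_add_1 (z : C) : q_ 2 (z + 1) = (- q_ 2 z)%C.
Proof.
  unfold q_. replace (2 * PI * Ci * (z + 1) / CN 2)%C with
    (2 * PI * Ci * z / CN 2 + PI * Ci)%C.
  - rewrite Cexp_add, Cexp_ipi_half. ring.
  - rewrite CN_2. field.
Qed.

Definition az (z : C) : C := Ls (q_ 2 z).
Definition bz (z : C) : C := Ls (- q_ 2 z).

Lemma CSeries1_hasSum (a : nat -> C) l : hasSum (fun m => a (S m)) l -> CSeries1 a = l.
Proof. apply CSeries_hasSum. Qed.

Lemma cE2_cE2q (z : C) : upper z -> cE2 z = cE2q (q z).
Proof.
  intros Hz. assert (H := Cmod_q_lt 1 z ltac:(lia) Hz). fold (q z) in H.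
  unfold cE2, cE2q. f_equal. f_equal. apply CSeries1_hasSum.
  eapply hasSum_ext; [|apply hasSum_B; auto].
  intros n. cbv beta. replace (S n - 1)%nat with n by lia. unfold Cdiv. ring.
Qed.

Lemma e2_e2q (z : C) : upper z -> e2 z = e2q (q z).
Proof.
  intros Hz. assert (H := Cmod_q_lt 1 z ltac:(lia) Hz). fold (q z) in H.
  unfold e2, e2q. f_equal. f_equal. apply CSeries1_hasSum.
  eapply hasSum_ext; [|apply hasSum_A; auto].
  intros n. cbv beta. unfold Cdiv. ring.
Qed.

Lemma cE4_cE4q (z : C) : upper z -> cE4 z = cE4q (q z).
Proof.
  intros Hz. assert (H := Cmod_q_lt 1 z ltac:(lia) Hz). fold (q z) in H.
  unfold cE4, cE4q. f_equal. f_equal. f_equal. apply CSeries1_hasSum.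
  eapply hasSum_ext; [|apply hasSum_C4; auto].
  intros n. cbv beta. replace (S n - 1)%nat with n by lia. unfold Cdiv. ring.
Qed.

Lemma e2_ab (z : C) : upper z -> e2 z = (2 * (az z + bz z))%C.
Proof.
  intros Hz. rewrite e2_e2q, q_sqr by auto. apply e2q_Ls, Cmod_q_lt; auto.
Qed.

Lemma cE4_ab (z : C) : upper z -> cE4 z = (16 * (az z * bz z))%C.
Proof.
  intros Hz. rewrite cE4_cE4q, q_sqr by auto. apply cE4q_sqr, Cmod_q_lt; auto.
Qed.

Lemma D_ab (z : C) : upper z -> D z = ((az z - bz z) * (az z - bz z) / 16)%C.
Proof.
  intros Hz. unfold D. rewrite e2_ab, cE4_ab by auto. field.
Qed.

Definition Pz (z : C) : C := cE2q (q z).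

Lemma Cder_az (z : C) : upper z -> Cder az z (ipi * (2 * az z * (Pz z / 4 - bz z)))%C.
Proof.
  intros Hz. assert (H := Cmod_q_lt 2 z ltac:(lia) Hz).
  eapply Cder_eq; [apply (Cder_comp Ls (q_ 2)); [apply Cder_Ls; auto | apply Cder_q_; lia]|].
  replace (ipi / CN 2 * q_ 2 z * dLs (q_ 2 z))%C with (ipi / CN 2 * (q_ 2 z * dLs (q_ 2 z)))%C by ring.
  rewrite theta_Ls, c0f_cE2q, <- q_sqr, CN_2 by auto. unfold az, bz, Pz. field.
Qed.

Lemma Cder_bz (z : C) : upper z -> Cder bz z (ipi * (2 * bz z * (Pz z / 4 - az z)))%C.
Proof.
  intros Hz. assert (H := Cmod_q_lt 2 z ltac:(lia) Hz).
  eapply Cder_eq; [apply (Cder_comp (fun x => Ls (- x)%C) (q_ 2));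
    [apply (Cder_comp_opp Ls), Cder_Ls; rewrite Cmod_opp; auto | apply Cder_q_; lia]|].
  replace (ipi / CN 2 * q_ 2 z * - dLs (- q_ 2 z))%C with
    (ipi / CN 2 * (- q_ 2 z * dLs (- q_ 2 z)))%C by ring.
  rewrite theta_Ls_neg, c0f_cE2q, <- q_sqr, CN_2 by auto. unfold az, bz, Pz. field.
Qed.

Lemma Cder_Pz (z : C) : upper z ->
  Cder Pz z (ipi * ((Pz z * Pz z - 16 * (az z * bz z)) / 4))%C.
Proof.
  intros Hz. assert (H := Cmod_q_lt 1 z ltac:(lia) Hz). fold (q z) in H.
  assert (H2 := Cmod_q_lt 2 z ltac:(lia) Hz).
  eapply Cder_eq; [apply (Cder_comp cE2q (q_ 1)); [apply Cder_cE2q; auto | apply Cder_q_; lia]|].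
  fold (q z).
  replace (ipi / CN 1 * q z * dPq (q z))%C with (ipi / CN 1 * (q z * dPq (q z)))%C by ring.
  rewrite theta_cE2q by auto. unfold Pz at 1 2.
  replace (Ls (- q z) * Ls (- q z))%C with (az z * bz z)%C.
  - change (CN 1) with (RtoC 1). field.
  - unfold az, bz. rewrite q_sqr, <- Ls_dup by auto. unfold Ls. ring.
Qed.

(** * Inversion on the imaginary axis *)

(* [theta_3^2 / 2] and [theta_4^2 / 2] at [i y]; [rg] below is [theta_2^2 / 2]. *)
Definition ra (y : R) : R := Re (af (RtoC (exp (- (PI * y))))).
Definition rb (y : R) : R := Re (af (- RtoC (exp (- (PI * y))))%C).

Lemma Rabs_lt_all (x : R) : (forall eps, 0 < eps -> Rabs x <= eps) -> x = 0.
Proof.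
  intros H. destruct (Req_dec x 0) as [|E]; auto.
  assert (Hp := Rabs_pos_lt x E). specialize (H (Rabs x / 2) ltac:(lra)). lra.
Qed.

Lemma hasSum_real {I : Type} (f : I -> R) l : hasSum (fun i => RtoC (f i)) l -> l = RtoC (Re l).
Proof.
  intros H. assert (E : Im l = 0).
  { apply Rabs_lt_all. intros eps He. destruct (H eps He) as [s0 Hs0].
    specialize (Hs0 (nodup cdec s0) (NoDup_nodup _ _)
      (fun x Hx => proj2 (nodup_In _ _ _) Hx)).
    rewrite lsum_RtoC in Hs0.
    assert (H1 := im_le_Cmod (RtoC (rsum f (nodup cdec s0)) - l)). simpl in H1.
    replace (0 + - snd l) with (- snd l) in H1 by ring. rewrite Rabs_Ropp in H1.
    unfold Im. lra. }
  destruct l as [x y]. simpl in *. subst. reflexivity.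
Qed.

Lemma hasSum_Re_nonneg {I : Type} (f : I -> R) l :
  (forall i, 0 <= f i) -> hasSum (fun i => RtoC (f i)) l -> 0 <= Re l.
Proof.
  intros Hf H. apply Rnot_lt_le. intros Hlt.
  destruct (H (- Re l) ltac:(lra)) as [s0 Hs0].
  specialize (Hs0 (nodup cdec s0) (NoDup_nodup _ _)
    (fun x Hx => proj2 (nodup_In _ _ _) Hx)).
  rewrite lsum_RtoC in Hs0.
  assert (H1 := re_le_Cmod (RtoC (rsum f (nodup cdec s0)) - l)).
  assert (H2 := rsum_pos f (nodup cdec s0) Hf).
  simpl in H1. apply Rabs_le_between in H1. unfold Re in *. lra.
Qed.

Lemma Cmod_lt_1_R (x : R) : Rabs x < 1 -> Cmod (RtoC x) < 1.
Proof. rewrite Cmod_R. auto. Qed.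

Lemma hasSum_L4_real (x : R) : Rabs x < 1 ->
  hasSum (fun n => RtoC (x ^ S n / (1 + x ^ S n * x ^ S n))) (L4 (RtoC x)).
Proof.
  intros Hx. eapply hasSum_ext; [|apply hasSum_L4, Cmod_lt_1_R, Hx].
  intros n. cbv beta. rewrite <- !RtoC_pow.
  assert (H : 0 <= x ^ S n * x ^ S n) by apply Rle_0_sqr.
  rewrite RtoC_div by lra. rewrite RtoC_plus, RtoC_mult. auto.
Qed.

Lemma af_real (x : R) : Rabs x < 1 -> af (RtoC x) = RtoC (Re (af (RtoC x))).
Proof.
  intros Hx. assert (H := hasSum_real _ _ (hasSum_L4_real x Hx)).
  unfold af. rewrite H. unfold Cplus, Cmult, Cdiv, Cinv, RtoC. simpl.
  apply injective_projections; simpl; [auto | field].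
Qed.

Lemma exp_nome (y : R) : 0 < y -> 0 < exp (- (PI * y)) < 1.
Proof.
  intros Hy. split; [apply exp_pos|]. rewrite <- exp_0 at 1. apply exp_increasing.
  assert (H := PI_RGT_0). nra.
Qed.

Lemma af_ra (y : R) : 0 < y -> af (RtoC (exp (- (PI * y)))) = RtoC (ra y).
Proof.
  intros Hy. destruct (exp_nome y Hy). apply af_real. rewrite Rabs_pos_eq; lra.
Qed.

Lemma af_rb (y : R) : 0 < y -> af (- RtoC (exp (- (PI * y))))%C = RtoC (rb y).
Proof.
  intros Hy. destruct (exp_nome y Hy). unfold rb. rewrite <- RtoC_opp. apply af_real.
  rewrite Rabs_Ropp, Rabs_pos_eq; lra.
Qed.

Lemma exp_nome_sqr (y : R) :
  (RtoC (exp (- (PI * y))) * RtoC (exp (- (PI * y))))%C = RtoC (exp (- (PI * (2 * y)))).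
Proof. rewrite <- RtoC_mult, <- exp_plus. do 2 f_equal. ring. Qed.

Lemma Cmod_nome (y : R) : 0 < y -> Cmod (RtoC (exp (- (PI * y)))) < 1.
Proof. intros Hy. destruct (exp_nome y Hy). apply Cmod_lt_1_R. rewrite Rabs_pos_eq; lra. Qed.

Lemma ra_double (y : R) : 0 < y -> 2 * ra (2 * y) = ra y + rb y.
Proof.
  intros Hy. assert (H := af_even _ (Cmod_nome y Hy)).
  rewrite exp_nome_sqr, !af_ra, af_rb in H by lra.
  rewrite <- RtoC_plus, <- RtoC_mult in H. apply RtoC_inj in H. lra.
Qed.

Lemma rb_double (y : R) : 0 < y -> rb (2 * y) * rb (2 * y) = ra y * rb y.
Proof.
  intros Hy. assert (H := Ls_dup _ (Cmod_nome y Hy)). unfold Ls in H.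
  rewrite exp_nome_sqr, !af_ra, !af_rb in H by lra.
  rewrite <- !RtoC_mult in H. apply RtoC_inj in H. lra.
Qed.

Lemma phi_mono (u v : R) : 0 <= u -> u <= v -> v <= 1 -> u / (1 + u * u) <= v / (1 + v * v).
Proof.
  intros Hu Huv Hv. apply Rmult_le_reg_r with ((1 + u * u) * (1 + v * v)); [nra|].
  field_simplify; [|nra|nra].
  assert (0 <= (v - u) * (1 - u * v)); [|nra].
  apply Rmult_le_pos; [lra|]. nra.
Qed.

(** The function [- atan (exp (- t))] is a primitive of [sech t / 2]. The mean value theorem on one
    mesh interval and monotonicity of the integrand compare the increment with both end values. *)
Lemma atan_step (h : R) n : 0 < h ->
  let x := exp (- h) in
  h * (x ^ S n / (1 + x ^ S n * x ^ S n)) <= atan (x ^ n) - atan (x ^ S n)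
  <= h * (x ^ n / (1 + x ^ n * x ^ n)).
Proof.
  intros Hh x.
  assert (Ex : forall k, x ^ k = exp (- (INR k * h))).
  { intros k. unfold x. induction k as [|k IH].
    - simpl. rewrite Rmult_0_l, Ropp_0, exp_0. auto.
    - simpl pow. rewrite IH, <- exp_plus, S_INR. f_equal. ring. }
  destruct (MVT_gen (fun t => - atan (exp (- t))) (INR n * h) (INR (S n) * h)
    (fun t => exp (- t) / (1 + exp (- t) * exp (- t)))) as [c [Hc E]].
  - intros t _. auto_derive; auto. assert (H := exp_pos (- t)). field. nra.
  - intros t _. apply derivable_continuous_pt.
    exists (exp (- t) / (1 + exp (- t) * exp (- t))). apply is_derive_Reals.
    auto_derive; auto. assert (H := exp_pos (- t)). field. nra.
  - rewrite S_INR in Hc, E. assert (Hn := pos_INR n).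
    rewrite Rmin_left, Rmax_right in Hc by nra.
    rewrite !Ex, S_INR.
    replace (atan (exp (- (INR n * h))) - atan (exp (- ((INR n + 1) * h)))) with
      (h * (exp (- c) / (1 + exp (- c) * exp (- c)))) by (rewrite <- Rmult_comm; lra).
    assert (M : forall s t, s <= t -> exp (- t) <= exp (- s)).
    { intros s t [Hs| ->]; [left; apply exp_increasing; lra | lra]. }
    assert (P : forall t, 0 <= t -> exp (- t) <= 1).
    { intros t Ht. rewrite <- exp_0. rewrite <- Ropp_0. apply M. auto. }
    split; apply Rmult_le_compat_l; try lra; apply phi_mono;
      try (left; apply exp_pos); try (apply M; lra); apply P; nra.
Qed.

Lemma atan_le (u : R) : 0 <= u -> 0 <= atan u <= u.
Proof.
  intros Hu. split.
  - rewrite <- atan_0. destruct Hu as [Hu| <-]; [left; apply atan_increasing; auto | lra].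
  - destruct (MVT_gen atan 0 u (fun t => / (1 + t ^ 2))) as [c [Hc E]].
    + intros t _. auto_derive; auto. unfold Rsqr; field; nra.
    + intros t _. apply derivable_continuous_pt. apply derivable_pt_atan.
    + rewrite atan_0 in E. rewrite Rmin_left, Rmax_right in Hc by lra.
      assert (/ (1 + c ^ 2) <= 1).
      { rewrite <- Rinv_1. apply Rinv_le_contravar; nra. }
      nra.
Qed.

Lemma sum_n_RtoC (f : nat -> R) n :
  sum_n (G := C_AbelianMonoid) (fun k => RtoC (f k)) n = RtoC (sum_n f n).
Proof.
  induction n as [|n IH]; [rewrite !sum_O; auto|].
  rewrite !sum_Sn, IH. change (plus (RtoC (sum_n f n)) (RtoC (f (S n)))) with
    (RtoC (sum_n f n) + RtoC (f (S n)))%C.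
  rewrite <- RtoC_plus. reflexivity.
Qed.

(* The Riemann sum of [sech] with mesh [pi y], compared with its integral. *)
Lemma ra_bound (y : R) : 0 < y -> Rabs (y * ra y - / 2) <= y / 2.
Proof.
  intros Hy. destruct (exp_nome y Hy) as [Hx0 Hx1].
  assert (HP := PI_RGT_0). set (h := PI * y). assert (Hh : 0 < h) by (unfold h; nra).
  set (x := exp (- h)). fold h in Hx0, Hx1. fold x in Hx0, Hx1.
  assert (Hax : Rabs x < 1) by (rewrite Rabs_pos_eq; lra).
  set (phi := fun n => x ^ n / (1 + x ^ n * x ^ n)).
  assert (HL := hasSum_L4_real x Hax).
  assert (EL := hasSum_real _ _ HL). set (L := Re (L4 (RtoC x))) in *.
  assert (Er : ra y = / 2 + 2 * L).
  { unfold ra. fold h. fold x. unfold af. rewrite EL.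
    unfold Cplus, Cmult, Cdiv, Cinv, RtoC. simpl. field. }
  apply hasSum_is_series in HL. rewrite is_C_series_iff in HL.
  assert (Hlim : forall eps, 0 < eps -> exists N, forall n, (N <= n)%nat ->
    Rabs (sum_n (fun n => phi (S n)) n - L) < eps).
  { intros eps He. destruct (HL eps He) as [N HN]. exists N. intros n Hn. specialize (HN n Hn).
    rewrite sum_n_RtoC, EL, <- RtoC_minus, Cmod_R in HN. exact HN. }
  assert (Hup : forall n, h * sum_n (fun n => phi (S n)) n <= PI / 4 - atan (x ^ S n)).
  { induction n as [|n IH].
    - rewrite sum_O. assert (H := atan_step h 0 Hh). cbv zeta in H. fold x in H.
      change (x ^ 0) with 1 in H. rewrite atan_1 in H. unfold phi. lra.
    - rewrite sum_Sn. unfold plus. simpl AbelianMonoid.plus. cbn -[sum_n pow phi].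
      assert (H := atan_step h (S n) Hh). cbv zeta in H. fold x in H.
      unfold phi at 2. simpl in *. lra. }
  (* The interval next to 0 is bounded by [h] times the value [1/2] of [phi] at 0, which is not part
     of the sum; this is the source of the error term. *)
  assert (Hlo : forall n, PI / 4 - atan (x ^ S (S n)) - h / 2 <= h * sum_n (fun n => phi (S n)) n).
  { induction n as [|n IH].
    - rewrite sum_O. assert (H := atan_step h 0 Hh). assert (H2 := atan_step h 1 Hh).
      cbv zeta in H, H2. fold x in H, H2.
      change (x ^ 0) with 1 in H. rewrite atan_1 in H. unfold phi. lra.
    - rewrite sum_Sn. unfold plus. simpl AbelianMonoid.plus. cbn -[sum_n pow phi].
      assert (H := atan_step h (S (S n)) Hh). cbv zeta in H. fold x in H.
      unfold phi at 2. simpl in *. lra. }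
  assert (H1 : h * L <= PI / 4).
  { apply Rnot_lt_le. intros Hlt.
    destruct (Hlim ((h * L - PI / 4) / h)) as [N HN]; [apply Rdiv_lt_0_compat; lra|].
    specialize (HN N (le_n _)). apply Rabs_def2 in HN. destruct HN as [_ HN].
    specialize (Hup N). assert (Ha := atan_le (x ^ S N) (pow_le _ _ (Rlt_le _ _ Hx0))).
    apply Rmult_lt_compat_l with (r := h) in HN; auto.
    replace (h * - ((h * L - PI / 4) / h)) with (PI / 4 - h * L) in HN by (field; lra). lra. }
  assert (H2 : PI / 4 - h / 2 <= h * L).
  { apply Rnot_lt_le. intros Hlt. set (e := (PI / 4 - h / 2 - h * L) / 2).
    destruct (Hlim (e / h)) as [N HN]; [apply Rdiv_lt_0_compat; unfold e; lra|].
    destruct (pow_lt_1_zero x Hax e ltac:(unfold e; lra)) as [N2 HN2].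
    set (n := (N + N2)%nat).
    specialize (HN n ltac:(unfold n; lia)). specialize (HN2 (S (S n)) ltac:(unfold n; lia)).
    apply Rabs_def2 in HN. destruct HN as [HN _].
    specialize (Hlo n).
    assert (Ha := atan_le (x ^ S (S n)) (pow_le _ _ (Rlt_le _ _ Hx0))).
    assert (Hb := Rle_abs (x ^ S (S n))).
    apply Rmult_lt_compat_l with (r := h) in HN; auto.
    replace (h * (e / h)) with e in HN by (field; lra). unfold e in *. lra. }
  rewrite Er. unfold h in *.
  apply Rabs_le. split; apply Rmult_le_reg_l with PI; auto; nra.
Qed.

Lemma ra_ge (y : R) : 0 < y -> / 2 <= ra y.
Proof.
  intros Hy. destruct (exp_nome y Hy) as [Hx0 Hx1]. unfold ra.
  set (x := exp (- (PI * y))) in *.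
  assert (Hax : Rabs x < 1) by (rewrite Rabs_pos_eq; lra).
  assert (HL := hasSum_L4_real x Hax). assert (EL := hasSum_real _ _ HL).
  assert (H0 : 0 <= Re (L4 (RtoC x))).
  { refine (hasSum_Re_nonneg _ _ _ HL). intros n.
    assert (Hn : 0 < x ^ S n) by (apply pow_lt; auto).
    left. apply Rdiv_lt_0_compat; [auto|]. assert (0 < x ^ S n * x ^ S n) by nra. lra. }
  unfold af. rewrite EL. set (L := Re (L4 (RtoC x))) in *.
  unfold Cplus, Cmult, Cdiv, Cinv, RtoC. simpl.
  match goal with |- _ <= ?r => replace r with (/ 2 + 2 * L) by field end. lra.
Qed.

Lemma lim_nome (f : R -> C) : (forall y, 0 < y -> Cmod (f y) = exp (- (PI * y))) ->
  forall eps, 0 < eps -> exists Y, 0 < Y /\ forall y, Y <= y -> Cmod (af (f y) - / 2) < eps.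
Proof.
  intros Hf eps He.
  assert (H0 : Cmod 0 < 1) by (rewrite Cmod_0; lra).
  destruct (Cder_continuous _ _ _ (Cder_af' 0 H0) eps He) as [d [Hd HD]].
  rewrite af_0 in HD.
  assert (HP := PI_RGT_0).
  (* From here on [exp (PI y) > 1 + PI y > 1 / d], so the nome is smaller than [d]. *)
  exists (1 / (PI * d)). split; [apply Rdiv_lt_0_compat; nra|].
  intros y Hy. assert (Hy0 : 0 < y).
  { assert (0 < 1 / (PI * d)) by (apply Rdiv_lt_0_compat; nra). lra. }
  apply HD. replace (f y - 0)%C with (f y) by ring. rewrite Hf by auto.
  assert (H1 : 1 <= PI * y * d).
  { apply Rmult_le_compat_l with (r := PI * d) in Hy; [|nra].
    replace (PI * d * (1 / (PI * d))) with 1 in Hy by (field; lra). nra. }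
  assert (H2 : 1 + PI * y < exp (PI * y)) by (apply exp_ineq1; nra).
  rewrite exp_Ropp. apply Rmult_lt_reg_l with (exp (PI * y)); [apply exp_pos|].
  rewrite Rinv_r by (apply Rgt_not_eq, exp_pos). nra.
Qed.

Lemma ra_lim eps : 0 < eps -> exists Y, 0 < Y /\ forall y, Y <= y -> Rabs (ra y - / 2) < eps.
Proof.
  intros He. destruct (lim_nome (fun y => RtoC (exp (- (PI * y))))) with (eps := eps)
    as [Y [HY H]]; auto.
  { intros y Hy. rewrite Cmod_R, Rabs_pos_eq; auto. left. apply exp_pos. }
  exists Y. split; auto. intros y Hy. specialize (H y Hy).
  rewrite af_ra in H by lra. rewrite <- RtoC_inv, <- RtoC_minus, Cmod_R in H by lra. auto.
Qed.

Lemma rb_lim eps : 0 < eps -> exists Y, 0 < Y /\ forall y, Y <= y -> Rabs (rb y - / 2) < eps.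
Proof.
  intros He. destruct (lim_nome (fun y => (- RtoC (exp (- (PI * y))))%C)) with (eps := eps)
    as [Y [HY H]]; auto.
  { intros y Hy. rewrite Cmod_opp, Cmod_R, Rabs_pos_eq; auto. left. apply exp_pos. }
  exists Y. split; auto. intros y Hy. specialize (H y Hy).
  rewrite af_rb in H by lra. rewrite <- RtoC_inv, <- RtoC_minus, Cmod_R in H by lra. auto.
Qed.

Lemma pow2_large (y Y : R) : 0 < y -> exists N, forall n, (N <= n)%nat -> Y <= 2 ^ n * y.
Proof.
  intros Hy. destruct (Pow_x_infinity 2 ltac:(rewrite Rabs_pos_eq; lra) (Y / y)) as [N HN].
  exists N. intros n Hn. specialize (HN n Hn).
  rewrite Rabs_pos_eq in HN by (apply pow_le; lra).
  apply Rge_le in HN. apply Rmult_le_compat_r with (r := y) in HN; [|lra].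
  replace (Y / y * y) with Y in HN by (field; lra). auto.
Qed.

(** By [rb_double] the product [ra y * rb y] is a square, so [rb] is nonnegative. A zero would
    persist under all doublings, against the limit [1/2]. *)
Lemma rb_pos (y : R) : 0 < y -> 0 < rb y.
Proof.
  intros Hy. assert (Ha := ra_ge y Hy). assert (Hd := rb_double y Hy).
  assert (Hge : 0 <= rb y).
  { assert (0 <= rb (2 * y) * rb (2 * y)) by apply Rle_0_sqr. nra. }
  destruct Hge as [|E]; auto. exfalso.
  assert (Hall : forall n, rb (2 ^ n * y) = 0).
  { induction n as [|n IH]; [simpl; rewrite Rmult_1_l; auto|].
    assert (Hn : 0 < 2 ^ n * y) by (apply Rmult_lt_0_compat; auto; apply pow_lt; lra).
    assert (H := rb_double _ Hn). rewrite IH in H.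
    replace (2 ^ S n * y) with (2 * (2 ^ n * y)) by (simpl; ring). nra. }
  destruct (rb_lim (/ 2) ltac:(lra)) as [Y [HY HYl]].
  destruct (pow2_large y Y Hy) as [N HN].
  specialize (HYl _ (HN N (le_n _))). rewrite Hall in HYl. apply Rabs_def2 in HYl. lra.
Qed.

Lemma half_pos (y : R) : 0 < y -> 0 < y / 2.
Proof. lra. Qed.

Lemma ra_half (y : R) : 0 < y -> 2 * ra y = ra (y / 2) + rb (y / 2).
Proof. intros Hy. rewrite <- ra_double by lra. do 2 f_equal. field. Qed.

Lemma rb_half (y : R) : 0 < y -> rb y * rb y = ra (y / 2) * rb (y / 2).
Proof. intros Hy. rewrite <- rb_double by lra. do 2 f_equal; field. Qed.

Lemma ra_ge_rb (y : R) : 0 < y -> rb y <= ra y.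
Proof.
  intros Hy. assert (H1 := ra_half y Hy). assert (H2 := rb_half y Hy).
  assert (H3 := rb_pos y Hy). assert (H4 := ra_ge y Hy).
  set (A := ra (y / 2)) in *. set (B := rb (y / 2)) in *.
  assert (0 <= (A - B) * (A - B)) by apply Rle_0_sqr. nra.
Qed.

(** Equality of the arithmetic and the geometric mean forces equality one halving earlier, so [ra]
    would stay constant along [y / 2^n]. *)
Lemma ra_gt_rb (y : R) : 0 < y -> rb y < ra y.
Proof.
  intros Hy. destruct (ra_ge_rb y Hy) as [|E]; auto. exfalso.
  assert (Hall : forall n, ra (y / 2 ^ n) = ra y /\ rb (y / 2 ^ n) = ra y).
  { induction n as [|n [IH1 IH2]]; [simpl; rewrite Rdiv_1_r; auto|].
    assert (Hn : 0 < y / 2 ^ n) by (apply Rdiv_lt_0_compat; auto; apply pow_lt; lra).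
    assert (H1 := ra_half _ Hn). assert (H2 := rb_half _ Hn).
    replace (y / 2 ^ n / 2) with (y / 2 ^ S n) in *
      by (simpl; field; apply pow_nonzero; lra).
    rewrite IH1 in H1. rewrite IH2 in H2.
    set (A := ra (y / 2 ^ S n)) in *. set (B := rb (y / 2 ^ S n)) in *.
    assert ((A - B) * (A - B) = 0) by nra. assert (A = B) by nra. split; lra. }
  assert (Ha := ra_ge y Hy).
  (* But [y ra y] tends to [1/2] as [y] tends to [0]. *)
  destruct (pow2_large 1 (y * (8 * ra y + 8)) ltac:(lra)) as [N HN].
  specialize (HN N (le_n _)). rewrite Rmult_1_r in HN.
  assert (H2N : 0 < 2 ^ N) by (apply pow_lt; lra).
  set (w := y / 2 ^ N). assert (Hw : 0 < w) by (apply Rdiv_lt_0_compat; auto).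
  assert (Hwb : w * (8 * ra y + 8) <= 1).
  { unfold w. apply Rmult_le_reg_l with (2 ^ N); auto.
    replace (2 ^ N * (y / 2 ^ N * (8 * ra y + 8))) with (y * (8 * ra y + 8)) by (field; lra). lra. }
  assert (Hb := ra_bound w Hw). unfold w in Hb at 2. rewrite (proj1 (Hall N)) in Hb. fold w in Hb.
  apply Rabs_le_between in Hb. nra.
Qed.

Definition rg (y : R) : R := sqrt (ra y * ra y - rb y * rb y).

Lemma rg_sqr (y : R) : 0 < y -> rg y * rg y = ra y * ra y - rb y * rb y.
Proof.
  intros Hy. apply sqrt_sqrt.
  assert (H1 := ra_ge_rb y Hy). assert (H2 := rb_pos y Hy). nra.
Qed.

Lemma rg_pos (y : R) : 0 < y -> 0 < rg y.
Proof.
  intros Hy. apply sqrt_lt_R0. assert (H1 := ra_gt_rb y Hy). assert (H2 := rb_pos y Hy). nra.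
Qed.

Lemma sqr_inj (a b : R) : 0 <= a -> 0 <= b -> a * a = b * b -> a = b.
Proof. intros. apply Rsqr_inj; auto. Qed.

(** The values at [y / 2] are recovered from their two means: half their difference is [rg], with
    the sign decided by [ra_ge_rb]. *)
Lemma ra_halve (y : R) : 0 < y -> ra (y / 2) = ra y + rg y.
Proof.
  intros Hy. assert (H1 := ra_half y Hy). assert (H2 := rb_half y Hy).
  assert (H3 := ra_ge_rb (y / 2) (half_pos y Hy)).
  set (A := ra (y / 2)) in *. set (B := rb (y / 2)) in *.
  assert (E : rg y = (A - B) / 2).
  { apply sqr_inj; [left; apply rg_pos; auto | lra|]. rewrite rg_sqr by auto.
    replace (ra y) with ((A + B) / 2) by lra. rewrite H2. field. }
  lra.
Qed.

Lemma rg_halve (y : R) : 0 < y -> rg (y / 2) * rg (y / 2) = 4 * (ra y * rg y).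
Proof.
  intros Hy. rewrite rg_sqr by lra. rewrite ra_halve by auto.
  assert (H1 := ra_half y Hy). rewrite ra_halve in H1 by auto.
  replace (rb (y / 2)) with (ra y - rg y) by lra. ring.
Qed.

(* Doubling acts on [(ra, rb)], and halving on [(ra, rg)] up to scaling, as one step of the
   arithmetic-geometric mean; comparing the limits of the two sequences identifies [lam]. *)
Lemma agm_scale (y y' lam : R) : 0 < y -> 0 < y' -> 0 < lam ->
  ra y' = lam * ra y -> rb y' = lam * rg y -> lam = y.
Proof.
  intros Hy Hy' Hlam Ha Hb.
  assert (Hall : forall n, ra (2 ^ n * y') = lam * (ra (y / 2 ^ n) / 2 ^ n) /\
                           rb (2 ^ n * y') = lam * (rg (y / 2 ^ n) / 2 ^ n)).
  { induction n as [|n [IH1 IH2]].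
    - simpl. rewrite Rmult_1_l, !Rdiv_1_r. auto.
    - assert (H2n : 0 < 2 ^ n) by (apply pow_lt; lra).
      assert (Hn : 0 < y / 2 ^ n) by (apply Rdiv_lt_0_compat; auto).
      assert (Hn' : 0 < 2 ^ n * y') by nra.
      assert (D1 := ra_double _ Hn'). assert (D2 := rb_double _ Hn').
      assert (E1 := ra_halve _ Hn). assert (E2 := rg_halve _ Hn).
      replace (2 * (2 ^ n * y')) with (2 ^ S n * y') in * by (simpl; ring).
      replace (y / 2 ^ n / 2) with (y / 2 ^ S n) in * by (simpl; field; lra).
      rewrite IH1, IH2 in D1, D2. split.
      + rewrite E1. replace (ra (2 ^ S n * y')) with (/ 2 * (2 * ra (2 ^ S n * y'))) by field.
        rewrite D1. simpl (2 ^ S n). field. lra.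
      + assert (P2 : 0 < 2 ^ S n) by (apply pow_lt; lra).
        assert (Hn2 : 0 < y / 2 ^ S n) by (apply Rdiv_lt_0_compat; auto).
        apply sqr_inj.
        * left. apply rb_pos. nra.
        * apply Rmult_le_pos; [lra|]. left. apply Rdiv_lt_0_compat; auto. apply rg_pos; auto.
        * rewrite D2.
          replace (lam * (rg (y / 2 ^ S n) / 2 ^ S n) * (lam * (rg (y / 2 ^ S n) / 2 ^ S n))) with
            (lam * lam * (rg (y / 2 ^ S n) * rg (y / 2 ^ S n)) / (2 ^ S n * 2 ^ S n)) by (field; lra).
          rewrite E2. simpl. field. lra. }
  (* With [w = y / 2^n] one has [ra (2^n y') = (lam / y) * (w * ra w)], and both [ra (2^n y')] and
     [w * ra w] tend to [1/2]. *)
  assert (E : lam / y - 1 = 0).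
  { apply Rabs_lt_all. intros eps He.
    destruct (ra_lim (eps / 4) ltac:(lra)) as [Y [HY HYl]].
    destruct (pow2_large y' Y Hy') as [N HN].
    destruct (pow2_large 1 (4 * lam / eps) ltac:(lra)) as [N2 HN2].
    set (n := (N + N2)%nat).
    specialize (HYl _ (HN n ltac:(unfold n; lia))). specialize (HN2 n ltac:(unfold n; lia)).
    rewrite (proj1 (Hall n)) in HYl. apply Rabs_def2 in HYl.
    assert (H2n : 0 < 2 ^ n) by (apply pow_lt; lra).
    set (w := y / 2 ^ n) in *. assert (Hw : 0 < w) by (apply Rdiv_lt_0_compat; auto).
    assert (Hb' := ra_bound w Hw). apply Rabs_le_between in Hb'.
    replace (lam * (ra w / 2 ^ n)) with (lam / y * (w * ra w)) in HYl
      by (unfold w; field; split; lra).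
    assert (Hl : 0 < lam / y) by (apply Rdiv_lt_0_compat; auto).
    assert (Hlw : lam / y * w <= eps / 4).
    { replace (lam / y * w) with (lam / 2 ^ n) by (unfold w; field; split; lra).
      apply Rmult_le_reg_r with (2 ^ n); auto. unfold Rdiv at 1.
      rewrite Rmult_assoc, Rinv_l, Rmult_1_r by lra.
      rewrite Rmult_1_r in HN2. apply Rmult_le_compat_l with (r := eps / 4) in HN2; [|lra].
      replace (eps / 4 * (4 * lam / eps)) with lam in HN2 by (field; lra). lra. }
    set (t := lam / y) in *. set (v := w * ra w) in *.
    apply Rabs_le. split; nra. }
  apply Rmult_eq_reg_r with (/ y); [|apply Rinv_neq_0_compat; lra].
  rewrite Rinv_r by lra. unfold Rdiv in E. lra.
Qed.

Lemma Re_minus (a b : C) : Re (a - b) = Re a - Re b.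
Proof. reflexivity. Qed.

(** The sign [eps0] treats [ra] and [rb] at once; the variable is [s = ln y], so that the domain is
    the whole line and the intermediate value theorem applies directly. *)
Lemma Re_continuous_af (s : R) (eps0 : R) : (eps0 = 1 \/ eps0 = -1) ->
  continuity_pt (fun s => Re (af (RtoC (eps0 * exp (- (PI * exp s)))))) s.
Proof.
  intros He0 eps He.
  assert (Hy := exp_pos s). destruct (exp_nome _ Hy) as [Hx0 Hx1].
  assert (Hmod : forall t, Cmod (RtoC (eps0 * t)) = Rabs t).
  { intros t. rewrite Cmod_R, Rabs_mult.
    destruct He0 as [-> | ->]; [rewrite Rabs_R1 | rewrite (Rabs_left (-1)) by lra]; ring. }
  assert (Hlt : Cmod (RtoC (eps0 * exp (- (PI * exp s)))) < 1).
  { rewrite Hmod, Rabs_pos_eq; lra. }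
  destruct (Cder_continuous _ _ _ (Cder_af' _ Hlt) eps He) as [d [Hd HD]].
  assert (Hc : continuity_pt (fun s => exp (- (PI * exp s))) s).
  { apply derivable_continuous_pt. exists (- (PI * exp s) * exp (- (PI * exp s))).
    apply is_derive_Reals. auto_derive; auto. ring. }
  destruct (Hc d Hd) as [d2 [Hd2 H2]].
  exists d2. split; auto. intros t Ht. specialize (H2 t Ht).
  change (Rabs (exp (- (PI * exp t)) - exp (- (PI * exp s))) < d) in H2.
  change (Rabs (Re (af (RtoC (eps0 * exp (- (PI * exp t))))) -
    Re (af (RtoC (eps0 * exp (- (PI * exp s)))))) < eps).
  eapply Rle_lt_trans; [|apply (HD (RtoC (eps0 * exp (- (PI * exp t)))))].
  - rewrite <- Re_minus. apply re_le_Cmod.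
  - rewrite <- RtoC_minus, <- Rmult_minus_distr_l, Hmod. auto.
Qed.

Lemma ratio_surj (v : R) : 0 < v < 1 -> exists y, 0 < y /\ rb y = v * ra y.
Proof.
  intros Hv.
  pose (F := fun s => rb (exp s) / ra (exp s)).
  assert (HF : continuity F).
  { intros s. unfold F. apply continuity_pt_div.
    - apply continuity_pt_ext with (fun s => Re (af (RtoC (-1 * exp (- (PI * exp s)))))).
      + intros t. unfold rb. do 2 f_equal. rewrite RtoC_mult. ring.
      + apply Re_continuous_af; auto.
    - apply continuity_pt_ext with (fun s => Re (af (RtoC (1 * exp (- (PI * exp s)))))).
      + intros t. unfold ra. do 2 f_equal. rewrite RtoC_mult. ring.
      + apply Re_continuous_af; auto.
    - assert (H := ra_ge (exp s) (exp_pos s)). lra. }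
  (* Here [y1 rb(y1) = 2 y1 ra(2 y1) - y1 ra(y1)] is at most [3 y1 / 2] by [ra_bound], while
     [v y1 ra(y1)] is at least [v (1 - y1) / 2 = 4 y1 (1 - y1)]. *)
  set (y1 := v / 8). assert (Hy1 : 0 < y1 < / 8) by (unfold y1; lra).
  assert (H1 : F (ln y1) <= v).
  { unfold F. rewrite exp_ln by lra.
    assert (Ha := ra_ge y1 ltac:(lra)).
    assert (B1 := ra_bound y1 ltac:(lra)). assert (B2 := ra_bound (2 * y1) ltac:(lra)).
    apply Rabs_le_between in B1. apply Rabs_le_between in B2.
    assert (Dd := ra_double y1 ltac:(lra)).
    apply Rmult_le_reg_r with (ra y1); [lra|]. unfold Rdiv.
    rewrite Rmult_assoc, Rinv_l, Rmult_1_r by lra.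
    replace (rb y1) with (2 * ra (2 * y1) - ra y1) by lra.
    apply Rmult_le_reg_l with y1; [lra|].
    assert (y1 * ra (2 * y1) * 2 <= / 2 + y1) by lra.
    assert (/ 2 - y1 / 2 <= y1 * ra y1) by lra.
    assert (y1 = v / 8) by auto. nra. }
  destruct (ra_lim ((1 - v) / 8) ltac:(lra)) as [Y1 [HY1 L1]].
  destruct (rb_lim ((1 - v) / 8) ltac:(lra)) as [Y2 [HY2 L2]].
  set (y2 := Rmax Y1 Y2).
  assert (Hy2 : 0 < y2) by (eapply Rlt_le_trans; [apply HY1 | apply Rmax_l]).
  specialize (L1 y2 (Rmax_l _ _)). specialize (L2 y2 (Rmax_r _ _)).
  assert (H2 : v <= F (ln y2)).
  { unfold F. rewrite exp_ln by lra.
    assert (Ha := ra_ge y2 Hy2).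
    apply Rabs_def2 in L1. apply Rabs_def2 in L2.
    apply Rmult_le_reg_r with (ra y2); [lra|]. unfold Rdiv.
    rewrite Rmult_assoc, Rinv_l, Rmult_1_r by lra. nra. }
  destruct (IVT_gen F (ln y1) (ln y2) v HF) as [s [_ Hs]].
  { rewrite Rmin_left, Rmax_right by lra. lra. }
  exists (exp s). split; [apply exp_pos|]. rewrite <- Hs. unfold F.
  assert (Ha := ra_ge (exp s) (exp_pos s)). field. lra.
Qed.

(** A point [y'] is chosen where [rb / ra] takes the value [rg y / ra y]. Then the pair at [y'] is
    proportional to [(ra, rg)] at [y] and, by the quadratic relation, conversely; [agm_scale] in
    both directions gives the factor [y] and [y' = / y]. *)
Theorem ra_inversion (y : R) : 0 < y -> ra (/ y) = y * ra y /\ rb (/ y) = y * rg y.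
Proof.
  intros Hy. assert (Ha := ra_ge y Hy). assert (Hb := rb_pos y Hy).
  assert (Hg := rg_pos y Hy). assert (Hg2 := rg_sqr y Hy).
  destruct (ratio_surj (rg y / ra y)) as [y' [Hy' E]].
  { split; [apply Rdiv_lt_0_compat; lra|].
    apply Rmult_lt_reg_r with (ra y); [lra|]. unfold Rdiv.
    rewrite Rmult_assoc, Rinv_l by lra. nra. }
  assert (Ha' := ra_ge y' Hy').
  set (lam := ra y' / ra y).
  assert (Hlam : 0 < lam) by (apply Rdiv_lt_0_compat; lra).
  assert (E1 : ra y' = lam * ra y) by (unfold lam; field; lra).
  assert (E2 : rb y' = lam * rg y) by (rewrite E; unfold lam; field; lra).
  assert (L1 : lam = y) by (apply (agm_scale y y' lam); auto).
  assert (E3 : rg y' = lam * rb y).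
  { apply sqr_inj; [left; apply rg_pos; auto | nra|].
    rewrite rg_sqr by auto. rewrite E1, E2.
    replace (lam * rg y * (lam * rg y)) with (lam * lam * (rg y * rg y)) by ring.
    rewrite Hg2. ring. }
  assert (L2 : / lam = y').
  { apply (agm_scale y' y (/ lam)); auto.
    - apply Rinv_0_lt_compat; auto.
    - rewrite E1. field. lra.
    - rewrite E3. field. lra. }
  rewrite L1 in E1, E2, L2. rewrite L2. auto.
Qed.

Lemma q2_imag (y : R) : q_ 2 (Ci * y) = RtoC (exp (- (PI * y))).
Proof.
  unfold q_. replace (2 * PI * Ci * (Ci * y) / CN 2)%C with (RtoC (- (PI * y))).
  - unfold Cexp, RtoC. simpl. rewrite cos_0, sin_0. f_equal; ring.
  - rewrite CN_2, RtoC_opp, RtoC_mult.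
    replace (2 * PI * Ci * (Ci * y) / 2)%C with (Ci * Ci * (PI * y))%C by field.
    replace (Ci * Ci)%C with (RtoC (-1)); [ring|].
    unfold Cmult, Ci, RtoC. simpl. f_equal; ring.
Qed.

Lemma upper_imag (y : R) : 0 < y -> upper (Ci * y)%C.
Proof. intros Hy. unfold upper. simpl. lra. Qed.

Lemma az_imag (y : R) : 0 < y -> az (Ci * y) = RtoC (ra y * ra y).
Proof. intros Hy. unfold az, Ls. rewrite q2_imag, af_ra, RtoC_mult; auto. Qed.

Lemma bz_imag (y : R) : 0 < y -> bz (Ci * y) = RtoC (rb y * rb y).
Proof. intros Hy. unfold bz, Ls. rewrite q2_imag, af_rb, RtoC_mult; auto. Qed.

Lemma az_inv_imag (y : R) : 0 < y -> az (Ci * (/ y)%R) = (y * y * az (Ci * y))%C.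
Proof.
  intros Hy. assert (Hi := Rinv_0_lt_compat y Hy). rewrite !az_imag by auto.
  rewrite (proj1 (ra_inversion y Hy)), !RtoC_mult. ring.
Qed.

(** At the fixed point [y = 1] the inversion says [rb = rg], and [rg^2 = ra^2 - rb^2]. *)
Lemma az_Ci : az Ci = (2 * bz Ci)%C.
Proof.
  replace Ci with (Ci * 1)%C by ring. rewrite az_imag, bz_imag by lra.
  assert (H := proj2 (ra_inversion 1 ltac:(lra))). rewrite Rinv_1, Rmult_1_l in H.
  assert (H2 := rg_sqr 1 ltac:(lra)). rewrite <- H in H2.
  rewrite <- RtoC_mult. f_equal. lra.
Qed.

(** The function [F] vanishes on the imaginary axis and is complex differentiable at [i], so its
    derivative there is 0. Since [i] is fixed by [z -> -1/z], this derivative involves only values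
    at [i] and can be solved for [Pz]. *)
Lemma Pz_Ci : Pz Ci = (2 * az Ci + / PI)%C.
Proof.
  assert (Hup : upper Ci) by (unfold upper; simpl; lra).
  pose (F := fun z => (az (- / z) + z * z * az z)%C).
  set (a := az Ci). set (d := (ipi * (2 * a * (Pz Ci / 4 - bz Ci)))%C).
  assert (HaC : Cder az Ci d) by (apply Cder_az; auto).
  assert (EC : (- / Ci)%C = Ci) by (rewrite Ci_inv; ring).
  assert (ECC : (Ci * Ci)%C = RtoC (-1)) by (unfold Cmult, Ci, RtoC; simpl; f_equal; ring).
  assert (HF : Cder F Ci (- 2 * d + 2 * Ci * a)%C).
  { eapply Cder_eq.
    - apply Cder_plus.
      + apply (Cder_comp az (fun z => (- / z)%C)); [rewrite EC; apply HaC|].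
        apply Cder_opp, Cder_inv, Ci_nz.
      + apply Cder_mult; [apply Cder_sqr | apply HaC].
    - cbv beta. fold a. rewrite ECC. field. }
  assert (HF0 : forall y, 0 < y -> F (Ci * y)%C = RtoC 0).
  { intros y Hy. unfold F.
    assert (Hyn : RtoC y <> RtoC 0) by (intros E; apply RtoC_inj in E; lra).
    replace (- / (Ci * y))%C with (Ci * (/ y)%R)%C.
    - rewrite az_inv_imag by auto.
      replace (Ci * y * (Ci * y))%C with (Ci * Ci * (y * y))%C by ring. rewrite ECC. ring.
    - rewrite RtoC_inv by lra.
      replace (/ (Ci * y))%C with (/ Ci * / y)%C by (field; split; auto; apply Ci_nz).
      rewrite Ci_inv. ring. }
  assert (Hl : (- 2 * d + 2 * Ci * a)%C = RtoC 0).
  { apply Cmod_eq_0. apply Rle_antisym; [|apply Cmod_ge_0].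
    apply Rnot_lt_le. intros Hpos. set (l := (- 2 * d + 2 * Ci * a)%C) in *.
    destruct (Cder_elim _ _ _ HF (Cmod l / 2) ltac:(lra)) as [dd [Hdd HD]].
    set (h := Rmin 1 (dd / 2)). assert (Hh : 0 < h) by (apply Rmin_pos; lra).
    assert (Hh2 : h <= dd / 2) by apply Rmin_r.
    specialize (HD (Ci * (1 + h)%R)%C).
    replace (Ci * (1 + h)%R - Ci)%C with (Ci * h)%C in HD by (rewrite RtoC_plus; ring).
    assert (Em : Cmod (Ci * h) = h) by (rewrite Cmod_mult, Cmod_Ci, Cmod_R, Rabs_pos_eq; lra).
    rewrite Em in HD. specialize (HD ltac:(lra)).
    rewrite HF0 in HD by lra.
    replace (F Ci) with (F (Ci * 1)%C) in HD by (f_equal; ring). rewrite HF0 in HD by lra.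
    replace (0 - 0 - Ci * h * l)%C with (- (Ci * h * l))%C in HD by ring.
    rewrite Cmod_opp, Cmod_mult, Em in HD. nra. }
  assert (Ha : a <> RtoC 0).
  { unfold a. replace Ci with (Ci * 1)%C by ring. rewrite az_imag by lra.
    assert (H := ra_ge 1 ltac:(lra)). intros E. apply RtoC_inj in E. nra. }
  assert (Hb : bz Ci = (a / 2)%C) by (unfold a; rewrite az_Ci; field).
  unfold d in Hl. rewrite Hb in Hl.
  replace (Pz Ci) with (2 * a + / PI -
    (-2 * (ipi * (2 * a * (Pz Ci / 4 - a / 2))) + 2 * Ci * a) / (2 * PI * Ci * a))%C.
  2:{ unfold ipi. field. repeat split; auto; [apply Ci_nz | apply PI_nz]. }
  rewrite Hl. unfold Cdiv. ring.
Qed.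

(** * Inversion on the upper half plane *)

(** Derivative along a real parameter, taken by components so that the real mean value theorem is
    available. *)
Definition rder (F : R -> C) (s : R) (l : C) : Prop :=
  is_derive (fun t => Re (F t)) s (Re l) /\ is_derive (fun t => Im (F t)) s (Im l).

Lemma Re_path (f : C -> C) (z0 v l : C) (s : R) : Cder f (z0 + s * v)%C l ->
  is_derive (fun t : R => Re (f (z0 + t * v)%C)) s (Re (v * l)).
Proof.
  intros H. apply is_derive_Reals. intros eps He.
  assert (Hv := Cmod_ge_0 v).
  destruct (Cder_elim _ _ _ H (eps / (2 * (Cmod v + 1)))) as [d [Hd HD]].
  { apply Rdiv_lt_0_compat; lra. }
  assert (Hp : 0 < d / (Cmod v + 1)) by (apply Rdiv_lt_0_compat; lra).
  exists (mkposreal _ Hp). intros h Hh Hhd. simpl in Hhd.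
  specialize (HD (z0 + (s + h)%R * v)%C).
  replace (z0 + (s + h)%R * v - (z0 + s * v))%C with (h * v)%C in HD by (rewrite RtoC_plus; ring).
  rewrite Cmod_mult, Cmod_R in HD.
  assert (Hd2 : Rabs h * (Cmod v + 1) < d).
  { apply Rmult_lt_compat_r with (r := Cmod v + 1) in Hhd; [|lra].
    replace (d / (Cmod v + 1) * (Cmod v + 1)) with d in Hhd by (field; lra). auto. }
  assert (Hah := Rabs_pos h). specialize (HD ltac:(nra)).
  assert (Hah2 := Rabs_pos_lt h Hh).
  set (E := (f (z0 + (s + h)%R * v) - f (z0 + s * v) - h * v * l)%C) in *.
  replace ((Re (f (z0 + (s + h)%R * v)%C) - Re (f (z0 + s * v)%C)) / h - Re (v * l)) with (Re E / h).
  2:{ replace (Re E) with (Re (f (z0 + (s + h)%R * v)%C) - Re (f (z0 + s * v)%C) - h * Re (v * l)).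
      - field. auto.
      - unfold E. rewrite !Re_minus. f_equal. unfold Re, Cmult, RtoC. simpl. ring. }
  unfold Rdiv. rewrite Rabs_mult, Rabs_inv.
  assert (HE := re_le_Cmod E).
  apply Rmult_lt_reg_r with (Rabs h); auto. rewrite Rmult_assoc, Rinv_l, Rmult_1_r by lra.
  assert (H2 : eps / (2 * (Cmod v + 1)) * (Rabs h * Cmod v) <= eps / 2 * Rabs h).
  { replace (eps / (2 * (Cmod v + 1)) * (Rabs h * Cmod v)) with
      (eps / 2 * Rabs h * (Cmod v / (Cmod v + 1))) by (field; lra).
    rewrite <- (Rmult_1_r (eps / 2 * Rabs h)) at 2.
    apply Rmult_le_compat_l; [nra|].
    apply Rmult_le_reg_r with (Cmod v + 1); [lra|]. unfold Rdiv.
    rewrite Rmult_assoc, Rinv_l by lra. lra. }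
  nra.
Qed.

Lemma rder_path (f : C -> C) (z0 v l : C) (s : R) : Cder f (z0 + s * v)%C l ->
  rder (fun t => f (z0 + t * v)%C) s (v * l)%C.
Proof.
  intros H. split; [apply Re_path, H|].
  assert (H2 := Re_path _ z0 v _ s (Cder_scal (- Ci) _ _ _ H)).
  apply is_derive_ext with (fun t : R => Re (- Ci * f (z0 + t * v))%C).
  - intros t. unfold Ci. simpl. destruct (f _) as [x y]. simpl. ring.
  - replace (Im (v * l)) with (Re (v * (- Ci * l))); auto.
    unfold Ci. destruct v, l. simpl. ring.
Qed.

Definition nrm (F : R -> C) (s : R) : R := Re (F s) * Re (F s) + Im (F s) * Im (F s).

Lemma nrm_Cmod F s : nrm F s = Cmod (F s) * Cmod (F s).
Proof. unfold nrm. assert (H := Cmod2_alt (F s)). simpl in H. lra. Qed.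

Lemma nrm_der F s l : rder F s l ->
  is_derive (nrm F) s (2 * (Re (F s) * Re l + Im (F s) * Im l)).
Proof.
  intros [H1 H2]. unfold nrm.
  replace (2 * (Re (F s) * Re l + Im (F s) * Im l)) with
    ((Re l * Re (F s) + Re (F s) * Re l) + (Im l * Im (F s) + Im (F s) * Im l)) by ring.
  apply @is_derive_plus; apply Derive.is_derive_mult; auto.
Qed.

Lemma dot_le (x y : C) : Re x * Re y + Im x * Im y <= Cmod x * Cmod y.
Proof.
  replace (Re x * Re y + Im x * Im y) with (Re (x * Cconj y)).
  - eapply Rle_trans; [apply Rle_abs|]. eapply Rle_trans; [apply re_le_Cmod|].
    rewrite Cmod_mult, Cmod_conj. lra.
  - destruct x, y. unfold Cconj. simpl. ring.
Qed.

Lemma path_bounded (F : R -> C) : (forall s, 0 <= s <= 1 -> exists l, rder F s l) ->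
  exists M, 0 <= M /\ forall s, 0 <= s <= 1 -> Cmod (F s) <= M.
Proof.
  intros H. destruct (continuity_ab_maj (nrm F) 0 1 ltac:(lra)) as [m [Hm _]].
  - intros s Hs. destruct (H s Hs) as [l Hl].
    apply derivable_continuous_pt. eexists. apply is_derive_Reals. apply nrm_der, Hl.
  - exists (nrm F m + 1). assert (H0 : forall s, 0 <= nrm F s).
    { intros s. rewrite nrm_Cmod. apply Rle_0_sqr. }
    split; [specialize (H0 m); lra|]. intros s Hs. specialize (Hm s Hs).
    rewrite nrm_Cmod in Hm at 1. assert (H1 := Cmod_ge_0 (F s)). nra.
Qed.

(** The sum of the three squared moduli grows at rate at most [6 K]: a factor 2 from differentiating
    squares and a factor 3 from [(x1 + x2 + x3)^2 <= 3 (x1^2 + x2^2 + x3^2)]. Weighted by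
    [exp (- 6 K s)] it decreases from 0. *)
Lemma gronwall3 (F1 F2 F3 G1 G2 G3 : R -> C) (K : R) : 0 <= K ->
  (forall s, 0 <= s <= 1 -> rder F1 s (G1 s) /\ rder F2 s (G2 s) /\ rder F3 s (G3 s)) ->
  (forall s, 0 <= s <= 1 -> let N := Cmod (F1 s) + Cmod (F2 s) + Cmod (F3 s) in
     Cmod (G1 s) <= K * N /\ Cmod (G2 s) <= K * N /\ Cmod (G3 s) <= K * N) ->
  F1 0 = RtoC 0 -> F2 0 = RtoC 0 -> F3 0 = RtoC 0 ->
  F1 1 = RtoC 0 /\ F2 1 = RtoC 0 /\ F3 1 = RtoC 0.
Proof.
  intros HK HF HG Z1 Z2 Z3.
  set (c := 6 * K).
  pose (N := fun s => (nrm F1 s + nrm F2 s + nrm F3 s) * exp (- (c * s))).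
  pose (dN := fun s => (2 * (Re (F1 s) * Re (G1 s) + Im (F1 s) * Im (G1 s)) +
    2 * (Re (F2 s) * Re (G2 s) + Im (F2 s) * Im (G2 s)) +
    2 * (Re (F3 s) * Re (G3 s) + Im (F3 s) * Im (G3 s))) * exp (- (c * s)) +
    (nrm F1 s + nrm F2 s + nrm F3 s) * (- c * exp (- (c * s)))).
  assert (HN : forall s, 0 <= s <= 1 -> is_derive N s (dN s)).
  { intros s Hs. destruct (HF s Hs) as [D1 [D2 D3]].
    apply (Derive.is_derive_mult (fun s => nrm F1 s + nrm F2 s + nrm F3 s)
      (fun s => exp (- (c * s)))).
    - apply @is_derive_plus; [apply @is_derive_plus|]; apply nrm_der; auto.
    - auto_derive; auto. ring. }
  assert (HdN : forall s, 0 <= s <= 1 -> dN s <= 0).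
  { intros s Hs. destruct (HG s Hs) as [B1 [B2 B3]].
    set (x1 := Cmod (F1 s)) in *. set (x2 := Cmod (F2 s)) in *. set (x3 := Cmod (F3 s)) in *.
    assert (P1 : 0 <= x1) by apply Cmod_ge_0. assert (P2 : 0 <= x2) by apply Cmod_ge_0.
    assert (P3 : 0 <= x3) by apply Cmod_ge_0.
    assert (E1 := dot_le (F1 s) (G1 s)). assert (E2 := dot_le (F2 s) (G2 s)).
    assert (E3 := dot_le (F3 s) (G3 s)). fold x1 in E1. fold x2 in E2. fold x3 in E3.
    unfold dN. rewrite !nrm_Cmod. fold x1 x2 x3.
    assert (He := exp_pos (- (c * s))). set (e := exp (- (c * s))) in *.
    assert (X1 : x1 * Cmod (G1 s) <= x1 * (K * (x1 + x2 + x3))) by (apply Rmult_le_compat_l; auto).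
    assert (X2 : x2 * Cmod (G2 s) <= x2 * (K * (x1 + x2 + x3))) by (apply Rmult_le_compat_l; auto).
    assert (X3 : x3 * Cmod (G3 s) <= x3 * (K * (x1 + x2 + x3))) by (apply Rmult_le_compat_l; auto).
    set (t := 2 * (Re (F1 s) * Re (G1 s) + Im (F1 s) * Im (G1 s)) +
      2 * (Re (F2 s) * Re (G2 s) + Im (F2 s) * Im (G2 s)) +
      2 * (Re (F3 s) * Re (G3 s) + Im (F3 s) * Im (G3 s))) in *.
    assert (Ht : t <= c * (x1 * x1 + x2 * x2 + x3 * x3)).
    { assert (Hq : (x1 + x2 + x3) * (x1 + x2 + x3) <= 3 * (x1 * x1 + x2 * x2 + x3 * x3)).
      { assert (0 <= (x1 - x2) * (x1 - x2)) by apply Rle_0_sqr.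
        assert (0 <= (x1 - x3) * (x1 - x3)) by apply Rle_0_sqr.
        assert (0 <= (x3 - x2) * (x3 - x2)) by apply Rle_0_sqr. nra. }
      assert (Ht1 : t <= 2 * K * ((x1 + x2 + x3) * (x1 + x2 + x3))) by (unfold t; nra).
      unfold c. assert (2 * K * ((x1 + x2 + x3) * (x1 + x2 + x3)) <=
        2 * K * (3 * (x1 * x1 + x2 * x2 + x3 * x3))) by (apply Rmult_le_compat_l; lra). nra. }
    replace (t * e + (x1 * x1 + x2 * x2 + x3 * x3) * (- c * e)) with
      (- ((c * (x1 * x1 + x2 * x2 + x3 * x3) - t) * e)) by ring.
    assert (0 <= (c * (x1 * x1 + x2 * x2 + x3 * x3) - t) * e); [|lra].
    apply Rmult_le_pos; lra. }
  destruct (MVT_gen N 0 1 dN) as [s [Hs E]].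
  - rewrite Rmin_left, Rmax_right by lra. intros s Hs. apply HN. lra.
  - rewrite Rmin_left, Rmax_right by lra. intros s Hs.
    apply derivable_continuous_pt. eexists. apply is_derive_Reals. apply HN; auto.
  - rewrite Rmin_left, Rmax_right in Hs by lra. specialize (HdN s Hs).
    assert (E0 : N 0 = 0).
    { unfold N. rewrite !nrm_Cmod, Z1, Z2, Z3, Cmod_0. ring. }
    assert (E1 : N 1 <= 0) by lra.
    unfold N in E1. assert (He := exp_pos (- (c * 1))). rewrite !nrm_Cmod in E1.
    assert (Q1 : 0 <= Cmod (F1 1) * Cmod (F1 1)) by apply Rle_0_sqr.
    assert (Q2 : 0 <= Cmod (F2 1) * Cmod (F2 1)) by apply Rle_0_sqr.
    assert (Q3 : 0 <= Cmod (F3 1) * Cmod (F3 1)) by apply Rle_0_sqr.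
    assert (Hs0 : Cmod (F1 1) * Cmod (F1 1) + Cmod (F2 1) * Cmod (F2 1) +
      Cmod (F3 1) * Cmod (F3 1) <= 0).
    { apply Rmult_le_reg_r with (exp (- (c * 1))); auto. lra. }
    repeat split; apply Cmod_eq_0; nra.
Qed.

Lemma upper_nz (z : C) : upper z -> z <> RtoC 0.
Proof. intros H E. subst. unfold upper in H. simpl in H. lra. Qed.

Lemma upper_inv (z : C) : upper z -> upper (- / z)%C.
Proof.
  intros H. unfold upper in *. destruct z as [x y]. simpl in *.
  replace (- (- y / (x * (x * 1) + y * (y * 1)))) with (y / (x * x + y * y)) by (field; nra).
  apply Rdiv_lt_0_compat; nra.
Qed.

(* The images of [az], [bz], [Pz] under inversion, arranged so as to satisfy the same system. *)
Definition uS (z : C) : C := (- az (- / z) / (z * z))%C.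
Definition vS (z : C) : C := (uS z + bz (- / z) / (z * z))%C.
Definition wS (z : C) : C := (Pz (- / z) / (z * z) - 4 / ipi * / z + 4 * uS z)%C.

Lemma Cder_inv_comp f (z l : C) : z <> RtoC 0 -> Cder f (- / z)%C l ->
  Cder (fun z => (f (- / z) / (z * z))%C) z (l / (z * z * (z * z)) - 2 * f (- / z)%C / (z * z * z))%C.
Proof.
  intros Hz H. eapply Cder_eq.
  - apply Cder_mult.
    + apply (Cder_comp f (fun z => (- / z)%C)); [apply H|]. apply Cder_opp, Cder_inv, Hz.
    + apply (Cder_comp Cinv (fun z => (z * z)%C)); [|apply Cder_sqr].
      apply Cder_inv. apply Cmult_neq_0; auto.
  - cbv beta. field. auto.
Qed.

Lemma Cder_uS (z : C) : upper z -> Cder uS z (ipi * (2 * uS z * (wS z / 4 - vS z)))%C.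
Proof.
  intros Hz. assert (Hz0 := upper_nz z Hz). assert (Hi := ipi_nz).
  apply Cder_ext with (fun z => (-1 * (az (- / z) / (z * z)))%C).
  { intros y. unfold uS, Cdiv. ring. }
  eapply Cder_eq.
  - apply Cder_scal. apply Cder_inv_comp; auto. apply Cder_az, upper_inv, Hz.
  - unfold wS, vS, uS. field. auto.
Qed.

Lemma Cder_vS (z : C) : upper z -> Cder vS z (ipi * (2 * vS z * (wS z / 4 - uS z)))%C.
Proof.
  intros Hz. assert (Hz0 := upper_nz z Hz). assert (Hi := ipi_nz).
  eapply Cder_eq.
  - apply Cder_plus; [apply Cder_uS; auto|]. apply Cder_inv_comp; auto.
    apply Cder_bz, upper_inv, Hz.
  - unfold wS, vS, uS. field. auto.
Qed.

Lemma Cder_wS (z : C) : upper z -> Cder wS z (ipi * ((wS z * wS z - 16 * (uS z * vS z)) / 4))%C.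
Proof.
  intros Hz. assert (Hz0 := upper_nz z Hz). assert (Hi := ipi_nz).
  eapply Cder_eq.
  - apply Cder_plus; [|apply Cder_scal, Cder_uS; auto].
    apply Cder_minus; [apply Cder_inv_comp; auto; apply Cder_Pz, upper_inv, Hz|].
    apply Cder_scal, Cder_inv, Hz0.
  - unfold wS, vS, uS. field. auto.
Qed.

Lemma S_agree_Ci : uS Ci = az Ci /\ vS Ci = bz Ci /\ wS Ci = Pz Ci.
Proof.
  assert (EC : (- / Ci)%C = Ci) by (rewrite Ci_inv; ring).
  assert (ECC : (Ci * Ci)%C = RtoC (-1)) by (unfold Cmult, Ci, RtoC; simpl; f_equal; ring).
  assert (Hu : uS Ci = az Ci) by (unfold uS; rewrite EC, ECC; field).
  split; auto. split.
  - unfold vS. rewrite Hu, EC, ECC, az_Ci. field.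
  - unfold wS. rewrite Hu, EC, ECC, Pz_Ci. unfold ipi.
    replace (4 / (2 * PI * Ci) * / Ci)%C with (4 / (2 * PI * (Ci * Ci)))%C.
    + rewrite ECC. field. apply PI_nz.
    + field. split; [apply Ci_nz | apply PI_nz].
Qed.


(** The three differences vanish at [i] and obey a linear system whose coefficients are values of
    the functions themselves, bounded on the segment from [i] to [z] by compactness; [gronwall3]
    carries the zero to [z]. *)
Lemma S_agree (z : C) : upper z -> uS z = az z /\ vS z = bz z.
Proof.
  intros Hz. set (V := (z - Ci)%C).
  assert (Hup : forall s, 0 <= s <= 1 -> upper (Ci + s * V)%C).
  { intros s Hs. unfold upper in *. unfold V. destruct z as [x y]. simpl in *. nra. }
  pose (pt := fun s : R => (Ci + s * V)%C).
  assert (Hbd : forall f : C -> C, (forall w, upper w -> cdiff f w) ->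
    exists M, 0 <= M /\ forall s, 0 <= s <= 1 -> Cmod (f (pt s)) <= M).
  { intros f Hf. apply (path_bounded (fun s => f (pt s))). intros s Hs.
    destruct (Hf _ (Hup s Hs)) as [l Hl]. exists (V * l)%C. apply (rder_path f Ci V l s Hl). }
  destruct (Hbd az) as [M1 [P1 B1]]; [intros; eexists; apply Cder_az; auto|].
  destruct (Hbd bz) as [M2 [P2 B2]]; [intros; eexists; apply Cder_bz; auto|].
  destruct (Hbd Pz) as [M3 [P3 B3]]; [intros; eexists; apply Cder_Pz; auto|].
  destruct (Hbd vS) as [M4 [P4 B4]]; [intros; eexists; apply Cder_vS; auto|].
  destruct (Hbd wS) as [M5 [P5 B5]]; [intros; eexists; apply Cder_wS; auto|].
  set (M := M1 + M2 + M3 + M4 + M5).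
  set (K := Cmod (V * ipi) * (8 * M)).
  pose (D1 := fun w => (az w - uS w)%C). pose (D2 := fun w => (bz w - vS w)%C).
  pose (D3 := fun w => (Pz w - wS w)%C).
  (* The differences of the quadratic right-hand sides, made linear in [D1], [D2], [D3] by
     [a b - u v = a (b - v) + v (a - u)]. *)
  pose (H1 := fun w => ((az w * D3 w + wS w * D1 w) / 2 - 2 * (az w * D2 w + vS w * D1 w))%C).
  pose (H2 := fun w => ((bz w * D3 w + wS w * D2 w) / 2 - 2 * (az w * D2 w + vS w * D1 w))%C).
  pose (H3 := fun w => (((Pz w + wS w) * D3 w) / 4 - 4 * (az w * D2 w + vS w * D1 w))%C).
  destruct S_agree_Ci as [A1 [A2 A3]].
  assert (E0 : pt 0 = Ci) by (unfold pt; ring).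
  assert (E1 : pt 1 = z) by (unfold pt, V; ring).
  destruct (gronwall3 (fun s => D1 (pt s)) (fun s => D2 (pt s)) (fun s => D3 (pt s))
    (fun s => (V * (ipi * H1 (pt s)))%C) (fun s => (V * (ipi * H2 (pt s)))%C)
    (fun s => (V * (ipi * H3 (pt s)))%C) K) as [R1 [R2 _]].
  - unfold K, M. apply Rmult_le_pos; [apply Cmod_ge_0 | lra].
  - intros s Hs. assert (Hu := Hup s Hs). fold (pt s) in Hu.
    split; [|split]; apply (rder_path _ Ci V); fold (pt s).
    + eapply Cder_eq; [apply Cder_minus; [apply Cder_az | apply Cder_uS]; auto|].
      unfold H1, D1, D2, D3. field.
    + eapply Cder_eq; [apply Cder_minus; [apply Cder_bz | apply Cder_vS]; auto|].
      unfold H2, D1, D2, D3. field.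
    + eapply Cder_eq; [apply Cder_minus; [apply Cder_Pz | apply Cder_wS]; auto|].
      unfold H3, D1, D2, D3. field.
  - intros s Hs. cbv zeta.
    specialize (B1 s Hs). specialize (B2 s Hs). specialize (B3 s Hs).
    specialize (B4 s Hs). specialize (B5 s Hs).
    set (d1 := D1 (pt s)) in *. set (d2 := D2 (pt s)) in *. set (d3 := D3 (pt s)) in *.
    assert (Q1 := Cmod_ge_0 d1). assert (Q2 := Cmod_ge_0 d2). assert (Q3 := Cmod_ge_0 d3).
    assert (Hb : forall c d, Cmod c <= M -> Cmod (c * d) <= M * Cmod d).
    { intros c d Hc. rewrite Cmod_mult. apply Rmult_le_compat_r; auto. apply Cmod_ge_0. }
    assert (Ha : Cmod (az (pt s) * d2 + vS (pt s) * d1) <= M * Cmod d2 + M * Cmod d1).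
    { eapply Rle_trans; [apply Cmod_triangle|].
      apply Rplus_le_compat; apply Hb; unfold M; lra. }
    assert (Hn2 : Cmod (- (2)) = 2) by (rewrite Cmod_opp, Cmod_R, Rabs_pos_eq; lra).
    assert (Hn4 : Cmod (- (4)) = 4) by (rewrite Cmod_opp, Cmod_R, Rabs_pos_eq; lra).
    assert (Hh2 : Cmod (/ 2) = / 2) by (rewrite <- RtoC_inv, Cmod_R, Rabs_pos_eq; lra).
    assert (Hh4 : Cmod (/ 4) = / 4) by (rewrite <- RtoC_inv, Cmod_R, Rabs_pos_eq; lra).
    assert (HVi : 0 <= Cmod (V * ipi)) by apply Cmod_ge_0.
    assert (HM : 0 <= M) by (unfold M; lra).
    assert (T1 : 0 <= M * Cmod d1) by (apply Rmult_le_pos; auto).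
    assert (T2 : 0 <= M * Cmod d2) by (apply Rmult_le_pos; auto).
    assert (T3 : 0 <= M * Cmod d3) by (apply Rmult_le_pos; auto).
    assert (Hfin : forall H, Cmod H <= 8 * M * (Cmod d1 + Cmod d2 + Cmod d3) ->
      Cmod (V * (ipi * H)) <= K * (Cmod d1 + Cmod d2 + Cmod d3)).
    { intros H HH. replace (V * (ipi * H))%C with ((V * ipi) * H)%C by ring.
      rewrite Cmod_mult. unfold K. rewrite Rmult_assoc. apply Rmult_le_compat_l; auto. }
    split; [|split]; apply Hfin.
    + replace (H1 (pt s)) with (/ 2 * (az (pt s) * d3 + wS (pt s) * d1) +
        (- (2)) * (az (pt s) * d2 + vS (pt s) * d1))%C by (unfold H1, d1, d2, d3; field).
      eapply Rle_trans; [apply Cmod_triangle|].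
      rewrite (Cmod_mult (/ 2)), (Cmod_mult (- (2))), Hn2, Hh2.
      assert (Cmod (az (pt s) * d3 + wS (pt s) * d1) <= M * Cmod d3 + M * Cmod d1); [|lra].
      eapply Rle_trans; [apply Cmod_triangle|].
      apply Rplus_le_compat; apply Hb; unfold M; lra.
    + replace (H2 (pt s)) with (/ 2 * (bz (pt s) * d3 + wS (pt s) * d2) +
        (- (2)) * (az (pt s) * d2 + vS (pt s) * d1))%C by (unfold H2, d1, d2, d3; field).
      eapply Rle_trans; [apply Cmod_triangle|].
      rewrite (Cmod_mult (/ 2)), (Cmod_mult (- (2))), Hn2, Hh2.
      assert (Cmod (bz (pt s) * d3 + wS (pt s) * d2) <= M * Cmod d3 + M * Cmod d2); [|lra].
      eapply Rle_trans; [apply Cmod_triangle|].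
      apply Rplus_le_compat; apply Hb; unfold M; lra.
    + replace (H3 (pt s)) with (/ 4 * (Pz (pt s) * d3 + wS (pt s) * d3) +
        (- (4)) * (az (pt s) * d2 + vS (pt s) * d1))%C by (unfold H3, d1, d2, d3; field).
      eapply Rle_trans; [apply Cmod_triangle|].
      rewrite (Cmod_mult (/ 4)), (Cmod_mult (- (4))), Hn4, Hh4.
      assert (Cmod (Pz (pt s) * d3 + wS (pt s) * d3) <= M * Cmod d3 + M * Cmod d3); [|lra].
      eapply Rle_trans; [apply Cmod_triangle|].
      apply Rplus_le_compat; apply Hb; unfold M; lra.
  - cbv beta. unfold D1. rewrite E0, A1. ring.
  - cbv beta. unfold D2. rewrite E0, A2. ring.
  - cbv beta. unfold D3. rewrite E0, A3. ring.
  - cbv beta in R1, R2. rewrite E1 in R1, R2. unfold D1 in R1. unfold D2 in R2. split.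
    + replace (uS z) with (az z - (az z - uS z))%C by ring. rewrite R1. ring.
    + replace (vS z) with (bz z - (bz z - vS z))%C by ring. rewrite R2. ring.
Qed.

Theorem az_S (z : C) : upper z -> az (- / z) = (- (z * z) * az z)%C.
Proof.
  intros Hz. assert (Hz0 := upper_nz z Hz). destruct (S_agree z Hz) as [H _].
  rewrite <- H. unfold uS. field. auto.
Qed.

Theorem bz_S (z : C) : upper z -> bz (- / z) = (- (z * z) * (az z - bz z))%C.
Proof.
  intros Hz. assert (Hz0 := upper_nz z Hz). destruct (S_agree z Hz) as [H1 H2].
  rewrite <- H1, <- H2. unfold vS, uS. field. auto.
Qed.

(** * Slash action *)

(** The slash action on bare integer entries, so that the Euclidean recursion need not rebuild
    determinant proofs. *)
Definition sl (k : nat) (f : C -> C) (a b c d : Z) (z : C) : C :=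
  (f ((CZ a * z + CZ b) / (CZ c * z + CZ d)) / (CZ c * z + CZ d) ^ k)%C.

Lemma upper_add_Z (z : C) n : upper z -> upper (z + CZ n)%C.
Proof. unfold upper. intros H. destruct z as [x y]. simpl in *. lra. Qed.

Lemma upper_add_1 (z : C) : upper z -> upper (z + 1)%C.
Proof. apply (upper_add_Z z 1). Qed.

Lemma period_Z (f : C -> C) (t : Z) :
  (forall z, upper z -> f (z + CZ t)%C = f z) ->
  forall n z, upper z -> f (z + CZ (t * n))%C = f z.
Proof.
  intros H. apply (Z.bi_induction (fun n => forall z, upper z -> f (z + CZ (t * n))%C = f z)).
  - intros a b E. unfold Z.eq in E. subst. apply iff_refl.
  - intros z Hz. rewrite Z.mul_0_r. f_equal. unfold CZ. ring.
  - intros n. assert (E : forall z, (z + CZ (t * Z.succ n))%C = (z + CZ (t * n) + CZ t)%C).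
    { intros z. rewrite Z.mul_succ_r, CZ_add. ring. }
    split; intros IH z Hz; specialize (IH z Hz).
    + rewrite E, H by (apply upper_add_Z; auto). auto.
    + rewrite E, H in IH by (apply upper_add_Z; auto). auto.
Qed.

Lemma even_pow_opp (x : C) k : Nat.Even k -> ((- x) ^ k)%C = (x ^ k)%C.
Proof.
  intros [m ->]. rewrite !pow_2mul. f_equal. ring.
Qed.

Lemma autj_nz (c d : Z) (z : C) : upper z -> (c <> 0 \/ d <> 0)%Z -> (CZ c * z + CZ d)%C <> RtoC 0.
Proof.
  intros Hz H E. unfold upper in Hz. destruct z as [x y]. unfold CZ, RtoC, Cmult, Cplus in E.
  simpl in *. apply pair_equal_spec in E. destruct E as [E1 E2].
  assert (Hc : IZR c = 0) by nra. apply eq_IZR in Hc. subst.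
  assert (Hd : IZR d = 0) by nra. apply eq_IZR in Hd. lia.
Qed.

(** The subgroup has three right cosets, represented by the identity, [S] and [S T], and the
    parities of the lower row tell them apart. Evenness of [k] removes the ambiguity of sign. *)
Theorem sl_cases (k : nat) (f : C -> C) : Nat.Even k ->
  (forall z, upper z -> f (z + 1)%C = f z) ->
  let f1 := fun z => (f (- / z) / z ^ k)%C in
  (forall z, upper z -> f1 (z + 2)%C = f1 z) ->
  forall a b c d z, (a * d - b * c = 1)%Z -> upper z ->
  sl k f a b c d z =
    if Z.even c then f z else if Z.even d then f1 z else f1 (z + 1)%C.
Proof.
  intros Hk HT f1 HT2.
  assert (PT : forall n z, upper z -> f (z + CZ n)%C = f z).
  { intros n z Hz. assert (H := period_Z f 1 HT n z Hz). rewrite Z.mul_1_l in H. auto. }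
  assert (P2 : forall n z, upper z -> f1 (z + CZ (2 * n))%C = f1 z) by (apply (period_Z f1 2 HT2)).
  assert (Ppar : forall n z, upper z -> f1 (z + CZ n)%C = if Z.even n then f1 z else f1 (z + 1)%C).
  { intros n z Hz. destruct (Z.even n) eqn:E.
    - apply Z.even_spec in E. destruct E as [j ->]. auto.
    - assert (E2 : Z.odd n = true) by (rewrite <- Z.negb_even, E; auto).
      apply Z.odd_spec in E2. destruct E2 as [j ->].
      rewrite Z.add_comm, CZ_add, Cplus_assoc. apply (P2 j (z + CZ 1)%C). apply upper_add_Z; auto. }
  assert (Main : forall N a b c d z, (Z.to_nat (Z.abs c) < N)%nat ->
    (a * d - b * c = 1)%Z -> upper z ->
    sl k f a b c d z = if Z.even c then f z else if Z.even d then f1 z else f1 (z + 1)%C).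
  { induction N as [|N IH]; intros a b c d z HN Hdet Hz; [lia|].
    destruct (Z.eq_dec c 0) as [->|Hc].
    - replace (a * d - b * 0)%Z with (a * d)%Z in Hdet by ring.
      simpl Z.even. cbv iota. unfold sl.
      assert (Had : (a = 1 /\ d = 1 \/ a = -1 /\ d = -1)%Z) by (apply Z.mul_eq_1 in Hdet as Ha; lia).
      destruct Had as [[-> ->]|[-> ->]].
      + replace ((CZ 1 * z + CZ b) / (CZ 0 * z + CZ 1))%C with (z + CZ b)%C
          by (change (CZ 1) with (RtoC 1); change (CZ 0) with (RtoC 0); field).
        replace (CZ 0 * z + CZ 1)%C with (RtoC 1) by (unfold CZ; ring).
        rewrite Cpow_1_l, PT by auto. field.
      + replace ((CZ (-1) * z + CZ b) / (CZ 0 * z + CZ (-1)))%C with (z + CZ (- b))%C.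
        2:{ rewrite CZ_opp. change (CZ (-1)) with (RtoC (-1)). change (CZ 0) with (RtoC 0). field.
            }
        replace (CZ 0 * z + CZ (-1))%C with (- (1))%C by (unfold CZ; ring).
        rewrite even_pow_opp, Cpow_1_l, PT by auto. field.
    (* One Euclidean step: the factor [S T^n] is split off on the right, and the new lower left
       entry is the remainder [d'] of [d] modulo [c]. *)
    - set (n := (d / c)%Z). set (d' := (d - c * n)%Z). set (b' := (b - a * n)%Z).
      assert (Hd' : (Z.abs d' < Z.abs c)%Z).
      { unfold d', n. assert (H := Z.mod_eq d c Hc). rewrite <- H.
        destruct (Z.lt_ge_cases 0 c); [assert (Hm := Z.mod_pos_bound d c) |
          assert (Hm := Z.mod_neg_bound d c)]; lia. }
      assert (Hdet' : (b' * (- c) - (- a) * d' = 1)%Z) by (unfold b', d'; lia).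
      set (w := (z + CZ n)%C). assert (Hw : upper w) by (apply upper_add_Z; auto).
      set (u := (- / w)%C). assert (Hu : upper u) by (apply upper_inv; auto).
      assert (Hw0 := upper_nz w Hw). assert (Hu0 := upper_nz u Hu).
      assert (Ewu : w = (- / u)%C) by (unfold u; field; auto).
      assert (Hj : (CZ d' * u + CZ (- c))%C <> RtoC 0) by (apply autj_nz; auto; right; lia).
      assert (Ej : (CZ c * z + CZ d)%C = ((CZ d' * u + CZ (- c)) / u)%C).
      { replace z with (w - CZ n)%C by (unfold w; ring). rewrite Ewu.
        unfold d'. rewrite CZ_sub, CZ_mul, CZ_opp. field. auto. }
      assert (En : (CZ a * z + CZ b)%C = ((CZ b' * u + CZ (- a)) / u)%C).
      { replace z with (w - CZ n)%C by (unfold w; ring). rewrite Ewu.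
        unfold b'. rewrite CZ_sub, CZ_mul, CZ_opp. field. auto. }
      assert (Esl : sl k f a b c d z = (u ^ k * sl k f b' (- a) d' (- c) u)%C).
      { unfold sl. rewrite Ej, En.
        replace ((CZ b' * u + CZ (- a)) / u / ((CZ d' * u + CZ (- c)) / u))%C with
          ((CZ b' * u + CZ (- a)) / (CZ d' * u + CZ (- c)))%C by (field; auto).
        unfold Cdiv at 3. rewrite Cpow_mult_l, Cpow_inv by auto.
        field. split; apply Cpow_nz; auto. }
      rewrite Esl, IH; auto; [|lia]. clear Esl Ej En.
      assert (Euk : (u ^ k)%C = (/ w ^ k)%C).
      { unfold u. rewrite even_pow_opp, Cpow_inv by auto. auto. }
      assert (Edpar : Z.even d = xorb (Z.even d') (negb (Z.even c || Z.even n))).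
      { replace d with (d' + c * n)%Z by (unfold d'; ring).
        rewrite Z.even_add, Z.even_mul. destruct (Z.even d'), (Z.even c), (Z.even n); auto. }
      assert (Hcd : (Z.even d' && Z.even c)%bool = false).
      { destruct (Z.even d') eqn:E1, (Z.even c) eqn:E2; auto. exfalso.
        apply Z.even_spec in E1. apply Z.even_spec in E2.
        destruct E1 as [i Hi], E2 as [j Hj2]. rewrite Hi, Hj2 in Hdet'. lia. }
      rewrite Z.even_opp. rewrite Edpar.
      destruct (Z.even d') eqn:E1.
      + assert (E2 : Z.even c = false) by (destruct (Z.even c); auto; discriminate).
        rewrite E2. simpl.
        assert (Hf1 : (u ^ k * f u)%C = f1 w) by (unfold f1; fold u; rewrite Euk; unfold Cdiv; ring).
        rewrite Hf1. unfold w. rewrite Ppar by auto. destruct (Z.even n); auto.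
      + destruct (Z.even c) eqn:E2.
        * unfold f1. rewrite <- Ewu.
          replace (u ^ k * (f w / u ^ k))%C with (f w) by (field; apply Cpow_nz; auto).
          unfold w. apply PT; auto.
        * assert (Hw1 : upper (w - 1)%C).
          { replace (w - 1)%C with (w + CZ (-1))%C by (unfold CZ; ring). apply upper_add_Z; auto. }
          assert (Hw10 := upper_nz _ Hw1).
          (* Here [-1/(u + 1) = -1/(w - 1) - 1], so the translation invariance of [f] and the period
             2 of [f1] bring the value back to [f1]. *)
          assert (Hf1 : (u ^ k * f1 (u + 1))%C = f1 (w + 1)%C).
          { replace (w + 1)%C with ((w - 1) + 2)%C by ring. rewrite HT2 by auto.
            unfold f1. replace (u + 1)%C with ((w - 1) * / w)%C by (unfold u; field; auto).
            rewrite Cpow_mult_l, Cpow_inv, Euk by auto.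
            replace (- / ((w - 1) * / w))%C with (- / (w - 1) + CZ (-1))%C
              by (change (CZ (-1)) with (RtoC (-1)); field; auto).
            rewrite PT by (apply upper_inv; auto).
            field. split; apply Cpow_nz; auto. }
          rewrite Hf1. unfold w.
          replace (z + CZ n + 1)%C with (z + 1 + CZ n)%C by ring.
          rewrite Ppar by (apply upper_add_1; auto).
          destruct (Z.even n); simpl; auto.
          replace (z + 1 + 1)%C with (z + 2)%C by ring. apply HT2; auto. }
  intros a b c d z. apply (Main (S (Z.to_nat (Z.abs c)))). lia.
Qed.

(** * Expansions in powers of the nome *)

(** Stronger than [has_q_expansion]: convergence on the disk is carried along, which makes the
    notion stable under Cauchy products, and [c] records the constant term. *)
Definition qexp (N : nat) (F : C -> C) (c : C) : Prop :=
  exists a, tame a /\ a O = c /\ forall z, upper z -> F z = PS a (q_ N z).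

Lemma qexp_has N F c : (0 < N)%nat -> qexp N F c -> exists a, has_q_expansion N F a /\ a O = c.
Proof.
  intros HN [a [Ha [H0 H]]]. exists a. split; auto. intros z Hz. rewrite H by auto.
  apply hasSum_is_series. apply (PS_correct a); auto. apply Cmod_q_lt; auto.
Qed.

Definition dl (c : C) (n : nat) : C := match n with O => c | _ => RtoC 0 end.

Lemma tame_dl c : tame (dl c).
Proof.
  apply tame_le with (fun _ => c); [|apply tame_const].
  intros [|n]; simpl; [lra|]. rewrite Cmod_0. apply Cmod_ge_0.
Qed.

Lemma PS_dl c x : PS (dl c) x = c.
Proof.
  apply csum_unique.
  assert (H : hasSum (fun n => (dl c n * x ^ n)%C) (dl c O * x ^ 0)%C).
  { apply (hasSum_single O (fun n => (dl c n * x ^ n)%C)).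
    intros [|n] Hn; [congruence|]. simpl. ring. }
  replace (dl c O * x ^ 0)%C with c in H by (simpl; ring). exact H.
Qed.

Lemma qexp_const N c : qexp N (fun _ => c) c.
Proof.
  exists (dl c). split; [apply tame_dl|]. split; auto. intros. symmetry. apply PS_dl.
Qed.

Lemma qexp_plus N F G c d : (0 < N)%nat -> qexp N F c -> qexp N G d ->
  qexp N (fun z => (F z + G z)%C) (c + d)%C.
Proof.
  intros HN [a [Ha [A0 HA]]] [b [Hb [B0 HB]]].
  exists (fun n => (a n + b n)%C). split; [auto with tame|]. split; [congruence|].
  intros z Hz. rewrite PS_plus, HA, HB; auto. apply Cmod_q_lt; auto.
Qed.

Lemma qexp_mult N F G c d : (0 < N)%nat -> qexp N F c -> qexp N G d ->
  qexp N (fun z => (F z * G z)%C) (c * d)%C.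
Proof.
  intros HN [a [Ha [A0 HA]]] [b [Hb [B0 HB]]].
  exists (conv a b). split; [auto with tame|]. split; [rewrite conv_0; congruence|].
  intros z Hz. rewrite PS_conv, HA, HB; auto. apply Cmod_q_lt; auto.
Qed.

Lemma qexp_pow N F c n : (0 < N)%nat -> qexp N F c -> qexp N (fun z => (F z ^ n)%C) (c ^ n)%C.
Proof.
  intros HN H. induction n as [|n IH]; [apply (qexp_const N 1)|].
  simpl. apply qexp_mult; auto.
Qed.

Lemma qexp_ext N F G c : (forall z, upper z -> F z = G z) -> qexp N F c -> qexp N G c.
Proof.
  intros H [a [Ha [A0 HA]]]. exists a. repeat split; auto.
  intros z Hz. rewrite <- H; auto.
Qed.

Lemma qexp_scal N F c d : (0 < N)%nat -> qexp N F c -> qexp N (fun z => (d * F z)%C) (d * c)%C.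
Proof. intros. apply qexp_mult; auto. apply qexp_const. Qed.

Lemma qexp_sum N (F : nat -> C -> C) (c : nat -> C) K : (0 < N)%nat ->
  (forall i, qexp N (F i) (c i)) ->
  qexp N (fun z => C_sum (fun i => F i z) K) (C_sum c K).
Proof.
  intros HN H. unfold C_sum. induction K as [|K IH].
  - rewrite sum_O. eapply qexp_ext; [|apply H]. intros z _. cbv beta. rewrite sum_O. auto.
  - rewrite sum_Sn. apply qexp_ext with
      (fun z => (sum_n (G := C_AbelianMonoid) (fun i => F i z) K + F (S K) z)%C).
    + intros z _. rewrite sum_Sn. reflexivity.
    + apply qexp_plus; auto.
Qed.

Lemma tame_alternate a : tame a -> tame (fun n => (RtoC (-1) ^ n * a n)%C).
Proof.
  apply tame_le. intros n. rewrite Cmod_mult, Cmod_pow, Cmod_R.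
  replace (Rabs (-1)) with 1 by (rewrite Rabs_left; lra). rewrite pow1. lra.
Qed.

Lemma PS_opp a x : PS (fun n => (RtoC (-1) ^ n * a n)%C) x = PS a (- x)%C.
Proof.
  unfold PS. f_equal. apply functional_extensionality. intros n.
  replace (- x)%C with (RtoC (-1) * x)%C by ring. rewrite Cpow_mult_l. ring.
Qed.

Definition afc (n : nat) : C := (dl (1 / 2) n + 2 * lamc one1 chi4 n)%C.

Lemma tame_afc : tame afc.
Proof.
  apply (tame_plus (dl (1 / 2)) (fun n => (2 * lamc one1 chi4 n)%C));
    [apply tame_dl | auto with tame].
Qed.

Lemma PS_afc (x : C) : Cmod x < 1 -> PS afc x = af x.
Proof.
  intros Hx. unfold afc. rewrite (PS_plus (dl (1 / 2)) (fun n => (2 * lamc one1 chi4 n)%C)); auto.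
  - rewrite PS_dl, PS_scal by auto with tame. auto.
  - apply tame_dl.
  - auto with tame.
Qed.

Lemma afc_0 : afc O = (/ 2)%C.
Proof. unfold afc. rewrite lamc_0. simpl. field. Qed.

Lemma qexp_Ls N : (0 < N)%nat -> qexp N (fun z => Ls (q_ N z)) (/ 4)%C.
Proof.
  intros HN. replace (/ 4)%C with (/ 2 * / 2)%C by field. apply qexp_mult; auto;
  (exists afc; split; [apply tame_afc|]; split; [apply afc_0|];
   intros z Hz; symmetry; apply PS_afc, Cmod_q_lt; auto).
Qed.

Lemma qexp_Ls_neg N : (0 < N)%nat -> qexp N (fun z => Ls (- q_ N z)) (/ 4)%C.
Proof.
  intros HN. replace (/ 4)%C with (/ 2 * / 2)%C by field. apply qexp_mult; auto;
  (exists (fun n => (RtoC (-1) ^ n * afc n)%C); split; [apply tame_alternate, tame_afc|];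
   split; [rewrite afc_0; simpl; ring|];
   intros z Hz; rewrite PS_opp; symmetry; apply PS_afc; rewrite Cmod_opp; apply Cmod_q_lt; auto).
Qed.

(** Unlike [e2_ab], which lives at the square root of the nome, this form and [D_Ls] use [q] itself
    and so show that only integral powers of [q] occur. *)
Lemma e2_Ls (z : C) : upper z -> e2 z = (8 * Ls (q z) - 4 * Ls (- q z))%C.
Proof. intros Hz. rewrite e2_e2q by auto. apply e2q_Ls2, (Cmod_q_lt 1); auto. Qed.

Lemma D_Ls (z : C) : upper z -> D z = (Ls (q z) * (Ls (q z) - Ls (- q z)))%C.
Proof.
  intros Hz. unfold D. rewrite e2_Ls, cE4_cE4q, cE4q_Ls by (auto; apply (Cmod_q_lt 1); auto). field.
Qed.

Lemma qexp_e2 : qexp 1 e2 1.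
Proof.
  replace (RtoC 1) with (8 * / 4 + -4 * / 4)%C by field.
  apply qexp_ext with (fun z => (8 * Ls (q_ 1 z) + -4 * Ls (- q_ 1 z))%C).
  - intros z Hz. rewrite e2_Ls by auto. unfold q. ring.
  - apply qexp_plus; auto; apply qexp_scal; auto; [apply qexp_Ls | apply qexp_Ls_neg]; auto.
Qed.

Lemma qexp_D : qexp 1 D 0.
Proof.
  replace (RtoC 0) with (/ 4 * (/ 4 + -1 * / 4))%C by field.
  apply qexp_ext with (fun z => (Ls (q_ 1 z) * (Ls (q_ 1 z) + -1 * Ls (- q_ 1 z)))%C).
  - intros z Hz. rewrite D_Ls by auto. unfold q. ring.
  - apply qexp_mult; auto; [apply qexp_Ls; auto|].
    apply qexp_plus; auto; [apply qexp_Ls; auto|]. apply qexp_scal; auto. apply qexp_Ls_neg; auto.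
Qed.

Definition spread (a : nat -> C) (n : nat) : C := if Nat.even n then a (Nat.div2 n) else RtoC 0.

Lemma tame_spread a : tame a -> tame (spread a).
Proof.
  intros Ha r Hr. apply bddSum_inj with (u := fun n => (2 * n)%nat).
  - intros n. apply Rmult_le_pos; [apply Cmod_ge_0 | apply pow_le; lra].
  - intros; lia.
  - intros n Hn. unfold spread. destruct (Nat.even n) eqn:E; [|rewrite Cmod_0; ring].
    apply Nat.even_spec in E. destruct E as [m ->]. exfalso. apply (Hn m). auto.
  - eapply bddSum_le; [|apply (Ha (r * r)); nra].
    intros n. cbv beta. unfold spread. rewrite Nat.even_even, Nat.div2_double, pow_mult.
    replace (r ^ 2) with (r * r) by ring. lra.
Qed.

Lemma PS_spread a (x : C) : tame a -> Cmod x < 1 -> PS (spread a) x = PS a (x * x).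
Proof.
  intros Ha Hx. apply csum_unique. apply hasSum_inj with (u := fun n => (2 * n)%nat).
  - intros; lia.
  - intros n Hn. unfold spread. destruct (Nat.even n) eqn:E; [|ring].
    apply Nat.even_spec in E. destruct E as [m ->]. exfalso. apply (Hn m). auto.
  - eapply hasSum_ext; [|apply PS_correct; [apply Ha | apply Cmod_sqr_lt, Hx]].
    intros n. cbv beta. unfold spread. rewrite Nat.even_even, Nat.div2_double, pow_2mul. auto.
Qed.

Lemma qexp_1_2 F c : qexp 1 F c -> qexp 2 F c.
Proof.
  intros [a [Ha [A0 HA]]]. exists (spread a). split; [apply tame_spread; auto|].
  split; [auto|]. intros z Hz. rewrite HA by auto. fold (q z). rewrite q_sqr.
  symmetry. apply PS_spread; auto. apply Cmod_q_lt; auto.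
Qed.

Definition cdiff_upper (f : C -> C) : Prop := forall z, upper z -> cdiff f z.

(** By [sl_cases] every slash of [f] is [f], [f1] or the translate of [f1] by 1. The expansion of
    the translate comes from that of [f1] by alternating signs, since [q_2] changes sign. *)
Theorem modular_form_intro (k : nat) (f f1 : C -> C) c c1 : Nat.Even k ->
  cdiff_upper f ->
  (forall z, upper z -> f (z + 1)%C = f z) ->
  (forall z, upper z -> f (- / z)%C = (z ^ k * f1 z)%C) ->
  (forall z, upper z -> f1 (z + 2)%C = f1 z) ->
  qexp 2 f c -> qexp 2 f1 c1 -> modular_form k f.
Proof.
  intros Hk Hd HT HS HT2 Hq Hq1.
  assert (Hf1 : forall z, upper z -> (f (- / z) / z ^ k)%C = f1 z).
  { intros z Hz. rewrite HS by auto. field. apply Cpow_nz, upper_nz; auto. }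
  assert (Hsl : forall g z, upper z -> slash k f g z =
    if Z.even (m_c g) then f z else if Z.even (m_d g) then f1 z else f1 (z + 1)%C).
  { intros g z Hz. rewrite <- (Hf1 z), <- (Hf1 (z + 1)%C) by (auto using upper_add_1).
    apply (sl_cases k f Hk HT); auto.
    - intros w Hw. rewrite !Hf1; auto. apply (upper_add_Z w 2); auto.
    - apply m_det. }
  split; [exact Hd|]. split.
  - intros g Hg z Hz. rewrite Hsl by auto. apply Z.even_spec in Hg. rewrite Hg. auto.
  - intros g.
    assert (Hqg : exists c', qexp 2 (slash k f g) c').
    { destruct (Z.even (m_c g)) eqn:E1; [|destruct (Z.even (m_d g)) eqn:E2].
      - exists c. apply qexp_ext with f; auto. intros z Hz. rewrite Hsl, E1; auto.
      - exists c1. apply qexp_ext with f1; auto. intros z Hz. rewrite Hsl, E1, E2; auto.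
      - destruct Hq1 as [a [Ha [A0 HA]]]. exists c1.
        exists (fun n => (RtoC (-1) ^ n * a n)%C).
        split; [apply tame_alternate; auto|]. split; [rewrite A0; simpl; ring|].
        intros z Hz. rewrite Hsl, E1, E2, PS_opp, <- q2_add_1 by auto.
        apply HA. apply upper_add_1; auto. }
    destruct Hqg as [c' Hc']. destruct (qexp_has 2 _ _ ltac:(lia) Hc') as [a [Ha _]].
    exists a. auto.
Qed.

(** * The hypergeometric polynomial *)

Lemma C_sum_0 (a : nat -> C) : C_sum a 0 = a O.
Proof. unfold C_sum. apply sum_O. Qed.

Lemma C_sum_S (a : nat -> C) n : C_sum a (S n) = (C_sum a n + a (S n))%C.
Proof. unfold C_sum. rewrite sum_Sn. reflexivity. Qed.

Lemma C_sum_ext (a b : nat -> C) n : (forall i, (i <= n)%nat -> a i = b i) -> C_sum a n = C_sum b n.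
Proof.
  intros H. induction n as [|n IH]; [rewrite !C_sum_0; apply H; lia|].
  rewrite !C_sum_S, IH, H; auto.
Qed.

Lemma C_sum_plus (a b : nat -> C) n : C_sum (fun i => (a i + b i)%C) n = (C_sum a n + C_sum b n)%C.
Proof. induction n as [|n IH]; [rewrite !C_sum_0; auto|]. rewrite !C_sum_S, IH. ring. Qed.

Lemma C_sum_scal c (a : nat -> C) n : C_sum (fun i => (c * a i)%C) n = (c * C_sum a n)%C.
Proof. induction n as [|n IH]; [rewrite !C_sum_0; auto|]. rewrite !C_sum_S, IH. ring. Qed.

Definition cf (k i : nat) : C :=
  (poch (hyp_a k) i * poch (hyp_b k) i / (poch (hyp_c k) i * CN (fact i)) * 64 ^ i)%C.

Definition hp (k : nat) (d e : C) : C := C_sum (fun i => cf k i * d ^ i * e ^ (k / 2 - 2 * i))%C (k / 4).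
(** [hpe] and [hpee] are the first two partial derivatives of [hp] in [e]. Where the truncated
    exponents are wrong, the factor in front is zero. *)
Definition hpe (k : nat) (d e : C) : C :=
  C_sum (fun i => cf k i * CN (k / 2 - 2 * i) * d ^ i * e ^ (k / 2 - 2 * i - 1))%C (k / 4).
Definition hpee (k : nat) (d e : C) : C :=
  C_sum (fun i => cf k i * (CN (k / 2 - 2 * i) * CN (k / 2 - 2 * i - 1)) * d ^ i *
    e ^ (k / 2 - 2 * i - 2))%C (k / 4).

Lemma CN_add m n : CN (m + n) = (CN m + CN n)%C.
Proof. unfold CN. rewrite plus_INR, RtoC_plus. auto. Qed.

Lemma CN_sub m n : (n <= m)%nat -> CN (m - n) = (CN m - CN n)%C.
Proof. intros H. unfold CN. rewrite minus_INR, RtoC_minus; auto. Qed.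

Lemma CN_inj m n : CN m = CN n -> m = n.
Proof. intros H. apply RtoC_inj in H. apply INR_eq; auto. Qed.

Lemma CN_0 : CN 0 = RtoC 0.
Proof. reflexivity. Qed.

Lemma CN_1 : CN 1 = RtoC 1.
Proof. reflexivity. Qed.

(** Twice this number is [2 i + 1 - 2 m], which is odd. *)
Lemma hyp_c_nz m i : (hyp_c (2 * m) + CN i)%C <> RtoC 0.
Proof.
  intros E. unfold hyp_c in E. rewrite CN_mul, CN_2 in E.
  assert (E2 : CN (2 * m) = CN (2 * i + 1)).
  { rewrite CN_add, !CN_mul, CN_2, CN_1.
    replace (2 * CN i + 1)%C with (2 * (- ((2 * CN m - 1) / 2) + CN i) + 2 * CN m)%C by field.
    rewrite E. ring. }
  apply CN_inj in E2. lia.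
Qed.

Lemma poch_c_nz m i : poch (hyp_c (2 * m)) i <> RtoC 0.
Proof.
  induction i as [|i IH]; simpl.
  - intros E. apply RtoC_inj in E. lra.
  - apply Cmult_neq_0; auto. apply hyp_c_nz.
Qed.

Lemma fact_nz i : CN (fact i) <> RtoC 0.
Proof. apply CN_nz, lt_O_fact. Qed.

Lemma cf_0 k : cf k 0 = RtoC 1.
Proof. unfold cf. simpl. change (CN 1) with (RtoC 1). field. Qed.

(** The bracket on the left equals [4 (i + 1) (c + i)] for the lower parameter [c], and the two
    factors on the right are [-2 (a + i)] and [-2 (b + i)]: this is the hypergeometric recursion. *)
Lemma cf_S m i : (2 * S i <= m)%nat ->
  ((CN (m - 2 * S i) * (CN (m - 2 * S i) + 1) - CN m * (CN m + 1)) * cf (2 * m) (S i))%C =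
  (64 * CN (m - 2 * i) * CN (m - 2 * i - 1) * cf (2 * m) i)%C.
Proof.
  intros Hi. unfold cf.
  assert (H1 := poch_c_nz m i). assert (H2 := hyp_c_nz m i). assert (H3 := fact_nz i).
  assert (H4 : CN (S i) <> RtoC 0) by (apply CN_nz; lia).
  replace (fact (S i)) with (S i * fact i)%nat by reflexivity.
  cbn [poch Cpow]. rewrite CN_mul.
  rewrite !CN_sub, !CN_mul, CN_2, CN_1 by lia. rewrite CN_S in *.
  unfold hyp_c, hyp_a, hyp_b in *. rewrite CN_mul, CN_2 in *.
  set (pa := poch (- (2 * CN m / 4))%C i) in *. set (pb := poch (- ((2 * CN m - 2) / 4))%C i) in *.
  set (pc := poch (- ((2 * CN m - 1) / 2))%C i) in *.
  set (M := CN m) in *. set (I := CN i) in *. set (fi := CN (fact i)) in *.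
  field. repeat split; auto. intros E. apply H2.
  replace (- ((2 * M - 1) / 2) + I)%C with ((- (2 * M - 1) + I * 2) / 2)%C by field.
  rewrite E. field.
Qed.

Lemma half_mul m : (2 * m / 2 = m)%nat.
Proof. rewrite Nat.mul_comm. apply Nat.div_mul. lia. Qed.

Lemma quarter_mul m : (2 * m / 4 = m / 2)%nat.
Proof. change 4%nat with (2 * 2)%nat. rewrite <- Nat.Div0.div_div, half_mul. auto. Qed.

Lemma pow_e1 (e : C) n : (CN n * (e * e ^ (n - 1)))%C = (CN n * e ^ n)%C.
Proof.
  destruct n as [|n]; [rewrite CN_0; ring|]. replace (S n - 1)%nat with n by lia.
  rewrite Cpow_S. ring.
Qed.

Lemma pow_e2 (e : C) n : (CN n * CN (n - 1) * (e * e * e ^ (n - 2)))%C = (CN n * CN (n - 1) * e ^ n)%C.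
Proof.
  destruct n as [|[|n]]; [rewrite CN_0; ring | simpl (1 - 1)%nat; rewrite CN_0; ring|].
  replace (S (S n) - 2)%nat with n by lia. rewrite !Cpow_S. ring.
Qed.

(* Legendre's equation, by telescoping. *)
Lemma hp_legendre m (d e : C) :
  ((e * e - 64 * d) * hpee (2 * m) d e + 2 * e * hpe (2 * m) d e)%C =
  (CN m * (CN m + 1) * hp (2 * m) d e)%C.
Proof.
  set (N := fun i => (m - 2 * i)%nat).
  pose (t := fun i => ((e * e - 64 * d) *
    (cf (2 * m) i * (CN (N i) * CN (N i - 1)) * d ^ i * e ^ (N i - 2)) +
    2 * e * (cf (2 * m) i * CN (N i) * d ^ i * e ^ (N i - 1)) +
    - (CN m * (CN m + 1)) * (cf (2 * m) i * d ^ i * e ^ N i))%C).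
  assert (Et : forall i, t i = (cf (2 * m) i * d ^ i *
    (((CN (N i) * CN (N i - 1) + 2 * CN (N i)) - CN m * (CN m + 1)) * e ^ N i
     - 64 * d * (CN (N i) * CN (N i - 1)) * e ^ (N i - 2)))%C).
  { intros i. unfold t.
    transitivity (cf (2 * m) i * d ^ i * ((CN (N i) * CN (N i - 1) * (e * e * e ^ (N i - 2)) +
      2 * (CN (N i) * (e * e ^ (N i - 1)))) - CN m * (CN m + 1) * e ^ N i
      - 64 * d * (CN (N i) * CN (N i - 1)) * e ^ (N i - 2)))%C; [ring|].
    rewrite pow_e1, pow_e2. ring. }
  (* By [cf_S] the part of each term with [- 64 d] cancels the leading part of the next one, so a
     partial sum consists of its last such part only. *)
  assert (Hsum : forall j, (2 * j <= m)%nat -> C_sum t j =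
    (- (64 * cf (2 * m) j * (CN (N j) * CN (N j - 1)) * d ^ S j * e ^ (N j - 2)))%C).
  { induction j as [|j IH]; intros Hj.
    - rewrite C_sum_0, Et. unfold N. rewrite Nat.mul_0_r, Nat.sub_0_r.
      destruct m as [|m']; [rewrite !CN_0; simpl; ring|].
      replace (S m' - 1)%nat with m' by lia. rewrite CN_S. simpl (d ^ 1)%C. simpl (d ^ 0)%C. ring.
    - rewrite C_sum_S, IH, Et by lia.
      assert (E := cf_S m j Hj). fold (N (S j)) in E. fold (N j) in E.
      replace (N j - 2)%nat with (N (S j)) by (unfold N; lia).
      replace (CN (N (S j)) * CN (N (S j) - 1) + 2 * CN (N (S j)))%C with
        (CN (N (S j)) * (CN (N (S j)) + 1))%C.
      2:{ destruct (N (S j)) as [|n]; [rewrite CN_0; ring|].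
          replace (S n - 1)%nat with n by lia. rewrite CN_S. ring. }
      transitivity ((d ^ S j * e ^ N (S j) * ((CN (N (S j)) * (CN (N (S j)) + 1) -
        CN m * (CN m + 1)) * cf (2 * m) (S j) - 64 * CN (N j) * CN (N j - 1) * cf (2 * m) j)) -
        64 * cf (2 * m) (S j) * (CN (N (S j)) * CN (N (S j) - 1)) * d ^ S (S j) * e ^ (N (S j) - 2))%C.
      + rewrite !Cpow_S. ring.
      + rewrite E. ring. }
  assert (Hm : (2 * (m / 2) <= m)%nat) by (apply Nat.Div0.mul_div_le).
  (* The last exponent is [m mod 2], hence 0 or 1, and the surviving part carries the factor
     [N (N - 1)]. *)
  assert (Hlast : (CN (N (m / 2)%nat) * CN (N (m / 2)%nat - 1))%C = RtoC 0).
  { unfold N. assert (H := Nat.mod_upper_bound m 2 ltac:(lia)).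
    assert (Hd := Nat.div_mod_eq m 2).
    replace (m - 2 * (m / 2))%nat with (m mod 2)%nat by lia.
    destruct (m mod 2) as [|[|r]]; [rewrite CN_0; ring | simpl (1 - 1)%nat; rewrite CN_0; ring | lia]. }
  specialize (Hsum _ Hm). rewrite Hlast in Hsum.
  unfold t in Hsum. rewrite !C_sum_plus, !C_sum_scal in Hsum.
  unfold hp, hpe, hpee. rewrite !half_mul, quarter_mul. unfold N in Hsum.
  match type of Hsum with (?a + ?b + - ?c * ?d)%C = ?r =>
    transitivity ((a + b + - c * d) + c * d)%C; [ring|]; rewrite Hsum end.
  ring.
Qed.

(** * The differential equation *)

(* [thd f z d]: the normalized derivative of [f] at [z] is [d]. *)
Definition thd (f : C -> C) (z d : C) : Prop := Cder f z (ipi * d)%C.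

Lemma thd_eq f z d d' : thd f z d -> d = d' -> thd f z d'.
Proof. intros H <-. auto. Qed.

Lemma thd_plus f g z a b : thd f z a -> thd g z b -> thd (fun z => (f z + g z)%C) z (a + b)%C.
Proof. intros. eapply Cder_eq; [apply Cder_plus; eauto|]. ring. Qed.

Lemma thd_mult f g z a b : thd f z a -> thd g z b ->
  thd (fun z => (f z * g z)%C) z (a * g z + f z * b)%C.
Proof. intros. eapply Cder_eq; [apply Cder_mult; eauto|]. ring. Qed.

Lemma thd_scal c f z a : thd f z a -> thd (fun z => (c * f z)%C) z (c * a)%C.
Proof. intros. eapply Cder_eq; [apply Cder_scal; eauto|]. ring. Qed.

Lemma thd_pow f z a n : thd f z a -> thd (fun z => (f z ^ n)%C) z (CN n * a * f z ^ (n - 1))%C.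
Proof.
  intros. eapply Cder_eq; [apply Cder_pow; eauto|]. replace (n - 1)%nat with (pred n) by lia. ring.
Qed.

Lemma thd_sum (F : nat -> C -> C) (d : nat -> C) z K :
  (forall i, (i <= K)%nat -> thd (F i) z (d i)) ->
  thd (fun z => C_sum (fun i => F i z) K) z (C_sum d K).
Proof.
  intros H. induction K as [|K IH].
  - eapply Cder_ext; [|rewrite C_sum_0; apply (H O); lia].
    intros y. cbv beta. rewrite C_sum_0. auto.
  - eapply Cder_ext; [|rewrite C_sum_S; apply thd_plus; [apply IH; auto | apply (H (S K)); lia]].
    intros y. cbv beta. rewrite C_sum_S. auto.
Qed.

Lemma Cder_upper_ext f g z l : upper z -> (forall w, upper w -> f w = g w) -> Cder f z l -> Cder g z l.
Proof.
  intros Hz H. apply Cder_ext_loc with (Im z); auto.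
  intros y Hy. apply H. unfold upper in *.
  assert (H1 := im_le_Cmod (y - z)). apply Rabs_le_between in H1.
  destruct y as [y1 y2], z as [z1 z2]. simpl in *. lra.
Qed.

Lemma thd_upper_ext f g z l : upper z -> (forall w, upper w -> f w = g w) -> thd f z l -> thd g z l.
Proof. intros. eapply Cder_upper_ext; eauto. Qed.

Lemma qD_thd f z d : thd f z d -> qD f z = d.
Proof.
  intros H. unfold qD. rewrite (is_C_derive_unique f z _ H). fold ipi.
  field. apply ipi_nz.
Qed.

Lemma thd_cE2 z : upper z -> thd cE2 z ((Pz z * Pz z - (e2 z * e2 z - 64 * D z)) / 4)%C.
Proof.
  intros Hz. apply thd_upper_ext with Pz; auto.
  - intros w Hw. symmetry. apply cE2_cE2q; auto.
  - eapply Cder_eq; [apply Cder_Pz; auto|]. rewrite e2_ab, D_ab by auto. field.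
Qed.

Lemma thd_e2 z : upper z -> thd e2 z ((Pz z * e2 z - (e2 z * e2 z - 64 * D z)) / 2)%C.
Proof.
  intros Hz. apply thd_upper_ext with (fun z => (2 * (az z + bz z))%C); auto.
  - intros w Hw. symmetry. apply e2_ab; auto.
  - eapply thd_eq; [apply thd_scal, thd_plus; [apply Cder_az | apply Cder_bz]; auto|].
    rewrite e2_ab, D_ab by auto. field.
Qed.

Lemma thd_D z : upper z -> thd D z (Pz z * D z)%C.
Proof.
  intros Hz.
  apply thd_upper_ext with (fun z => (/ 16 * ((az z + -1 * bz z) * (az z + -1 * bz z)))%C); auto.
  - intros w Hw. rewrite D_ab by auto. field.
  - assert (H : thd (fun z => (az z + -1 * bz z)%C) z (Pz z / 2 * (az z - bz z))%C).
    { eapply thd_eq; [apply thd_plus; [apply Cder_az | apply thd_scal, Cder_bz]; auto|]. field. }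
    eapply thd_eq; [apply thd_scal, thd_mult; apply H|].
    rewrite D_ab by auto. field.
Qed.

(** [D] has weight 4 and [e2] weight 2; the coefficient of [Pz] is a quarter of the weight of the
    monomial. *)
Lemma thd_mono (c : C) i n z : upper z ->
  thd (fun z => (c * D z ^ i * e2 z ^ n)%C) z
    (c * ((CN i + CN n / 2) * Pz z * D z ^ i * e2 z ^ n -
      (e2 z * e2 z - 64 * D z) / 2 * CN n * D z ^ i * e2 z ^ (n - 1)))%C.
Proof.
  intros Hz.
  eapply thd_eq; [apply (thd_mult (fun z => (c * D z ^ i)%C) (fun z => (e2 z ^ n)%C));
    [apply thd_scal, thd_pow, thd_D; auto | apply thd_pow, thd_e2; auto]|].
  assert (E1 := pow_e1 (D z) i). assert (E2 := pow_e1 (e2 z) n).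
  set (Q := (e2 z * e2 z - 64 * D z)%C) in *.
  transitivity (c * (Pz z * (CN i * (D z * D z ^ (i - 1))) * e2 z ^ n +
    Pz z / 2 * D z ^ i * (CN n * (e2 z * e2 z ^ (n - 1))) -
    Q / 2 * CN n * D z ^ i * e2 z ^ (n - 1)))%C; [field|].
  rewrite E1, E2. field.
Qed.

Definition Qz (z : C) : C := (e2 z * e2 z - 64 * D z)%C.
Definition f0 (k : nat) (z : C) : C := hp k (D z) (e2 z).
Definition fe (k : nat) (z : C) : C := hpe k (D z) (e2 z).
Definition fee (k : nat) (z : C) : C := hpee k (D z) (e2 z).

Lemma hyp_form_hp k z : hyp_form k z = hp k (D z) (e2 z).
Proof. reflexivity. Qed.

Lemma thd_f0 m z : upper z ->
  thd (f0 (2 * m)) z (CN m / 2 * Pz z * f0 (2 * m) z - Qz z / 2 * fe (2 * m) z)%C.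
Proof.
  intros Hz. unfold f0, fe, hp, hpe. rewrite half_mul, quarter_mul.
  eapply thd_eq.
  - apply (thd_sum (fun i z => (cf (2 * m) i * D z ^ i * e2 z ^ (m - 2 * i))%C)).
    intros i _. apply thd_mono; auto.
  - rewrite <- !C_sum_scal.
    match goal with |- _ = (C_sum ?a ?n - C_sum ?b ?n)%C =>
      replace (C_sum a n - C_sum b n)%C with (C_sum a n + -1 * C_sum b n)%C by ring end.
    rewrite <- C_sum_scal, <- C_sum_plus. apply C_sum_ext. intros i Hi.
    assert (Hi2 : (2 * i <= m)%nat) by (assert (H := Nat.Div0.mul_div_le m 2); lia).
    rewrite CN_sub, CN_mul, CN_2 by auto. unfold Qz. field.
Qed.

Lemma thd_fe m z : upper z ->
  thd (fe (2 * m)) z ((CN m - 1) / 2 * Pz z * fe (2 * m) z - Qz z / 2 * fee (2 * m) z)%C.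
Proof.
  intros Hz. unfold fe, fee, hpe, hpee. rewrite half_mul, quarter_mul.
  eapply thd_eq.
  - apply (thd_sum (fun i z => (cf (2 * m) i * CN (m - 2 * i) * D z ^ i * e2 z ^ (m - 2 * i - 1))%C)).
    intros i _. apply thd_mono; auto.
  - rewrite <- !C_sum_scal.
    match goal with |- _ = (C_sum ?a ?n - C_sum ?b ?n)%C =>
      replace (C_sum a n - C_sum b n)%C with (C_sum a n + -1 * C_sum b n)%C by ring end.
    rewrite <- C_sum_scal, <- C_sum_plus. apply C_sum_ext. intros i Hi.
    assert (Hi2 : (2 * i <= m)%nat) by (assert (H := Nat.Div0.mul_div_le m 2); lia).
    replace (m - 2 * i - 1 - 1)%nat with (m - 2 * i - 2)%nat by lia.
    destruct (Nat.eq_dec (m - 2 * i) 0) as [E|E].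
    + rewrite E, CN_0. ring.
    + rewrite (CN_sub (m - 2 * i) 1), (CN_sub m (2 * i)), CN_mul, CN_2, CN_1 by lia.
      unfold Qz. field.
Qed.

Lemma C_differentiable_thd f z d : thd f z d -> C_differentiable f z.
Proof. intros H. eexists. apply H. Qed.

(** The equation with explicit candidates for both derivatives, so that the total operator [qD] is
    evaluated only once, in [ode_intro]. *)
Definition ode_data (k : nat) (f f' f'' : C -> C) : Prop :=
  (forall z, upper z -> thd f z (f' z)) /\ (forall z, upper z -> thd f' z (f'' z)) /\
  (forall z, upper z -> (f'' z - (CN k + 1) / 2 * Pz z * f' z +
    CN k * (CN k + 1) / 4 * ((Pz z * Pz z - Qz z) / 4) * f z)%C = RtoC 0).

Lemma ode_intro k f f' f'' : ode_data k f f' f'' -> ode_solution k f.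
Proof.
  intros [H1 [H2 H3]] z Hz.
  assert (H2' : thd (qD f) z (f'' z)).
  { apply thd_upper_ext with f'; auto. intros w Hw. symmetry. apply qD_thd; auto. }
  split; [eapply C_differentiable_thd; apply H1; auto|].
  split; [eapply C_differentiable_thd; apply H2'|].
  split; [eapply C_differentiable_thd; apply thd_cE2; auto|].
  rewrite (qD_thd _ _ _ H2'), (qD_thd _ _ _ (H1 z Hz)), (qD_thd _ _ _ (thd_cE2 z Hz)).
  rewrite cE2_cE2q by auto. apply (H3 z Hz).
Qed.

Definition f0' (m : nat) (z : C) : C :=
  (CN m / 2 * Pz z * f0 (2 * m) z - Qz z / 2 * fe (2 * m) z)%C.

Lemma thd_Qz z : upper z ->
  thd Qz z (e2 z * (Pz z * e2 z - Qz z) - 64 * (Pz z * D z))%C.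
Proof.
  intros Hz. eapply Cder_ext with (fun z => (e2 z * e2 z + -64 * D z)%C).
  { intros y. unfold Qz. ring. }
  eapply thd_eq; [apply thd_plus; [apply thd_mult; apply thd_e2; auto | apply thd_scal, thd_D; auto]|].
  unfold Qz. field.
Qed.

Lemma ode_data_scal k f f' f'' g (c : C) : ode_data k f f' f'' ->
  (forall z, upper z -> g z = (c * f z)%C) ->
  ode_data k g (fun z => (c * f' z)%C) (fun z => (c * f'' z)%C).
Proof.
  intros [H1 [H2 H3]] Hg. split; [|split]; intros z Hz.
  - apply thd_upper_ext with (fun z => (c * f z)%C); auto.
    + intros w Hw. symmetry. auto.
    + apply thd_scal; auto.
  - apply thd_scal; auto.
  - rewrite Hg by auto. specialize (H3 z Hz).
    match type of H3 with ?l = _ => transitivity (c * l)%C; [ring | rewrite H3; ring] end.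
Qed.

Definition f0'' (m : nat) (z : C) : C :=
  (CN m / 2 * ((Pz z * Pz z - Qz z) / 4 * f0 (2 * m) z +
    Pz z * f0' m z) - / 2 * ((e2 z * (Pz z * e2 z - Qz z) - 64 * (Pz z * D z)) * fe (2 * m) z +
    Qz z * ((CN m - 1) / 2 * Pz z * fe (2 * m) z - Qz z / 2 * fee (2 * m) z)))%C.

Lemma ode_hyp m : ode_data (2 * m) (hyp_form (2 * m)) (f0' m) (f0'' m).
Proof.
  split; [|split].
  - intros z Hz. apply (thd_f0 m z Hz).
  - intros z Hz.
    apply Cder_ext with (fun z => (CN m / 2 * (Pz z * f0 (2 * m) z) +
      (- / 2) * (Qz z * fe (2 * m) z))%C).
    { intros y. unfold f0'. field. }
    assert (HP : thd Pz z ((Pz z * Pz z - Qz z) / 4)%C).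
    { apply thd_upper_ext with cE2; auto; [intros; apply cE2_cE2q; auto|]. apply thd_cE2; auto. }
    eapply thd_eq; [apply thd_plus; apply thd_scal, thd_mult;
      [apply HP | apply thd_f0; auto | apply thd_Qz; auto | apply thd_fe; auto]|].
    fold (f0' m z). unfold f0''. ring.
  - intros z Hz. assert (H := hp_legendre m (D z) (e2 z)). fold (Qz z) in H.
    rewrite CN_mul, CN_2. change (hyp_form (2 * m) z) with (f0 (2 * m) z).
    fold (f0 (2 * m) z) in H.
    fold (fe (2 * m) z) in H. fold (fee (2 * m) z) in H.
    replace (Qz z) with (e2 z * e2 z - 64 * D z)%C in * by reflexivity.
    (* All terms in [Pz] cancel, and a quarter of [Qz] times the defect of Legendre's equation is
       left. *)
    transitivity (((e2 z * e2 z - 64 * D z) / 4) *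
      (((e2 z * e2 z - 64 * D z) * fee (2 * m) z + 2 * e2 z * fe (2 * m) z) -
       CN m * (CN m + 1) * f0 (2 * m) z))%C.
    + unfold f0'', f0', Qz. field.
    + rewrite H. ring.
Qed.

(** * Modularity *)

(* The weight [k] image of [hyp_form k] under [z -> -1/z]. *)
Definition hypS (k : nat) (z : C) : C :=
  hp k (bz z * bz z * / 16) (-2 * (2 * az z + -1 * bz z)).

Lemma q2_add_2 (z : C) : q_ 2 (z + 2) = q_ 2 z.
Proof. replace (z + 2)%C with (z + 1 + 1)%C by ring. rewrite !q2_add_1. ring. Qed.

Lemma az_add_1 z : az (z + 1) = bz z.
Proof. unfold az, bz. rewrite q2_add_1. auto. Qed.

Lemma bz_add_1 z : bz (z + 1) = az z.
Proof. unfold az, bz. rewrite q2_add_1. f_equal. ring. Qed.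

Lemma e2_add_1 z : upper z -> e2 (z + 1) = e2 z.
Proof.
  intros Hz. rewrite !e2_ab, az_add_1, bz_add_1 by (auto using upper_add_1). ring.
Qed.

Lemma D_add_1 z : upper z -> D (z + 1) = D z.
Proof.
  intros Hz. rewrite !D_ab, az_add_1, bz_add_1 by (auto using upper_add_1). field.
Qed.

Lemma e2_S z : upper z -> e2 (- / z) = (z * z * (-2 * (2 * az z + -1 * bz z)))%C.
Proof.
  intros Hz. rewrite e2_ab, az_S, bz_S by (auto using upper_inv). ring.
Qed.

Lemma D_S z : upper z -> D (- / z) = (z * z * (z * z) * (bz z * bz z * / 16))%C.
Proof.
  intros Hz. rewrite D_ab, az_S, bz_S by (auto using upper_inv). field.
Qed.

(** Every monomial has the same weight, so the factors [z^4] from [D] and [z^2] from [e2] always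
    combine to [z^(2 m)]. *)
Lemma hyp_S m z : upper z -> hyp_form (2 * m) (- / z) = (z ^ (2 * m) * hypS (2 * m) z)%C.
Proof.
  intros Hz. rewrite hyp_form_hp, e2_S, D_S by auto. unfold hypS, hp.
  rewrite half_mul, quarter_mul, <- C_sum_scal. apply C_sum_ext. intros i Hi.
  assert (Hi2 : (2 * i <= m)%nat) by (assert (H := Nat.Div0.mul_div_le m 2); lia).
  rewrite !(Cpow_mult_l (z * z * (z * z))), !(Cpow_mult_l (z * z) (-2 * _)).
  assert (E : (z ^ (2 * m))%C = ((z * z * (z * z)) ^ i * (z * z) ^ (m - 2 * i))%C).
  { rewrite pow_2mul, <- (pow_2mul (z * z)), <- Cpow_add_r. f_equal. lia. }
  rewrite E. ring.
Qed.

(** [D] vanishes at infinity, so the constant term comes from [i = 0] alone, where both the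
    coefficient and the constant term of [e2] are 1. *)
Lemma qexp_hyp k : qexp 1 (hyp_form k) 1.
Proof.
  assert (E : C_sum (fun i => (cf k i * 0 ^ i * 1 ^ (k / 2 - 2 * i))%C) (k / 4) = RtoC 1).
  { induction (k / 4)%nat as [|n IH]; [rewrite C_sum_0, cf_0, Cpow_1_l; simpl; ring|].
    rewrite C_sum_S, IH, Cpow_S. ring. }
  rewrite <- E.
  apply (qexp_sum 1 (fun i z => (cf k i * D z ^ i * e2 z ^ (k / 2 - 2 * i))%C)); auto.
  intros i. apply qexp_mult; auto; [apply qexp_mult; auto; [apply qexp_const|]|]; apply qexp_pow; auto;
    [apply qexp_D | apply qexp_e2].
Qed.

Lemma qexp_hypS k : exists c, qexp 2 (hypS k) c.
Proof.
  eexists. unfold hypS, hp.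
  apply (qexp_sum 2 (fun i z => (cf k i * (bz z * bz z * / 16) ^ i *
    (-2 * (2 * az z + -1 * bz z)) ^ (k / 2 - 2 * i))%C)
    (fun i => (cf k i * (/ 4 * / 4 * / 16) ^ i * (-2 * (2 * / 4 + -1 * / 4)) ^ (k / 2 - 2 * i))%C));
    auto.
  assert (Ha : qexp 2 az (/ 4)%C) by (apply qexp_Ls; lia).
  assert (Hb : qexp 2 bz (/ 4)%C) by (apply qexp_Ls_neg; lia).
  intros i. apply qexp_mult; auto; [apply qexp_mult; auto; [apply qexp_const|]|]; apply qexp_pow; auto.
  - apply qexp_mult; auto; [apply qexp_mult; auto | apply qexp_const].
  - apply qexp_scal; auto. apply qexp_plus; auto; apply qexp_scal; auto.
Qed.

(** * The hypergeometric series *)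

Lemma poch_zero a j n : (a + CN j)%C = RtoC 0 -> (j < n)%nat -> poch a n = RtoC 0.
Proof.
  intros H. induction n as [|n IH]; intros Hn; [lia|]. simpl.
  destruct (Nat.eq_dec j n) as [<-|Hne]; [rewrite H; ring|]. rewrite IH by lia. ring.
Qed.

(** For [m = 2 j] the factor [a + j] vanishes, for [m = 2 j + 1] the factor [b + j]; hence the
    series always stops at [m / 2]. *)
Lemma poch_ab_zero m n : (m / 2 < n)%nat ->
  (poch (hyp_a (2 * m)) n * poch (hyp_b (2 * m)) n)%C = RtoC 0.
Proof.
  intros Hn. assert (Hd := Nat.div_mod_eq m 2). assert (Hb := Nat.mod_upper_bound m 2 ltac:(lia)).
  set (j := (m / 2)%nat) in *. destruct (m mod 2) as [|[|r]]; [| |lia].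
  - rewrite (poch_zero (hyp_a (2 * m)) j n); auto; [ring|].
    unfold hyp_a. rewrite Hd, Nat.add_0_r, !CN_mul, CN_2. field.
  - rewrite (poch_zero (hyp_b (2 * m)) j n); auto; [ring|].
    unfold hyp_b. rewrite Hd, CN_mul, CN_add, CN_mul, CN_2, CN_1. field.
Qed.

Lemma Cinv_0 : (/ RtoC 0)%C = RtoC 0.
Proof. unfold Cinv, RtoC. simpl. f_equal; unfold Rdiv; ring. Qed.

(** If [D z = 0], both divisions by zero return 0, which agrees with the right-hand side. *)
Lemma j2_inv z : e2 z <> RtoC 0 -> (64 / j2 z)%C = (64 * D z / (e2 z * e2 z))%C.
Proof.
  intros He. unfold j2. destruct (C_zero_dec (D z)) as [E|E].
  - rewrite E. unfold Cdiv. rewrite Cinv_0, Cmult_0_r, Cinv_0. ring.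
  - simpl. field. auto.
Qed.

Lemma hyp_form_hyperF m z : e2 z <> RtoC 0 ->
  hyp_form (2 * m) z = (e2 z ^ (2 * m / 2) *
    hyperF (hyp_a (2 * m)) (hyp_b (2 * m)) (hyp_c (2 * m)) (64 / j2 z))%C.
Proof.
  intros He. rewrite j2_inv by auto.
  set (x := (64 * D z / (e2 z * e2 z))%C).
  assert (E : hyperF (hyp_a (2 * m)) (hyp_b (2 * m)) (hyp_c (2 * m)) x =
    C_sum (fun n => poch (hyp_a (2 * m)) n * poch (hyp_b (2 * m)) n / poch (hyp_c (2 * m)) n *
      (x ^ n / CN (fact n)))%C (m / 2)).
  { unfold hyperF. apply CSeries_hasSum. unfold C_sum. rewrite <- lsum_seq.
    apply hasSum_finite; [apply seq_NoDup|]. intros n Hn.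
    rewrite poch_ab_zero; [unfold Cdiv; ring|].
    apply Nat.nle_gt. intros Hle. apply Hn, in_seq. lia. }
  rewrite E, hyp_form_hp. unfold hp. rewrite half_mul, quarter_mul, <- C_sum_scal.
  apply C_sum_ext. intros i Hi.
  assert (Hi2 : (2 * i <= m)%nat) by (assert (H := Nat.Div0.mul_div_le m 2); lia).
  replace (e2 z ^ m)%C with (e2 z ^ (2 * i) * e2 z ^ (m - 2 * i))%C
    by (rewrite <- Cpow_add_r; f_equal; lia).
  rewrite pow_2mul. unfold x, cf.
  assert (H1 := poch_c_nz m i). assert (H3 := fact_nz i).
  assert (Hee : (e2 z * e2 z)%C <> RtoC 0) by (apply Cmult_neq_0; auto).
  replace ((64 * D z / (e2 z * e2 z)) ^ i)%C with (64 ^ i * D z ^ i / (e2 z * e2 z) ^ i)%C.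
  2:{ unfold Cdiv. rewrite (Cpow_mult_l (64 * D z)), (Cpow_mult_l 64), (Cpow_inv (e2 z * e2 z)) by auto.
      auto. }
  assert (H4 := Cpow_nz _ i Hee).
  field. auto.
Qed.

(** * Uniqueness *)

Lemma is_C_series_bounded (b : nat -> C) l : is_C_series b l -> exists B, forall n, Cmod (b n) <= B.
Proof.
  intros H. rewrite is_C_series_iff in H. destruct (H 1 ltac:(lra)) as [N HN].
  assert (Hfin : forall M, exists B, 0 <= B /\ forall n, (n <= M)%nat -> Cmod (b n) <= B).
  { induction M as [|M [B [HB IH]]].
    - exists (Cmod (b O)). split; [apply Cmod_ge_0|]. intros n Hn. replace n with O by lia. lra.
    - exists (B + Cmod (b (S M))). assert (H0 := Cmod_ge_0 (b (S M))). split; [lra|].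
      intros n Hn. destruct (Nat.eq_dec n (S M)) as [->|]; [lra|].
      specialize (IH n ltac:(lia)). lra. }
  destruct (Hfin (S N)) as [B [HB HBn]]. exists (B + 2). intros n.
  destruct (Nat.le_gt_cases n (S N)) as [Hn|Hn]; [specialize (HBn n Hn); lra|].
  destruct n as [|n]; [lia|].
  assert (H1 := HN n ltac:(lia)). assert (H2 := HN (S n) ltac:(lia)).
  rewrite sum_Sn in H2. set (s := sum_n (G := C_AbelianMonoid) b n) in *.
  change (plus s (b (S n))) with (s + b (S n))%C in H2.
  replace (b (S n)) with ((s + b (S n) - l) + - (s - l))%C by ring.
  eapply Rle_trans; [apply Cmod_triangle|]. rewrite Cmod_opp. lra.
Qed.

(** Abel's argument: boundedness at the larger radius [r'] gives geometric domination with ratio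
    [r / r']. *)
Lemma tame_of_bounded (a : nat -> C) :
  (forall r, 0 < r < 1 -> exists B, forall n, Cmod (a n) * r ^ n <= B) -> tame a.
Proof.
  intros H r Hr. set (r' := (r + 1) / 2). assert (Hr' : 0 < r' < 1) by (unfold r'; lra).
  destruct (H r' Hr') as [B HB].
  assert (HB0 : 0 <= B).
  { eapply Rle_trans; [|apply (HB O)]. simpl. rewrite Rmult_1_r. apply Cmod_ge_0. }
  apply bddSum_le with (fun n => B * (r / r') ^ n).
  - intros n. replace (r ^ n) with (r' ^ n * (r / r') ^ n).
    2:{ rewrite <- Rpow_mult_distr. f_equal. field. lra. }
    rewrite <- Rmult_assoc. apply Rmult_le_compat_r; auto.
    apply pow_le. apply Rmult_le_pos; [lra | left; apply Rinv_0_lt_compat; lra].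
  - apply bddSum_scal; auto. apply bddSum_geom. split.
    + apply Rmult_le_pos; [lra | left; apply Rinv_0_lt_compat; lra].
    + apply Rmult_lt_reg_r with r'; [lra|]. field_simplify; [|lra]. unfold r'. lra.
Qed.

Lemma q2_surj (r : R) : 0 < r < 1 -> exists z, upper z /\ q_ 2 z = RtoC r.
Proof.
  intros Hr. assert (HP := PI_RGT_0). assert (Hl : ln r < 0) by (rewrite <- ln_1; apply ln_increasing; lra).
  exists (Ci * (- ln r / PI)%R)%C. split.
  - apply upper_imag. apply Rdiv_lt_0_compat; lra.
  - rewrite q2_imag. f_equal. replace (- (PI * (- ln r / PI))) with (ln r) by (field; lra).
    apply exp_ln. lra.
Qed.

(** Convergence at points of the imaginary axis bounds the terms at every radius below 1, so a
    merely pointwise expansion is automatically absolutely convergent. *)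
Lemma has_q_expansion_qexp f a : has_q_expansion 2 f a ->
  tame a /\ forall z, upper z -> f z = PS a (q_ 2 z).
Proof.
  intros H. assert (Ha : tame a).
  { apply tame_of_bounded. intros r Hr. destruct (q2_surj r Hr) as [z [Hz E]].
    destruct (is_C_series_bounded _ _ (H z Hz)) as [B HB]. exists B. intros n.
    specialize (HB n). rewrite E, Cmod_mult, Cmod_pow, Cmod_R, Rabs_pos_eq in HB; lra. }
  split; auto. intros z Hz. apply (is_C_series_unique _ _ _ (H z Hz)).
  apply hasSum_is_series, PS_correct; auto. apply Cmod_q_lt; auto.
Qed.

Definition SL_1 : SL2Z := mkSL2Z 1 0 0 1 eq_refl.
Definition SL_T : SL2Z := mkSL2Z 1 1 0 1 eq_refl.

Lemma slash_1 k f z : slash k f SL_1 z = f z.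
Proof.
  unfold slash, mobius, autj. simpl m_a. simpl m_b. simpl m_c. simpl m_d.
  change (CZ 0) with (RtoC 0). change (CZ 1) with (RtoC 1).
  replace (0 * z + 1)%C with (RtoC 1) by ring.
  replace ((1 * z + 0) / 1)%C with z by field. rewrite Cpow_1_l. field.
Qed.

Lemma slash_T k f z : slash k f SL_T z = f (z + 1)%C.
Proof.
  unfold slash, mobius, autj. simpl m_a. simpl m_b. simpl m_c. simpl m_d.
  change (CZ 0) with (RtoC 0). change (CZ 1) with (RtoC 1).
  replace (0 * z + 1)%C with (RtoC 1) by ring.
  replace ((1 * z + 1) / 1)%C with (z + 1)%C by field. rewrite Cpow_1_l. field.
Qed.

Lemma modular_form_qexp k f : modular_form k f ->
  (exists a, tame a /\ forall z, upper z -> f z = PS a (q_ 2 z)) /\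
  (forall z, upper z -> f (z + 1)%C = f z).
Proof.
  intros [_ [Hg Hq]]. split.
  - destruct (Hq SL_1) as [a Ha]. exists a.
    apply has_q_expansion_qexp. intros z Hz. rewrite <- (slash_1 k f z). apply Ha; auto.
  - intros z Hz. rewrite <- (slash_T k f z). apply Hg; auto. exists 0%Z. auto.
Qed.

Lemma conv_lead a b N : (forall j, (j < N)%nat -> b j = RtoC 0) -> conv a b N = (a O * b N)%C.
Proof.
  intros H. unfold conv, fib. cbn [fst snd].
  pose (F := fun mn : nat * nat =>
    if Nat.eqb (fst mn + snd mn) N then (a (fst mn) * b (snd mn))%C else RtoC 0).
  assert (H1 : hasSum F (lsum F (list_prod (seq 0 (S N)) (seq 0 (S N))))).
  { apply hasSum_finite; [apply NoDup_list_prod; apply seq_NoDup|].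
    intros [m n] Hmn. unfold F. simpl. destruct (Nat.eqb_spec (m + n) N); auto.
    exfalso. apply Hmn, in_prod; apply in_seq; lia. }
  assert (H2 : hasSum F (F (O, N))).
  { apply (hasSum_single (O, N) F). intros [m n] Hmn. unfold F. simpl.
    destruct (Nat.eqb_spec (m + n) N) as [E|E]; auto.
    destruct (Nat.eq_dec n N) as [->|Hn].
    - exfalso. apply Hmn. f_equal. lia.
    - rewrite (H n) by lia. ring. }
  assert (E := hasSum_unique _ _ _ H1 H2).
  transitivity (F (O, N)).
  - rewrite <- E. apply lsum_ext. intros [m n] _. reflexivity.
  - unfold F. simpl. rewrite Nat.eqb_refl. auto.
Qed.

Definition sfc : nat -> C := lamc (nm one1) one1.
Definition pqc (n : nat) : C := (dl 1 n + 8 * (sfc n + -4 * spread sfc n))%C.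

Lemma tame_pqc : tame pqc.
Proof.
  apply (tame_plus (dl 1) (fun n => (8 * (sfc n + -4 * spread sfc n))%C)); [apply tame_dl|].
  apply tame_scal. apply tame_plus; [unfold sfc; auto with tame|].
  apply tame_scal, tame_spread. unfold sfc; auto with tame.
Qed.

Lemma PS_pqc (x : C) : Cmod x < 1 -> PS pqc x = cE2q x.
Proof.
  intros Hx. assert (Hs : tame sfc) by (unfold sfc; auto with tame).
  assert (Hs2 : tame (spread sfc)) by (apply tame_spread; auto).
  unfold pqc. rewrite (PS_plus (dl 1) (fun n => (8 * (sfc n + -4 * spread sfc n))%C));
    auto using tame_dl with tame.
  rewrite PS_dl, (PS_scal 8 (fun n => (sfc n + -4 * spread sfc n)%C)) by auto with tame.
  rewrite (PS_plus sfc (fun n => (-4 * spread sfc n)%C)), PS_scal, PS_spread by auto with tame.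
  unfold cE2q, Sf, Lam. fold sfc. ring.
Qed.

Definition pc2 : nat -> C := spread pqc.

Lemma tame_pc2 : tame pc2.
Proof. apply tame_spread, tame_pqc. Qed.

Lemma pc2_0 : pc2 O = RtoC 1.
Proof.
  unfold pc2, spread, pqc, spread, sfc. simpl Nat.even. simpl Nat.div2. cbv iota.
  rewrite lamc_0. simpl. ring.
Qed.

Lemma Pz_pc2 z : upper z -> Pz z = PS pc2 (q_ 2 z).
Proof.
  intros Hz. unfold pc2, Pz. rewrite PS_spread, q_sqr; auto using tame_pqc.
  - rewrite PS_pqc; auto. apply Cmod_sqr_lt, Cmod_q_lt; auto.
  - apply Cmod_q_lt; auto.
Qed.

(** The factor [1/2] appears because the expansion variable is the square root of [q]. *)
Lemma thd_PS2 a z : tame a -> upper z ->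
  thd (fun z => PS a (q_ 2 z)) z (/ 2 * PS (nm a) (q_ 2 z))%C.
Proof.
  intros Ha Hz. assert (H := Cmod_q_lt 2 z ltac:(lia) Hz).
  eapply Cder_eq; [apply (Cder_comp (PS a) (q_ 2)); [apply Cder_PS; auto | apply Cder_q_; lia]|].
  unfold nm. rewrite <- PS_theta, CN_2 by auto. field.
Qed.

Lemma thd_unique f z d d' : thd f z d -> thd f z d' -> d = d'.
Proof.
  intros H H'. rewrite <- (qD_thd _ _ _ H). apply qD_thd; auto.
Qed.

Lemma dPz_pc2 z : upper z -> ((Pz z * Pz z - Qz z) / 4)%C = (/ 2 * PS (nm pc2) (q_ 2 z))%C.
Proof.
  intros Hz. apply (thd_unique cE2 z).
  - apply thd_cE2; auto.
  - apply thd_upper_ext with (fun z => PS pc2 (q_ 2 z)); auto.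
    + intros w Hw. rewrite cE2_cE2q by auto. symmetry. apply Pz_pc2; auto.
    + apply thd_PS2; auto using tame_pc2.
Qed.

(* The equation in terms of the expansion coefficients [a] of a solution. *)
Definition odec (m : nat) (a : nat -> C) (n : nat) : C :=
  (/ 4 * nm (nm a) n + (- ((2 * CN m + 1) / 4) * conv pc2 (nm a) n +
    2 * CN m * (2 * CN m + 1) / 8 * conv (nm pc2) a n))%C.

Definition odev (m : nat) (a : nat -> C) (x : C) : C :=
  (/ 4 * PS (nm (nm a)) x - (2 * CN m + 1) / 2 * PS pc2 x * (/ 2 * PS (nm a) x) +
    2 * CN m * (2 * CN m + 1) / 4 * (/ 2 * PS (nm pc2) x) * PS a x)%C.

Lemma PS_odec m a (x : C) : tame a -> Cmod x < 1 -> PS (odec m a) x = odev m a x.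
Proof.
  intros Ha Hx. assert (Hp := tame_pc2). unfold odec.
  rewrite (PS_plus (fun n => (/ 4 * nm (nm a) n)%C)
    (fun n => (- ((2 * CN m + 1) / 4) * conv pc2 (nm a) n +
      2 * CN m * (2 * CN m + 1) / 8 * conv (nm pc2) a n)%C)) by auto with tame.
  rewrite (PS_plus (fun n => (- ((2 * CN m + 1) / 4) * conv pc2 (nm a) n)%C)
    (fun n => (2 * CN m * (2 * CN m + 1) / 8 * conv (nm pc2) a n)%C)) by auto with tame.
  rewrite !PS_scal, !PS_conv by auto with tame. unfold odev. field.
Qed.

Lemma ode_odev m f a : tame a -> (forall z, upper z -> f z = PS a (q_ 2 z)) ->
  ode_solution (2 * m) f -> forall z, upper z -> odev m a (q_ 2 z) = RtoC 0.
Proof.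
  intros Ha Hf Hode z Hz.
  assert (H1 : forall w, upper w -> thd f w (/ 2 * PS (nm a) (q_ 2 w))%C).
  { intros w Hw. apply thd_upper_ext with (fun z => PS a (q_ 2 z)); auto.
    - intros v Hv. symmetry. auto.
    - apply thd_PS2; auto. }
  assert (H2 : thd (qD f) z (/ 2 * (/ 2 * PS (nm (nm a)) (q_ 2 z)))%C).
  { apply thd_upper_ext with (fun z => (/ 2 * PS (nm a) (q_ 2 z))%C); auto.
    - intros v Hv. symmetry. apply qD_thd; auto.
    - apply thd_scal, thd_PS2; auto with tame. }
  destruct (Hode z Hz) as [_ [_ [_ E]]].
  rewrite (qD_thd _ _ _ H2), (qD_thd _ _ _ (H1 z Hz)), (qD_thd _ _ _ (thd_cE2 z Hz)) in E.
  fold (Qz z) in E. rewrite cE2_cE2q in E by auto. fold (Pz z) in E.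
  rewrite dPz_pc2, Pz_pc2, Hf in E by auto. rewrite <- E. unfold odev.
  rewrite CN_mul, CN_2. field.
Qed.

(** Translation by 1 replaces the variable by its negative, so each odd coefficient equals its own
    negative. *)
Lemma even_coef a : tame a ->
  (forall z, upper z -> PS a (q_ 2 (z + 1)) = PS a (q_ 2 z)) ->
  forall n, Nat.even n = false -> a n = RtoC 0.
Proof.
  intros Ha H n Hn.
  assert (Hz : forall n, (RtoC (-1) ^ n * a n + -1 * a n)%C = RtoC 0).
  { apply (PS_coef_0 (fun n => (RtoC (-1) ^ n * a n + -1 * a n)%C)).
    - apply tame_plus; [apply tame_alternate; auto | auto with tame].
    - intros x Hx. destruct (q2_surj x Hx) as [z [Hz E]].
      assert (Hx1 : Cmod (RtoC x) < 1) by (rewrite Cmod_R, Rabs_pos_eq; lra).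
      rewrite (PS_plus (fun n => (RtoC (-1) ^ n * a n)%C) (fun n => (-1 * a n)%C));
        auto using tame_alternate with tame.
      rewrite PS_opp, PS_scal by auto. specialize (H z Hz). rewrite q2_add_1, E in H.
      rewrite H. ring. }
  specialize (Hz n).
  assert (E : (RtoC (-1) ^ n)%C = RtoC (-1)).
  { assert (Ho : Nat.odd n = true) by (rewrite <- Nat.negb_even, Hn; auto).
    apply Nat.odd_spec in Ho. destruct Ho as [j ->].
    rewrite Cpow_add_r, pow_2mul. replace (RtoC (-1) * RtoC (-1))%C with (RtoC 1) by ring.
    rewrite Cpow_1_l. simpl. ring. }
  rewrite E in Hz. replace (a n) with (- / 2 * (RtoC (-1) * a n + -1 * a n))%C by field.
  rewrite Hz. ring.
Qed.

(* The indicial equation [N (N - k - 1) = 0] (in powers of the square root of [q]) has no even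
   solution other than [0]. *)
Lemma odec_0 m b : (forall n, odec m b n = RtoC 0) -> b O = RtoC 0 ->
  (forall n, Nat.even n = false -> b n = RtoC 0) -> forall n, b n = RtoC 0.
Proof.
  intros HL H0 Hodd n. induction n as [n IH] using lt_wf_ind.
  destruct (Nat.even n) eqn:En; [|auto]. destruct (Nat.eq_dec n 0) as [->|Hn]; auto.
  specialize (HL n). unfold odec in HL.
  rewrite (conv_lead pc2 (nm b)) in HL.
  2:{ intros j Hj. unfold nm. rewrite IH by auto. ring. }
  rewrite (conv_lead (nm pc2) b) in HL by auto.
  rewrite pc2_0 in HL. unfold nm in HL. rewrite CN_0 in HL.
  apply Nat.even_spec in En. destruct En as [j Hj].
  assert (Hk : (CN n - (2 * CN m + 1))%C <> RtoC 0).
  { intros E. assert (E2 : CN n = CN (2 * m + 1)).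
    { rewrite CN_add, CN_mul, CN_2, CN_1. replace (CN n) with ((CN n - (2 * CN m + 1)) + (2 * CN m + 1))%C by ring.
      rewrite E. ring. }
    apply CN_inj in E2. lia. }
  assert (Hn0 : CN n <> RtoC 0) by (apply CN_nz; lia).
  (* When all lower coefficients vanish, [odec m b n] reduces to [n (n - 2 m - 1) / 4] times
     [b n]. *)
  match type of HL with ?l = _ =>
    replace (b n) with (4 * l / (CN n * (CN n - (2 * CN m + 1))))%C by (field; auto) end.
  rewrite HL. unfold Cdiv. ring.
Qed.

(** Subtracting the multiple of [hyp_form] with the same constant term leaves an expansion [b] that
    satisfies the recursion, has zero constant term and, by translation invariance, only even
    powers; [odec_0] then makes it vanish. *)
Lemma uniqueness m f : modular_form (2 * m) f -> ode_solution (2 * m) f ->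
  exists c, forall z, upper z -> f z = (c * hyp_form (2 * m) z)%C.
Proof.
  intros Hm Hode.
  destruct (modular_form_qexp _ _ Hm) as [[a [Ha Hfa]] HT].
  destruct (qexp_1_2 _ _ (qexp_hyp (2 * m))) as [h [Hh [h0 Hfh]]].
  set (c := a O).
  pose (b := fun n => (a n + - c * h n)%C).
  assert (Hb : tame b) by (unfold b; auto with tame).
  assert (Eb : forall x, Cmod x < 1 -> PS b x = (PS a x + - c * PS h x)%C).
  { intros x Hx. unfold b. rewrite (PS_plus a (fun n => (- c * h n)%C)), PS_scal by auto with tame.
    auto. }
  assert (Enb : forall x, Cmod x < 1 -> PS (nm b) x = (PS (nm a) x + - c * PS (nm h) x)%C).
  { intros x Hx. rewrite (PS_ext (nm b) (fun n => (nm a n + - c * nm h n)%C))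
      by (intros n; unfold nm, b; ring).
    rewrite (PS_plus (nm a) (fun n => (- c * nm h n)%C)), PS_scal by auto with tame. auto. }
  assert (Ennb : forall x, Cmod x < 1 ->
    PS (nm (nm b)) x = (PS (nm (nm a)) x + - c * PS (nm (nm h)) x)%C).
  { intros x Hx. rewrite (PS_ext (nm (nm b)) (fun n => (nm (nm a) n + - c * nm (nm h) n)%C))
      by (intros n; unfold nm, b; ring).
    rewrite (PS_plus (nm (nm a)) (fun n => (- c * nm (nm h) n)%C)), PS_scal by auto with tame. auto. }
  assert (Hb0 : forall n, b n = RtoC 0).
  { apply (odec_0 m).
    - apply PS_coef_0.
      + assert (Hp := tame_pc2). unfold odec. auto 10 with tame.
      + intros x Hx. destruct (q2_surj x Hx) as [z [Hz E]].
        assert (Hx1 : Cmod (RtoC x) < 1) by (rewrite Cmod_R, Rabs_pos_eq; lra).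
        rewrite PS_odec by auto.
        assert (E1 := ode_odev m f a Ha Hfa Hode z Hz).
        assert (E2 := ode_odev m _ h Hh Hfh (ode_intro _ _ _ _ (ode_hyp m)) z Hz).
        rewrite E in E1, E2. unfold odev in *. rewrite Eb, Enb, Ennb by auto.
        match type of E1 with ?l1 = _ => match type of E2 with ?l2 = _ =>
          transitivity (l1 + - c * l2)%C; [ring|] end end.
        rewrite E1, E2. ring.
    - unfold b. rewrite h0. fold c. ring.
    - apply even_coef; auto. intros z Hz. assert (Hz1 := upper_add_1 z Hz).
      rewrite !Eb by (apply Cmod_q_lt; auto).
      rewrite <- !Hfa, <- !Hfh, HT by auto.
      rewrite !hyp_form_hp, e2_add_1, D_add_1; auto. }
  exists c. intros z Hz. rewrite Hfa, Hfh by auto.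
  assert (Hq := Cmod_q_lt 2 z ltac:(lia) Hz).
  assert (E : PS b (q_ 2 z) = RtoC 0).
  { rewrite (PS_ext b (dl 0)), PS_dl; auto. intros n. rewrite Hb0. destruct n; auto. }
  rewrite Eb in E by auto.
  replace (PS a (q_ 2 z)) with ((PS a (q_ 2 z) + - c * PS h (q_ 2 z)) + c * PS h (q_ 2 z))%C by ring.
  rewrite E. ring.
Qed.

Lemma modular_scal m f c : (forall z, upper z -> f z = (c * hyp_form (2 * m) z)%C) ->
  modular_form (2 * m) f.
Proof.
  intros Hf. destruct (qexp_hypS (2 * m)) as [c1 Hc].
  apply modular_form_intro with (f1 := fun z => (c * hypS (2 * m) z)%C) (c := (c * 1)%C)
    (c1 := (c * c1)%C).
  - exists m. auto.
  - intros z Hz. eexists.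
    apply Cder_upper_ext with (fun z => (c * hyp_form (2 * m) z)%C); auto.
    + intros w Hw. symmetry. auto.
    + apply Cder_scal. apply (thd_f0 m z Hz).
  - intros z Hz. rewrite !Hf, !hyp_form_hp, e2_add_1, D_add_1; auto using upper_add_1.
  - intros z Hz. rewrite Hf, hyp_S by (auto using upper_inv). ring.
  - intros z Hz. unfold hypS, az, bz. rewrite q2_add_2. auto.
  - apply qexp_ext with (fun z => (c * hyp_form (2 * m) z)%C); [intros; symmetry; auto|].
    apply qexp_scal; auto. apply qexp_1_2, qexp_hyp.
  - apply qexp_scal; auto.
Qed.

Theorem theorem3p3 (k : nat) (hk4 : (4 <= k)%nat) (hkeven : Nat.Even k) :
  (* the polynomial [hyp_form k] is the displayed hypergeometric expression *)
  (forall z, upper z -> e2 z <> RtoC 0 ->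
     hyp_form k z =
     (e2 z ^ (k / 2) * hyperF (hyp_a k) (hyp_b k) (hyp_c k) (64 / j2 z))%C) /\
  (* it is a normalized modular form of weight k solving the equation *)
  modular_form k (hyp_form k) /\
  normalized (hyp_form k) /\
  ode_solution k (hyp_form k) /\
  (* and it generates the space of modular solutions of weight k *)
  (forall f : C -> C,
     (modular_form k f /\ ode_solution k f) <->
     exists c : C, forall z, upper z -> f z = (c * hyp_form k z)%C).
Proof.
  destruct hkeven as [m ->].
  split; [|split; [|split; [|split]]].
  - intros z _ He. apply hyp_form_hyperF; auto.
  - apply (modular_scal m _ 1). intros z _. ring.
  - apply qexp_has; [lia | apply qexp_hyp].
  - apply (ode_intro _ _ _ _ (ode_hyp m)).
  - intros f. split.
    + intros [H1 H2]. apply uniqueness; auto.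
    + intros [c Hc]. split.
      * apply (modular_scal m f c Hc).
      * apply (ode_intro _ _ _ _ (ode_data_scal _ _ _ _ f c (ode_hyp m) Hc)).
Qed.
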